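(* Let $G$ be a totally disconnected, locally compact group of type (JB), with $\mathrm{QZ}(G)=\{1\}$. Then $\mathrm{Res}(G)$ is a direct factor of an open subgroup of $G$ and admits a decomposition into finitely many directly indecomposable direct factors $$\mathrm{Res}(G) = P_1 \times P_2 \times \dots \times P_n,$$ which we call the components of $G$, with the following properties. (i) Every direct factor of $\mathrm{Res}(G)$ is a direct product of a subset of the components. (ii) Each component $P$ is noncompact, but locally isomorphic to a just infinite profinite branch group, and we have $\mathcal{LN}(P)^P = \{0,\infty\}$. Moreover, $G$ does not normalize any proper nontrivial closed subgroup of $P$. (iii) Given $1 \le i \le n$, exactly one of the following holds: (Mysterious type) $P_i$ is residually discrete; (Simple type) $P_i$ is topologically simple.
   Context: All groups are locally compact Hausdorff topological groups; ''t.d.l.c.'' means totally disconnected locally compact. Direct products carry the product topology; direct factors are closed subgroups. The number $n$ of components may be zero. The quasi-centre $\mathrm{QZ}(G)$ is the set of elements of $G$ with open centralizer. $\mathrm{Res}(G)$ is the intersection of all open normal subgroups of $G$; $G$ is residually discrete if $\mathrm{Res}(G)=\{1\}$. A subgroup of $G$ is locally normal if its normalizer is open in $G$. Two subgroups $H,K$ are locally equivalent if $H\cap K$ is open in both; $[H]$ denotes the local equivalence class. The structure lattice $\mathcal{LN}(G)$ is the set of classes $[H]$ of closed locally normal subgroups $H$ of $G$, ordered by inclusion of representatives, with least element $0=[\{1\}]$ and greatest element $\infty=[G]$; $G$ acts on it by conjugation and $\mathcal{LN}(G)^G$ denotes the set of fixed points. Two t.d.l.c. groups $H,K$ are locally isomorphic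 if there is a continuous injective open homomorphism from an open subgroup of $H$ to $K$. A profinite group is just infinite if it is infinite and every nontrivial closed normal subgroup has finite index. A branch group is a compact or discrete group $G$ acting faithfully by automorphisms on a locally finite rooted tree with root $\varepsilon$, such that for each sphere of vertices $S_n(\varepsilon)$ around the root, $G$ acts transitively on $S_n(\varepsilon)$ and a finite index subgroup of $G$ splits as a direct product $\prod_{v\in S_n(\varepsilon)}R_v$, where $R_v$ fixes all vertices not descended from $v$. Type (JB): a nondiscrete t.d.l.c. group $G$ is of type (JB) if $\mathrm{QZ}(G)$ is discrete, $\mathcal{LN}(G)$ is infinite, $G/\mathrm{QZ}(G)$ acts faithfully on $\mathcal{LN}(G)$ and $G$ is locally isomorphic to a just infinite profinite branch group. *)

(* Defs.v *)
From HB Require Import structures.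
From mathcomp Require Import all_boot all_order finmap.
From mathcomp Require Import all_classical topology.

Set Implicit Arguments.
Unset Strict Implicit.
Unset Printing Implicit Defensive.

Local Open Scope classical_set_scope.
Local Open Scope group_scope.

HB.mixin Record Topological_isTopologicalGroup G & Topological G & Group G := {
  mulg_continuous : continuous (fun x : G * G => x.1 * x.2) ;
  invg_continuous : continuous (fun x : G => x^-1)
}.

#[short(type="topGroupType")]
HB.structure Definition TopologicalGroup :=
  {G of Topological G & Group G & Topological_isTopologicalGroup G}.

(* As with {group gT} in fingroup, the groups under consideration are subsets
   H of an ambient topological group G, with the subspace topology; an abstract
   topological group G is the case H = [set: G]. *)

Section Subgroups.
Context {G : topGroupType}.
Implicit Types A B H K N : set G.

Definition is_subgroup H :=
  [/\ H 1, (forall x y, H x -> H y -> H (x * y)) & (forall x, H x -> H x^-1)].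

Definition open_in H A := exists2 U : set G, open U & A = H `&` U.
Definition closed_in H A := exists2 C : set G, closed C & A = H `&` C.

Definition discrete H := forall x, H x -> open_in H [set x].

Definition conj_set A (g : G) : set G := [set x ^ g | x in A].

Definition normalizer H A := [set g | H g /\ conj_set A g = A].

Definition normal_in H N :=
  [/\ is_subgroup N, N `<=` H & normalizer H N = H].

Definition finite_index H K :=
  finite_set [set C : set G | exists2 g, H g & C = [set g * k | k in K]].

Definition QZ H : set G :=
  [set g | H g /\ open_in H [set h | H h /\ commute g h]].

Definition Res H : set G :=
  [set g | H g /\ forall N, normal_in H N -> open_in H N -> N g].

Definition residually_discrete H := Res H = [set 1].

Definition topologically_simple H :=
  H <> [set 1] /\
  forall N, normal_in H N -> closed_in H N -> N = [set 1] \/ N = H.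

Definition locally_normal H A :=
  [/\ is_subgroup A, A `<=` H & open_in H (normalizer H A)].

Definition locally_equivalent A B :=
  open_in A (A `&` B) /\ open_in B (A `&` B).

(* The class [A] consists of all locally equivalent subgroups of H, closed or
   not; only in LN is the representative A required to be closed. *)
Definition local_class H A : set (set G) :=
  [set B | [/\ is_subgroup B, B `<=` H & locally_equivalent A B]].

Definition LN H : set (set (set G)) :=
  [set a | exists A,
     [/\ locally_normal H A, closed_in H A & a = local_class H A]].

Definition LN0 H : set (set G) := local_class H [set 1].
Definition LNoo H : set (set G) := local_class H H.

Definition conj_class (a : set (set G)) (g : G) : set (set G) :=
  [set conj_set A g | A in a].

Definition LN_fixed H : set (set (set G)) :=
  [set a | LN H a /\ forall g, H g -> conj_class a g = a].

Definition LN_kernel H : set G :=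
  [set g | H g /\ forall a, LN H a -> conj_class a g = a].

(* Internal direct product: multiplication is an isomorphism of topological
   groups from the product of the P i (product topology) onto H. *)
Definition direct_product (I : finType) (P : I -> set G) H :=
  let D : set (prod_topology (fun _ : I => G)) :=
    [set x | forall i, P i (x i)] in
  let m (x : prod_topology (fun _ : I => G)) : G := \big[*%g/1]_(i : I) x i in
  [/\ forall i, is_subgroup (P i) /\ closed_in H (P i),
      forall x y, D x -> D y -> m (fun i => x i * y i) = m x * m y,
      set_bij D H m,
      {within D, continuous m} &
      forall U, open U -> open_in H (m @` (D `&` U))].

Definition direct_product2 A B H :=
  direct_product (fun b : bool => if b then A else B) H.

Definition direct_factor A H := exists B, direct_product2 A B H.

Definition directly_indecomposable H :=
  H <> [set 1] /\
  forall A B, direct_product2 A B H -> A = [set 1] \/ B = [set 1].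

End Subgroups.

Definition locally_isomorphic (G1 G2 : topGroupType)
    (H : set G1) (K : set G2) :=
  exists (U : set G1) (f : G1 -> G2),
  [/\ is_subgroup U /\ open_in H U,
      set_fun U K f /\ (forall x y, U x -> U y -> f (x * y) = f x * f y),
      set_inj U f,
      {within U, continuous f} &
      forall A, open_in U A -> open_in K (f @` A)].

Definition tdlc (G : topGroupType) :=
  [/\ hausdorff_space G, locally_compact [set: G] &
      totally_disconnected [set: G]].

Definition profinite (G : topGroupType) :=
  [/\ hausdorff_space G, compact [set: G] & totally_disconnected [set: G]].

Definition just_infinite (G : topGroupType) :=
  infinite_set [set: G] /\
  forall N : set G, normal_in [set: G] N -> closed N -> N <> [set 1] ->
    finite_index [set: G] N.

Section Trees.
Context {V : choiceType}.
Implicit Types (e : rel V) (r v w : V).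

(* p lists the vertices after v, so its size is the number of edges. *)
Definition simple_path e v (p : seq V) w :=
  [/\ path e v p, uniq (v :: p) & last v p = w].

Definition is_tree e :=
  [/\ symmetric e, irreflexive e &
      forall v w, exists! p, simple_path e v p w].

Definition locally_finite e := forall v, finite_set [set w | e v w].

Definition sphere e r (n : nat) : set V :=
  [set v | exists2 p, simple_path e r p v & size p = n].

(* w descends from v: v lies on the path from the root r to w (v = w allowed) *)
Definition descends e r v w :=
  exists2 p, simple_path e r p w & v \in r :: p.

End Trees.

(* Actions of topological groups are continuous, i.e. vertex stabilizers are
   open; this is automatic for discrete G. *)
Definition rooted_tree_action (G : topGroupType) (V : choiceType) (e : rel V)
    (r : V) (act : G -> V -> V) :=
  [/\ (forall v, act 1 v = v) /\
      (forall g h v, act (g * h) v = act g (act h v)),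
      forall g v w, e (act g v) (act g w) = e v w,
      forall g, act g r = r &
      forall v, open [set g | act g v = v]].

Definition branch_group (G : topGroupType) :=
  (compact [set: G] \/ discrete [set: G]) /\
  exists (V : choiceType) (e : rel V) (r : V) (act : G -> V -> V),
  [/\ is_tree e, locally_finite e, rooted_tree_action e r act,
      (forall g, (forall v, act g v = v) -> g = 1) &
      forall n : nat,
        (forall v w, sphere e r n v -> sphere e r n w ->
           exists g, act g v = w) /\
        exists (K : set G) (S : {fset V}) (R : S -> set G),
        [/\ is_subgroup K /\ closed K,
            finite_index [set: G] K,
            [set` S] = sphere e r n,
            direct_product R K &
            forall (v : S) g w, R v g -> ~ descends e r (val v) w ->
              act g w = w]].

Definition loc_just_infinite_branch (G : topGroupType) (H : set G) :=
  exists B : topGroupType,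
    [/\ profinite B, just_infinite B, branch_group B &
        locally_isomorphic H [set: B]].

(* G / QZ(G) acts faithfully on LN(G) iff the kernel of the action of G is
   exactly QZ(G). The predicate is only meant for t.d.l.c. groups G. *)
Definition type_JB (G : topGroupType) :=
  [/\ ~ discrete [set: G],
      discrete (QZ [set: G]),
      infinite_set (LN [set: G]),
      LN_kernel [set: G] = QZ [set: G] &
      loc_just_infinite_branch [set: G]].

(* Main.v *)
(* Let B be the given just infinite branch group. A closed subgroup of B that
   is normalised by a level stabiliser and moves a vertex w contains the
   commutators of the rigid stabiliser of w, hence (B being just infinite) an
   open subgroup of it. As the number of orbits of a level stabiliser on deeper
   levels is bounded, every closed locally normal subgroup of B is locally a
   product of rigid stabilisers of vertices of one fixed level, and an arbitrary
   such product is locally isomorphic to a just infinite branch group: the group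
   acting piecewise by elements of B on the forest below the chosen vertices.

   In G, where QZ(G) = 1, a closed locally normal subgroup K thus satisfies
   K /\ C(K) = 1, K C(K) is open, C(K) depends only on the local class of K, and
   only finitely many K = C(C(K)) are normalised by a given open subgroup. For
   R = Res(G) and the open normal subgroup O = R C(R), let the atoms be the
   minimal nontrivial X = C(C(X)) <= C(C(R)) normalised by O. There are finitely
   many of them, they commute pairwise, and the components are the R /\ X.
   If a G-equivariant choice of open subgroups kappa(X) of R /\ X is made, the
   intersection of the kappa(X) C(X) is open and normal in G, hence contains R,
   so that kappa(X) = R /\ X. With kappa(X) = R /\ X this gives the direct
   decomposition of R; with the residual of R /\ X it gives the dichotomy
   between mysterious and simple type; with a G-normal subgroup of R /\ X it
   gives the last part of (ii); and with the intersection of the maximal open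
   normal subgroups, nontrivial and proper if R /\ X is compact, it gives
   noncompactness. *)

Require Import Defs.
From HB Require Import structures.
From mathcomp Require Import all_boot all_order finmap.
From mathcomp Require Import all_classical topology.

Set Implicit Arguments.
Unset Strict Implicit.
Unset Printing Implicit Defensive.

Local Open Scope classical_set_scope.
Local Open Scope group_scope.

(** * Centralisers in abstract groups *)

Section GroupSets.
Context {G : groupType}.
Implicit Types (x y z g : G) (S : set G).

(** The branch group is visible in G only near 1, whereas the components are not compact. The bridge
    is [commute_near_eq1]: as QZ(G) = 1, an element commuting with a neighbourhood of 1 is trivial.
    It turns statements about germs at 1 into statements about whole subgroups. The hard case is C(K
    /\ W n) = C(K), since there neither of the two commuting elements is near 1. Atoms are taken
    relative to O and not to G because O acts on an atom X as R /\ X does, modulo C(X). So a normal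
    subgroup of a component is normalised by O and the minimality of X applies to it; minimality
    under G would only see whole conjugacy classes of components. As O is normal, G still permutes
    the atoms, and intersecting over a G-stable family of them produces a normal subgroup of G. On
    the side of B, the vertex set Y attached to a subgroup is arbitrary, and a product of several
    rigid stabilisers is not just infinite. Elements permuting the factors have to be added, but B
    itself need not contain elements that permute Y suitably: hence the group of piecewise
    elements. *)

Definition cent S : set G := [set g | forall x, S x -> commute g x].

Lemma commuteV1 x y : commute x y -> commute x^-1 y.
Proof. by move=> /commute_sym/commuteV/commute_sym. Qed.

Lemma commuteJ x y g : commute x y -> commute (x ^ g) (y ^ g).
Proof. by move=> cxy; rewrite /commute -!conjMg cxy. Qed.

Lemma cent_anti S S' : S `<=` S' -> cent S' `<=` cent S.
Proof. by move=> sS g Cg x /sS; apply: Cg. Qed.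

Lemma sub_centC S S' : S `<=` cent S' -> S' `<=` cent S.
Proof. by move=> sS x S'x y Sy; apply/commute_sym/sS. Qed.

Lemma sub_cent2 S : S `<=` cent (cent S).
Proof. exact: sub_centC. Qed.

Lemma cent3 S : cent (cent (cent S)) = cent S.
Proof.
by apply/seteqP; split; [exact/cent_anti/sub_cent2 | exact: sub_cent2].
Qed.

Lemma conj_fix x g : commute x g -> x ^ g = x.
Proof. by rewrite conjgE => ->; rewrite mulKg. Qed.

End GroupSets.

(** * Subgroups, conjugation and normalisation *)

Section TopGroup.
Context {G : topGroupType}.
Implicit Types (x y z g : G) (H K N U V : set G).

Lemma subg1 H : is_subgroup H -> H 1. Proof. by case. Qed.
Lemma subgM H x y : is_subgroup H -> H x -> H y -> H (x * y).
Proof. by case=> _ h _; apply: h. Qed.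
Lemma subgV H x : is_subgroup H -> H x -> H x^-1.
Proof. by case=> _ _ h; apply: h. Qed.
Lemma subgJ H x y : is_subgroup H -> H x -> H y -> H (x ^ y).
Proof. by move=> sH Hx Hy; apply: subgM (subgV sH Hy) (subgM sH Hx Hy). Qed.
Lemma subgVP H x : is_subgroup H -> H x^-1 -> H x.
Proof. by move=> sH Hx; rewrite -(invgK x); apply: subgV Hx. Qed.
Lemma subg_cancell H x y : is_subgroup H -> H x -> H (x * y) -> H y.
Proof. by move=> sH Hx Hxy; rewrite -(mulKg x y); apply: subgM (subgV sH Hx) Hxy. Qed.
Lemma subg_cancelr H x y : is_subgroup H -> H y -> H (x * y) -> H x.
Proof. by move=> sH Hy Hxy; rewrite -(mulgK y x); apply: subgM Hxy (subgV sH Hy). Qed.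

Lemma is_subgroupT : is_subgroup [set: G]. Proof. by split. Qed.

Lemma is_subgroup1 : is_subgroup [set (1 : G)].
Proof. by split=> // [x y -> ->|x ->] /=; rewrite ?mulg1 ?invg1. Qed.

Lemma is_subgroupI H K : is_subgroup H -> is_subgroup K ->
  is_subgroup (H `&` K).
Proof.
by move=> sH sK; split=> [|x y [? ?] [? ?]|x [? ?]]; split;
  [exact: subg1|exact: subg1|exact: subgM|exact: subgM|exact: subgV|exact: subgV].
Qed.

Lemma is_subgroup_bigcap I (D : set I) (F : I -> set G) :
  (forall i, D i -> is_subgroup (F i)) -> is_subgroup (\bigcap_(i in D) F i).
Proof.
move=> sF; split=> [i Di|x y Fx Fy i Di|x Fx i Di].
- exact: (subg1 (sF i Di)).
- exact: (subgM (sF i Di) (Fx i Di) (Fy i Di)).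
- exact: (subgV (sF i Di) (Fx i Di)).
Qed.

Lemma is_subgroup_cent H : is_subgroup (cent H).
Proof.
split=> [x _|x y Cx Cy z Hz|x Cx z Hz].
- by rewrite /commute mul1g mulg1.
- by apply/commute_sym/commuteM; apply/commute_sym; [exact: Cx|exact: Cy].
- exact/commuteV1/Cx.
Qed.

Definition normalised V K := forall v x, V v -> K x -> K (x ^ v).

Lemma normalisedP V K v x : is_subgroup V -> normalised V K -> V v ->
  K (x ^ v) <-> K x.
Proof.
move=> sV nK Vv; split; last exact: nK.
by move=> /(nK v^-1); rewrite conjgK; apply; exact: subgV.
Qed.

Lemma conj_setE K g : conj_set K g = [set x | K (x ^ g^-1)].
Proof.
apply/seteqP; split=> [_ [x Kx <-]|x Kx] /=; first by rewrite conjgK.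
by exists (x ^ g^-1); rewrite ?conjgKV.
Qed.

Lemma conj_set_sub H K g : is_subgroup H -> normalised H K -> H g ->
  conj_set K g = K.
Proof.
move=> sH nK Hg; rewrite conj_setE; apply/seteqP; split=> x /=.
  by move=> /(normalisedP _ sH nK); apply; exact: subgV.
by move=> Kx; apply: nK => //; exact: subgV.
Qed.

Lemma normal_inP H N : is_subgroup H ->
  normal_in H N <-> [/\ is_subgroup N, N `<=` H & normalised H N].
Proof.
move=> sH; split=> [[sN NH nN]|[sN NH nN]]; split=> //.
  move=> g x Hg Nx; have : normalizer H N g by rewrite nN.
  by case=> _ <-; exists x.
by apply/seteqP; split=> [g []|g Hg] //; split=> //; exact: conj_set_sub Hg.
Qed.

Lemma is_subgroup_conj_set H g : is_subgroup H -> is_subgroup (conj_set H g).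
Proof.
move=> sH; rewrite conj_setE; split=> [|x y|x] /=.
- by rewrite conj1g; exact: subg1.
- by rewrite conjMg; exact: subgM.
- by rewrite conjVg; exact: subgV.
Qed.

Lemma cent_conj_set H g : cent (conj_set H g) = conj_set (cent H) g.
Proof.
rewrite !conj_setE; apply/seteqP; split=> x Cx y Hy.
  have Hyg : [set x | H (x ^ g^-1)] (y ^ g) by rewrite /= conjgK.
  by have := commuteJ g^-1 (Cx _ Hyg); rewrite conjgK.
by have := commuteJ g (Cx _ Hy); rewrite !conjgKV.
Qed.

Lemma conj_set_mono H K g : H `<=` K -> conj_set H g `<=` conj_set K g.
Proof. by move=> HK x [y Hy <-]; exists y => //; apply: HK. Qed.

Lemma conj_setK H g : conj_set (conj_set H g) g^-1 = H.
Proof.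
by rewrite !conj_setE; apply/seteqP; split=> x /=; rewrite invgK conjgK.
Qed.

Lemma conj_setKV H g : conj_set (conj_set H g^-1) g = H.
Proof. by rewrite -{2}(invgK g) conj_setK. Qed.

Lemma conj_set1 H : conj_set H 1 = H.
Proof. by rewrite conj_setE; apply/seteqP; split=> x /=; rewrite invg1 conjg1. Qed.

Lemma normalised_cent V K : is_subgroup V -> normalised V K ->
  normalised V (cent K).
Proof.
move=> sV nK v x Vv Cx y Ky.
have := commuteJ v (Cx (y ^ v^-1) _); rewrite conjgKV; apply.
by apply: nK => //; exact: subgV.
Qed.

Lemma normalisedI V K L : normalised V K -> normalised V L ->
  normalised V (K `&` L).
Proof. by move=> nK nL v x Vv [Kx Lx]; split; [apply: nK|apply: nL]. Qed.

Lemma normalisedS V V' K : V `<=` V' -> normalised V' K -> normalised V K.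
Proof. by move=> sV nK v x /sV; apply: nK. Qed.

Lemma normalised_self V : is_subgroup V -> normalised V V.
Proof. by move=> sV v x Vv Vx; apply: subgJ. Qed.

(** * Topology *)

Lemma continuousM (T : topologicalType) (f g : T -> G) :
  continuous f -> continuous g -> continuous (fun t => f t * g t).
Proof.
move=> cf cg t; have /= := @continuous2_cvg T G G G (nbhs t) _ f g
  (fun x y => x * y) (f t) (g t).
apply; [exact: (mulg_continuous (f t, g t)) | exact: cf | exact: cg].
Qed.

Lemma continuousV (T : topologicalType) (f : T -> G) :
  continuous f -> continuous (fun t => (f t)^-1).
Proof. by move=> cf t; apply: cvg_comp (cf t) _; apply: invg_continuous. Qed.

Lemma continuous_mull g : continuous (fun x => g * x).
Proof. by apply: continuousM => // x; [exact: cvg_cst|exact: cvg_id]. Qed.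

Lemma continuous_mulr g : continuous (fun x => x * g).
Proof. by apply: continuousM => // x; [exact: cvg_id|exact: cvg_cst]. Qed.

Lemma continuous_conjl g : continuous (fun x => x ^ g).
Proof.
apply: (@continuousM _ (fun=> g^-1) (fun x => x * g)).
  by move=> x; exact: cvg_cst.
exact: continuous_mulr.
Qed.

Lemma continuous_conjr g : continuous (fun x => g ^ x).
Proof.
apply: (@continuousM _ (fun x => x^-1) (fun x => g * x)).
  by apply: continuousV => x; exact: cvg_id.
exact: continuous_mull.
Qed.

Lemma continuous_commg g : continuous (fun x => [~ g, x]).
Proof.
apply: (@continuousM _ (fun=> g^-1) (fun x => g ^ x)).
  by move=> x; exact: cvg_cst.
exact: continuous_conjr.
Qed.

Lemma open_preim (T S : topologicalType) (f : T -> S) (U : set S) :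
  continuous f -> open U -> open (f @^-1` U).
Proof. by move=> cf oU; apply: open_comp => // x _; exact: cf. Qed.

Lemma closed_preim (T S : topologicalType) (f : T -> S) (U : set S) :
  continuous f -> closed U -> closed (f @^-1` U).
Proof. by move=> cf oU; apply: closed_comp => // x _; exact: cf. Qed.

Lemma closed_conj_set K g : closed K -> closed (conj_set K g).
Proof. by rewrite conj_setE => cK; apply: closed_preim cK; exact: continuous_conjl. Qed.

Lemma open_coset U g : open U -> open [set x | U (g^-1 * x)].
Proof. exact: (open_preim (@continuous_mull g^-1)). Qed.

Lemma open_subg H U : is_subgroup H -> open U -> U 1 -> U `<=` H -> open H.
Proof.
move=> sH oU U1 UH; rewrite openE => x Hx.
rewrite /interior /= nbhsE; exists [set y | U (x^-1 * y)].
  by split; [exact: open_coset|rewrite /= mulVg].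
move=> y /= /UH; rewrite -{2}(mulVKg x y) => ?; exact: subgM.
Qed.

Lemma open_subgS H K : is_subgroup H -> open K -> is_subgroup K -> K `<=` H ->
  open H.
Proof. by move=> sH oK sK; apply: open_subg => //; exact: subg1. Qed.

Lemma closed_open_subg H : is_subgroup H -> open H -> closed H.
Proof.
move=> sH oH; rewrite -[H]setCK; apply: open_closedC; rewrite openE => x nHx.
rewrite /interior /= nbhsE; exists [set y | H (x^-1 * y)].
  by split; [exact: open_coset|rewrite /= mulVg; exact: subg1].
move=> y /= Hxy Hy; apply: nHx.
by apply: (subgVP sH); apply: subg_cancelr Hy _.
Qed.

(** N is what remains of the open set H after removal of the finitely many other cosets of N, each
    of which is closed. *)
Lemma open_of_finite_index H N : open H -> is_subgroup H -> is_subgroup N ->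
  N `<=` H -> closed N -> finite_index H N -> open N.
Proof.
move=> oH sH sN NH cN fN.
set F := [set C : set G | exists2 g, H g & C = [set g * k | k in N]].
have cosetE g x : [set g * k | k in N] x <-> N (g^-1 * x).
  split=> [[k Nk <-]|Nx]; first by rewrite mulKg.
  by exists (g^-1 * x) => //; rewrite mulVKg.
pose D := F `\ N.
have cD : closed (\bigcup_(C in D) C).
  apply: closed_bigcup; first by apply: sub_finite_set fN => ? [].
  move=> C [[g Hg ->] _].
  have -> : [set g * k | k in N] = [set x | N (g^-1 * x)].
    by apply/seteqP; split=> x /cosetE.
  exact: (closed_preim (@continuous_mull g^-1) cN).
have -> : N = H `&` ~` (\bigcup_(C in D) C).
  apply/seteqP; split=> [x Nx|x [Hx nDx]].
    split; first exact: NH.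
    move=> [C [[g Hg ->] neq] /cosetE gx]; apply: neq.
    have Ng : N g by apply: (subgVP sN); apply: subg_cancelr Nx _.
    apply/seteqP; split=> y; first by move=> /cosetE; apply: subg_cancell => //; exact: subgV.
    by move=> Ny; apply/cosetE; apply: subgM (subgV sN Ng) Ny.
  apply: contrapT => nNx; apply: nDx.
  exists [set x * k | k in N]; last by apply/cosetE; rewrite mulVg; exact: subg1.
  split; first by exists x.
  move=> eN; apply: nNx; rewrite -eN; apply/cosetE; rewrite mulVg; exact: subg1.
by apply: openI => //; exact: closed_openC.
Qed.

End TopGroup.

(** * Compactness arguments for sequences of closed sets and for cosets *)

Section Compactness.

Lemma compact_decreasing (T : topologicalType) (K : set T) (F : nat -> set T) :
  compact K -> F 0%N `<=` K -> (forall n, closed (F n)) ->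
  (forall m n, (m <= n)%N -> F n `<=` F m) -> (forall n, F n !=set0) ->
  exists x, forall n, F n x.
Proof.
move=> /compact_near_coveringP ncK F0 clF decF neF; apply: contrapT => noF.
have := ncK nat \oo (fun n x => ~ F n x) _ _.
case=> [x _|n _ /(_ n (leqnn n)) nF]; last first.
  by have [x Fx] := neF n; apply: (nF x _ Fx); apply: F0; exact: (decF _ n _ _ Fx).
have [n nFn] : exists n, ~ F n x by apply/existsNP => allF; apply: noF; exists x.
exists (~` F n, [set k | (n <= k)%N]) => /=.
  split; last by exists n.
  by apply: open_nbhs_nbhs; split; [exact: closed_openC|].
by move=> [y k] /= [nFy nk] /(decF _ _ nk).
Qed.

Context {G : topGroupType}.
Implicit Types (N H : set G).

(** Compactness is used as near covering along the filter of finite sequences ordered by inclusion: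
    near x a sequence only has to contain x, and one that works on all of H is the desired list. *)
Lemma compact_coset_reps H N : compact H -> is_subgroup N -> open N ->
  exists s : seq G, forall x, H x -> exists2 c, c \in s & N (c^-1 * x).
Proof.
move=> /compact_near_coveringP ncH sN oN.
pose B (s : seq G) := [set t : seq G | {subset s <= t}].
pose F := filter_from [set: seq G] B.
have FF : Filter F.
  apply: filter_from_filter; first by exists [::].
  move=> s t _ _; exists (s ++ t) => // u su; split=> c cs; apply: su;
    by rewrite mem_cat cs ?orbT.
have [] := ncH _ F (fun s x => exists2 c, c \in s & N (c^-1 * x)) FF.
  move=> x _; exists ([set y | N (x^-1 * y)], B [:: x]) => /=.
    split; last by exists [:: x].
    apply: open_nbhs_nbhs; split; first exact: open_coset.
    by rewrite /= mulVg; exact: subg1.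
  by move=> [y s] /= [Ny xs]; exists x => //; apply: xs; rewrite mem_head.
by move=> s _ /(_ s (fun _ => id)) cov; exists s.
Qed.

Lemma compact_finite_index H N : compact H -> is_subgroup N -> open N ->
  finite_index H N.
Proof.
move=> cH sN oN; have [s ss] := compact_coset_reps cH sN oN.
apply: (@sub_finite_set _ _ ((fun c => [set c * k | k in N]) @` [set` s])).
  move=> C [g Hg ->]; have [c cs Ncg] := ss g Hg; exists c => //.
  apply/seteqP; split=> _ [k Nk <-].
    exists (g^-1 * c * k); last by rewrite -!mulgA mulVKg.
    apply: subgM => //; apply: (subgVP sN).
    by rewrite invgM invgK.
  exists (c^-1 * g * k); last by rewrite -!mulgA mulVKg.
  exact: subgM.
by apply: finite_image; exact: finite_seq.
Qed.

End Compactness.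

(** * Internal direct products of commuting subgroups *)

Section DirectProducts.
Context {G : topGroupType}.
Implicit Types (W : nat -> set G).

Definition nbhs1_base W :=
  [/\ forall n, open (W n) /\ W n 1,
      forall m n, (m <= n)%N -> W n `<=` W m &
      forall U, open U -> U 1 -> exists n, W n `<=` U].

Definition boxed (I : Type) (P : I -> set G) : set (I -> G) :=
  [set x | forall i, P i (x i)].

(** Boxes of uniform radius [W k] converge to x in every coordinate, hence in the product topology,
    whatever the index set. *)
Lemma prod_topology_box W (I : Type) (U : set (prod_topology (fun _ : I => G)))
    (x : I -> G) :
  nbhs1_base W -> open U -> U x ->
  exists k, forall y : I -> G, (forall i, W k ((x i)^-1 * y i)) -> U y.
Proof.
move=> [oW dW bW] oU Ux.
pose B k := [set y : prod_topology (fun _ : I => G) |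
  forall i, W k ((x i)^-1 * y i)].
pose F := filter_from [set: nat] B.
have FF : Filter F.
  apply: filter_from_filter; first by exists 0%N.
  move=> k l _ _; exists (maxn k l) => // y By; split=> i; move: (By i);
    by apply: dW; rewrite leq_max leqnn ?orbT.
have Fx : F --> (x : prod_topology (fun _ : I => G)).
  apply/cvg_sup => i N [V] [[Q] oQ <-] Qx QN.
  have [] := bW [set z | Q (x i * z)]
    (open_preim (@continuous_mull _ (x i)) oQ); first by rewrite /= mulg1.
  move=> k Wk.
  exists k => // y By; apply: QN => /=.
  by have := Wk _ (By i); rewrite /= mulVKg.
have [k _ Bk] := Fx U (open_nbhs_nbhs (conj oU Ux)).
by exists k => y By; apply: Bk.
Qed.

Lemma continuous_prodg (I : eqType) (s : seq I) :
  continuous (fun x : prod_topology (fun _ : I => G) => \prod_(i <- s) x i).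
Proof.
elim: s => [|i s IHs].
  have -> : (fun x : prod_topology (fun _ : I => G) =>
    \prod_(i <- [::]) x i) = fun=> 1.
    by apply/funext => x; rewrite big_nil.
  exact: cst_continuous.
have -> : (fun x : prod_topology (fun _ : I => G) =>
    \prod_(j <- i :: s) x j) = fun x => x i * \prod_(j <- s) x j.
  by apply/funext => x; rewrite big_cons.
by apply: continuousM => //; exact: proj_continuous.
Qed.

Section Commuting.
Variables (I : finType) (P : I -> set G).
Hypothesis sP : forall i, is_subgroup (P i).
Hypothesis cP : forall i j, i <> j -> P i `<=` cent (P j).

Lemma prod_commuting_mul (x y : I -> G) : boxed P x -> boxed P y ->
  \prod_i (x i * y i) = (\prod_i x i) * (\prod_i y i).
Proof.
move=> Px Py; elim: (index_enum I) (index_enum_uniq I) => [|i s IHs] /=.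
  by rewrite !big_nil mulg1.
move=> /andP [nis us]; rewrite !big_cons (IHs us) -!mulgA; congr (_ * _).
rewrite !mulgA; congr (_ * _); rewrite big_seq.
apply: (big_ind (commute (y i))); first exact: commute1.
  by move=> *; exact: commuteM.
move=> j js; apply: (cP (j := j) _ (Py i) (Px j)) => ij.
by move: nis; rewrite ij js.
Qed.

Lemma prod_commuting_cent (x : I -> G) i (s : seq I) : boxed P x ->
  i \notin s -> cent (P i) (\prod_(j <- s) x j).
Proof.
move=> Px nis; rewrite big_seq; apply: (big_ind (cent (P i))).
- exact: subg1 (is_subgroup_cent _).
- by move=> a b; apply: (subgM (is_subgroup_cent _)).
move=> j js; apply: (cP (j := i) _ (Px j)) => ij.
by move: nis; rewrite -ij js.
Qed.

Lemma prod_commuting_component (x : I -> G) i : boxed P x ->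
  exists2 c, cent (P i) c & \prod_j x j = x i * c.
Proof.
move=> Px; elim: (index_enum I) (index_enum_uniq I) (mem_index_enum i) => //.
move=> j s IHs /= /andP [njs us]; rewrite inE big_cons.
case: eqP => [->|ij] /= is_.
  by exists (\prod_(k <- s) x k) => //; exact: prod_commuting_cent.
have [c Cc ->] := IHs us is_.
have Cxj : cent (P i) (x j) by apply: cP (Px j) => ji; apply: ij.
exists (x j * c); first exact: (subgM (is_subgroup_cent _)).
by rewrite !mulgA; congr (_ * _); exact: Cxj.
Qed.

(** The topology is concentrated in the third hypothesis: a product near 1 has its factors near 1.
    Together with the triviality of the intersection of the [W k] it makes the multiplication
    injective, and it makes the inverse continuous. *)
Lemma direct_product_commuting W (H : set G) :
  nbhs1_base W ->
  (forall i, closed_in H (P i)) ->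
  (forall k, exists l, forall x, boxed P x -> W l (\prod_i x i) ->
    forall i, W k (x i)) ->
  (forall x, (forall k, W k x) -> x = 1) ->
  (forall h, H h <-> exists2 x, boxed P x & h = \prod_i x i) ->
  direct_product P H.
Proof.
move=> bW clP sepP W1 HE.
have invM x y : boxed P x -> boxed P y ->
    (\prod_i x i)^-1 * \prod_i y i = \prod_i ((x i)^-1 * y i).
  move=> Px Py; have Pxy : boxed P (fun i => (x i)^-1 * y i).
    by move=> i; apply: subgM => //; exact: subgV.
  have -> : \prod_i y i = \prod_i (x i * ((x i)^-1 * y i)).
    by apply: eq_bigr => i _; rewrite mulVKg.
  by rewrite (prod_commuting_mul Px Pxy) mulKg.
split.
- by move=> i; split.
- by move=> x y Px Py; exact: prod_commuting_mul.
- split.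
  + by move=> x Px; apply/HE; exists x.
  + move=> x y /set_mem Px /set_mem Py exy; apply/funext => i.
    apply/esym/eqP; rewrite -(inj_eq (mulgI (x i)^-1)) mulVg; apply/eqP.
    apply: W1 => k; have [l Wl] := sepP k.
    have Pxy : boxed P (fun i => (x i)^-1 * y i).
      by move=> j; apply: subgM => //; exact: subgV.
    apply: (Wl _ Pxy); rewrite -invM // -exy mulVg.
    by have [/(_ l) []] := bW.
  + by move=> h /HE [x Px ->]; exists x.
- exact/continuous_subspaceT/continuous_prodg.
- move=> U oU.
  (* A union of neighbourhoods in G of the points of the image, each so small that it meets H only
     in products of elements of U. *)
  pose V := [set h | exists x k, [/\ boxed P x, U x,
    (forall z, boxed P z -> W k ((\prod_i x i)^-1 * \prod_i z i) -> U z) &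
    W k ((\prod_i x i)^-1 * h)]].
  exists V.
    rewrite openE => h [x [k [Px Ux xk Wh]]].
    rewrite /interior /= nbhsE; exists [set h' | W k ((\prod_i x i)^-1 * h')].
      by split=> //; apply: open_coset; have [/(_ k) []] := bW.
    by move=> h' Wh'; exists x, k.
  apply/seteqP; split=> [_ [x [Px Ux] <-]|h [/HE [z Pz ->] [x [k [Px Ux xk Wz]]]]].
    split; first by apply/HE; exists x.
    have [k Uk] := prod_topology_box bW oU Ux.
    have [l Wl] := sepP k; exists x, l; split=> //; last first.
      by rewrite mulVg; have [/(_ l) []] := bW.
    move=> z Pz; rewrite invM // => Wz; apply: Uk; apply: Wl => // i.
    by apply: subgM => //; exact: subgV.
  by exists z => //; split=> //; exact: xk.
Qed.

End Commuting.
End DirectProducts.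

(** * Rooted trees as parent functions *)

Section ParentTree.
Context {V : choiceType}.
Variables (par : V -> V) (dep : V -> nat) (r : V).
Implicit Types (u v w : V).

(** A rooted tree is encoded by its parent function. The root is its own parent, so that [par] is
    total and ancestors are plain iterates. *)
Definition rooted_parent :=
  [/\ par r = r, dep r = 0%N & forall v, v != r -> dep v = (dep (par v)).+1].

Definition par_edge : rel V :=
  fun v w => (v != r) && (par v == w) || (w != r) && (par w == v).

Definition below v u := exists k, iter k par u = v.

(** The ancestor of u at depth n. For n beyond the depth of u the truncated subtraction returns u
    itself. *)
Definition anc n u := iter (dep u - n) par u.

Lemma below_refl u : below u u. Proof. by exists 0%N. Qed.

Lemma below_trans v u w : below w v -> below v u -> below w u.
Proof. by move=> [k <-] [l <-]; exists (k + l)%N; rewrite iterD. Qed.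

Lemma below_par u : below (par u) u. Proof. by exists 1%N. Qed.

Lemma below_eq_or v u : below v u -> v = u \/ below v (par u).
Proof.
move=> [[|k] <-]; [by left|right].
by exists k; rewrite -iterSr.
Qed.

Hypothesis rp : rooted_parent.

Lemma dep_root : dep r = 0%N. Proof. by case: rp. Qed.

Lemma dep_eq0 v : (dep v == 0%N) = (v == r).
Proof.
case: rp => _ r0 dS; case: (eqVneq v r) => [->|/dS ->//]; by rewrite r0 eqxx.
Qed.

Lemma dep_par v : dep (par v) = (dep v).-1.
Proof.
case: rp => pr r0 dS; case: (eqVneq v r) => [->|/dS ->//].
by rewrite pr r0.
Qed.

Lemma dep_iter k v : dep (iter k par v) = (dep v - k)%N.
Proof. by elim: k => [|k IHk] /=; rewrite ?subn0 // dep_par IHk subnS. Qed.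

Lemma iter_par_root k : iter k par r = r.
Proof. by case: rp => pr _ _; elim: k => [|k IHk] //=; rewrite IHk. Qed.

Lemma dep_anc n u : (n <= dep u)%N -> dep (anc n u) = n.
Proof. by move=> nu; rewrite dep_iter subKn. Qed.

Lemma below_anc n u : below (anc n u) u. Proof. by exists (dep u - n)%N. Qed.

Lemma below_dep v u : below v u -> (dep v <= dep u)%N.
Proof. by move=> [k <-]; rewrite dep_iter leq_subr. Qed.

Lemma below_dep_uniq v v' u : below v u -> below v' u -> dep v = dep v' ->
  v = v'.
Proof.
wlog le_k : v v' / exists k d, iter k par u = v /\ iter (k + d) par u = v'.
  move=> IH [k kv] [l lv]; case: (leqP k l) => kl.
    move=> e; apply: IH => //; [|by exists k|by exists l].
    by exists k, (l - k)%N; rewrite subnKC.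
  move=> e; apply/esym; apply: IH => //; [|by exists l|by exists k].
  by exists l, (k - l)%N; rewrite subnKC // ltnW.
case: le_k => k [d [<- <-]] _ _; rewrite addnC iterD.
move: (iter k par u) => x; rewrite dep_iter.
case: (posnP (dep x)) => [/eqP|x0].
  by rewrite dep_eq0 => /eqP -> _; rewrite iter_par_root.
case: d => [//|d] e; suff : (dep x - d.+1 < dep x)%N by rewrite -e ltnn.
by rewrite ltn_subrL.
Qed.

Lemma below_root u : below r u.
Proof.
exists (dep u); apply/eqP; rewrite -dep_eq0 dep_iter subnn.
exact: eqxx.
Qed.

Lemma below_cmp v v' u : below v u -> below v' u -> (dep v <= dep v')%N ->
  below v v'.
Proof.
move=> vu v'u le_d; rewrite (@below_dep_uniq v (anc (dep v) v') u) //.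
- exact: below_anc.
- exact: below_trans (below_anc _ _) v'u.
- by rewrite dep_anc.
Qed.

Lemma ancP n u v : (n <= dep u)%N -> anc n u = v <-> dep v = n /\ below v u.
Proof.
move=> nu; split=> [<-|[dv vu]].
  by rewrite dep_anc //; split=> //; exact: below_anc.
by apply: below_dep_uniq (below_anc n u) vu _; rewrite dep_anc.
Qed.

Lemma dep_edge v w : par_edge v w -> dep v = (dep w).+1 \/ dep w = (dep v).+1.
Proof.
case: rp => _ _ dS.
by case/orP => /andP [/dS -> /eqP <-]; [left|right].
Qed.

Lemma par_edge_sym : symmetric par_edge.
Proof. by move=> v w; rewrite /par_edge orbC. Qed.

Lemma par_edge_irr : irreflexive par_edge.
Proof.
by move=> v; apply/negP => /dep_edge [] /eqP; rewrite eqn_leq ltnn ?andbF.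
Qed.

Lemma par_edge_par v : v != r -> par_edge v (par v).
Proof. by move=> vr; rewrite /par_edge vr eqxx. Qed.

(* Inside and outside of the subtree at a are joined by one edge only. *)
Lemma path_cut a x p : path par_edge x p ->
  below a x <> below a (last x p) -> par a \in x :: p.
Proof.
elim: p x => [|y p IHp] x //= /andP [exy py] nax.
have [ayx|nay] := pselect (below a y = below a x); last first.
  move: nay.
  case/orP: exy => /andP [nr /eqP e] nay.
    suff <- : y = par a by rewrite !inE eqxx orbT.
    apply: contrapT => ya; apply: nay; apply/propext; rewrite -e; split.
      by move=> h; apply: below_trans h (below_par x).
    by case/below_eq_or => // ax; case: ya; rewrite ax e.
  suff <- : x = par a by rewrite inE eqxx.
  apply: contrapT => ya; apply: nay; apply/propext; rewrite -e; split.
    by case/below_eq_or => // ax; case: ya; rewrite ax e.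
  by move=> h; apply: below_trans h (below_par y).
by rewrite inE (IHp y) ?orbT // ayx.
Qed.

(** If two simple paths leave v by different edges, one of these edges leads to a child a of v,
    because v has a single parent. The path through a cannot return to v, so w lies below a; the
    other path starts outside the subtree at a and could enter it only through v. *)
Lemma simple_path_uniq v w p q :
  simple_path par_edge v p w -> simple_path par_edge v q w -> p = q.
Proof.
elim: p v q => [|a p IHp] v [|b q] //.
- move=> [_ _ /= vw] [_ /= /andP [nv _] lq]; move: nv.
  by rewrite vw -lq mem_last.
- move=> [_ /= /andP [nv _] lq] [_ _ /= vw]; move: nv.
  by rewrite vw -lq mem_last.
move=> [/= /andP [eva pa] /andP [nva ua] la] [/= /andP [evb qb] /andP [nvb ub] lb].
have [ab|nab] := eqVneq a b.
  by rewrite ab in pa ua la *; congr (_ :: _); apply: (IHp b).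
suff H a' b' p' q' : par_edge v b' -> a' != b' -> v \notin a' :: p' ->
    path par_edge a' p' -> last a' p' = w -> v \notin b' :: q' ->
    path par_edge b' q' -> last b' q' = w -> par a' = v -> a' != r -> False.
  exfalso; case/orP: (eva) => /andP [nr /eqP e]; last exact: (H a b p q).
  case/orP: (evb) => /andP [nr' /eqP e']; first by case/eqP: nab; rewrite -e -e'.
  by apply: (H b a q p) => //; rewrite eq_sym.
move=> evb' nab' nva' pa' la' nvb' pb' lb' e nr.
have aw : below a' w.
  apply: contrapT => naw; have := @path_cut a' a' p' pa'; rewrite la' e.
  rewrite (negPf nva') => H; suff : false by []; apply: H => h; apply: naw.
  rewrite -h; exact: below_refl.
suff naw : ~ below a' b'.
  have := @path_cut a' b' q' pb'; rewrite lb' e (negPf nvb') => H.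
  by suff : false by []; apply: H => h; apply: naw; rewrite h.
move=> ab'; case: rp => _ _ dS.
have := below_dep ab'; have da : dep a' = (dep v).+1 by rewrite dS // e.
case/dep_edge: evb' => db; first by rewrite da db ltnNge leqnSn.
move=> _; case/eqP: nab'; apply: below_dep_uniq ab' (below_refl _) _.
by rewrite da db.
Qed.

Lemma root_path v : exists p, [/\ simple_path par_edge r p v, size p = dep v &
  forall u, (u \in r :: p) <-> below u v].
Proof.
elim: {v}(dep v) {-2}v (erefl (dep v)) => [|n IHn] v dv.
  move/eqP: (dv); rewrite dep_eq0 => /eqP ->; exists [::]; split=> // [|u].
    by rewrite dep_root.
  rewrite inE; split=> [/eqP -> | /below_dep]; first exact: below_refl.
  by rewrite dep_root leqn0 dep_eq0.
have nr : v != r by rewrite -dep_eq0 dv.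
have dpv : dep (par v) = n by rewrite dep_par dv.
have [p [[pp up lp] sp mp]] := IHn _ dpv.
exists (rcons p v); split.
- split; last by rewrite last_rcons.
    by rewrite rcons_path pp lp par_edge_sym par_edge_par.
  rewrite -rcons_cons rcons_uniq up andbT; apply/negP => /mp /below_dep.
  by rewrite dv dpv ltnn.
- by rewrite size_rcons sp dv dpv.
move=> u; rewrite -rcons_cons mem_rcons inE; split.
  case/orP => [/eqP -> | /mp h]; first exact: below_refl.
  exact: below_trans h (below_par v).
by case/below_eq_or => [-> | /mp ->]; rewrite ?eqxx ?orbT.
Qed.

Lemma par_edge_tree : is_tree par_edge.
Proof.
split; [exact: par_edge_sym|exact: par_edge_irr|move=> v w].
have [p [[pp _ lp] _ _]] := root_path v; have [q [[pq _ lq] _ _]] := root_path w.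
have : exists s, path par_edge v s /\ last v s = w.
  exists (rev (belast r p) ++ q); rewrite cat_path last_cat.
  have -> : last v (rev (belast r p)) = r.
    rewrite -lp; case: (p) => [//|x p'] /=.
    by rewrite rev_cons last_rcons.
  rewrite pq lq andbT; split=> //.
  rewrite -lp rev_path; apply: sub_path pp => x y /=.
  by rewrite par_edge_sym.
move=> [s [ps ls]]; move: ls; case: (shortenP ps) => s' ps' us' _ ls'.
by exists s'; split=> [|s'' h]; [split|apply: simple_path_uniq h].
Qed.

Lemma sphereE e n : is_tree e -> (forall v w, e v w = par_edge v w) ->
  sphere e r n = [set v | dep v = n].
Proof.
move=> [_ _ te] eE; have {}eE : e = par_edge by apply/funext => v; apply/funext.
rewrite eE in te *; apply/seteqP; split=> [v [p sp <-]|v /= <-].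
  by have [q [sq zq _]] := root_path v; rewrite /= -zq (simple_path_uniq sp sq).
by have [q [sq sz _]] := root_path v; exists q.
Qed.

Lemma descendsE e v w : is_tree e -> (forall v w, e v w = par_edge v w) ->
  descends e r v w <-> below v w.
Proof.
move=> [_ _ te] eE; have {}eE : e = par_edge by apply/funext => x; apply/funext.
rewrite eE in te *; have [q [sq _ mq]] := root_path w; split.
  by move=> [p sp vp]; apply/mq; rewrite -(simple_path_uniq sp sq).
by move=> /mq vq; exists q.
Qed.

End ParentTree.

Section TreeParent.
Context {V : choiceType}.
Variables (e : rel V) (r : V).
Hypothesis te : is_tree e.

Lemma tree_parent : exists par dep,
  rooted_parent par dep r /\ forall v w, e v w = par_edge par r v w.
Proof.
case: te => es ei ue.
have [P PP] : {P : V -> seq V & forall v, simple_path e r (P v) v}.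
  apply: (@boolp.choice _ _ (fun v p => simple_path e r p v)) => v.
  by have [p [sp _]] := ue r v; exists p.
have Pu v p : simple_path e r p v -> p = P v.
  by move=> sp; have [q [_ uq]] := ue r v; rewrite -(uq _ sp) (uq _ (PP v)).
have Pr : P r = [::] by apply/esym/Pu; split.
(* The penultimate vertex of the path from the root. For v = r the path is empty and the default r
   makes the root its own parent. *)
pose par v := last r (belast r (P v)).
have parS v : v != r -> P v = rcons (P (par v)) v.
  have [pv uv lv] := PP v; rewrite /par.
  case/lastP: (P v) pv uv lv => [|q x] /=; first by move=> _ _ ->; rewrite eqxx.
  rewrite last_rcons belast_rcons => pv uv xv nr; rewrite xv in pv uv *.
  rewrite /=; congr (rcons _ _); apply: Pu; split=> //.
    by move: pv; rewrite rcons_path => /andP [].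
  by move: uv; rewrite -cons_uniq -rcons_cons rcons_uniq => /andP [].
exists par, (fun v => size (P v)); split.
  split=> [||v nr]; rewrite ?/par ?Pr //=.
  by rewrite -/(par v) [in LHS](parS _ nr) size_rcons.
move=> v w; apply/idP/idP.
  (* If w is off the path to v, prolonging this path by w gives [P w]. Otherwise its tail from w is
     the single edge to v, so that w is the parent of v. *)
  move=> evw; have [wv|nwv] := boolP (w \in r :: P v); last first.
    have nr : w != r by apply: contraNneq nwv => ->; rewrite mem_head.
    have : rcons (P v) w = P w.
      apply: Pu; have [pv uv lv] := PP v; split; last by rewrite last_rcons.
        by rewrite rcons_path pv lv.
      by rewrite -rcons_cons rcons_uniq nwv.
    rewrite (parS _ nr) => /rcons_inj [ePv].
    have [_ _ lw] := PP (par w); rewrite /par_edge nr -lw -ePv.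
    by have [_ _ ->] := PP v; rewrite eqxx orbT.
  have nvw : w != v by apply: contraTneq evw => ->; rewrite ei.
  have nr : v != r.
    apply: contraNneq nvw => vr; move: wv; rewrite vr Pr inE => /eqP ->.
    exact: eqxx.
  rewrite /par_edge nr /par; have [pv uv lv] := PP v.
  case/splitPl: wv pv uv lv => p1 p2 lp1.
  rewrite cat_path lp1 last_cat lp1 -cat_cons cat_uniq => /andP [_ pp2].
  move=> /and3P [u1 h12 u2] lp2.
  have sp2 : simple_path e w p2 v.
    split=> //=; rewrite u2 andbT; apply: contra h12 => wp2.
    by apply/hasP; exists w => //; rewrite -lp1 mem_last.
  have [q [_ uq]] := ue w v.
  have sv : simple_path e w [:: v] v by split; rewrite //= ?inE ?nvw // es evw.
  rewrite -(uq _ sp2) (uq _ sv) belast_cat /= last_cat /= lp1 eqxx //.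
have H x : x != r -> e (par x) x.
  move=> nr; have [] := PP x; rewrite (parS _ nr) rcons_path.
  by have [_ _ ->] := PP (par x) => /andP [].
by case/orP => /andP [nr /eqP <-]; rewrite ?H // es H.
Qed.

End TreeParent.

(** * Groups acting on rooted trees *)

Section TreeAction.
Context {G : topGroupType} {V : choiceType}.
Variables (par : V -> V) (dep : V -> nat) (r : V) (act : G -> V -> V).
Implicit Types (g h x y : G) (u v w : V) (K : set G).

Definition tree_action :=
  [/\ forall v, act 1 v = v,
      forall g h v, act (g * h) v = act g (act h v),
      forall g v, dep (act g v) = dep v &
      forall g v, par (act g v) = act g (par v)].

Definition faithful_action := forall g, (forall v, act g v = v) -> g = 1.

Definition rist w : set G := [set g | forall u, ~ below par w u -> act g u = u].

(** This relation stands in for sections of g and h at w, which would require identifying the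
    subtrees at different vertices. *)
Definition agree g h w := forall u, below par w u -> act g u = act h u.

Definition level_stab n : set G :=
  [set g | forall v, (dep v <= n)%N -> act g v = v].

Hypothesis rp : rooted_parent par dep r.
Hypothesis ta : tree_action.

Lemma act1 v : act 1 v = v. Proof. by case: ta. Qed.
Lemma actM g h v : act (g * h) v = act g (act h v). Proof. by case: ta. Qed.
Lemma dep_act g v : dep (act g v) = dep v. Proof. by case: ta. Qed.
Lemma par_act g v : par (act g v) = act g (par v). Proof. by case: ta. Qed.

Lemma actK g v : act g^-1 (act g v) = v.
Proof. by rewrite -actM mulVg act1. Qed.
Lemma actKV g v : act g (act g^-1 v) = v.
Proof. by rewrite -actM mulgV act1. Qed.
Lemma act_inj g : injective (act g).
Proof. by move=> u v e; rewrite -(actK g u) e actK. Qed.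

Lemma below_act g v u : below par v u -> below par (act g v) (act g u).
Proof.
move=> [k <-]; exists k; elim: k => [|k IHk] //=.
by rewrite IHk par_act.
Qed.

Lemma below_actE g v u : below par (act g v) (act g u) <-> below par v u.
Proof.
by split=> [/(below_act g^-1)|]; [rewrite !actK|exact: below_act].
Qed.

Lemma below_actV g v u : below par v (act g u) <-> below par (act g^-1 v) u.
Proof. by rewrite -(below_actE g (act g^-1 v)) actKV. Qed.

Lemma fix_inv g u : act g u = u -> act g^-1 u = u.
Proof. by move=> gu; rewrite -{1}gu actK. Qed.

Lemma below_fixed g w u : act g w = w -> below par w (act g u) <-> below par w u.
Proof. by move=> gw; rewrite -{1}gw below_actE. Qed.

Lemma below_eq_dep w w' u : below par w u -> below par w' u ->
  dep w = dep w' -> w = w'.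
Proof. exact: (below_dep_uniq rp). Qed.

Lemma rist_fix w x : rist w x -> act x w = w.
Proof.
move=> xw; have [b|nb] := pselect (below par w (act x w)).
  by apply: below_eq_dep (below_refl _ _) b _; rewrite dep_act.
by apply: (@act_inj x); exact: xw.
Qed.

Lemma rist_subgroup w : is_subgroup (rist w).
Proof.
split=> [u _|x y xw yw u nu|x xw u nu]; first exact: act1.
- by rewrite actM yw // xw.
- by apply: fix_inv; apply: xw.
Qed.

Lemma level_stab_subgroup n : is_subgroup (level_stab n).
Proof.
split=> [u _|x y xw yw u nu|x xw u nu]; first exact: act1.
- by rewrite actM yw // xw.
- by apply: fix_inv; apply: xw.
Qed.

Lemma level_stabS m n : (m <= n)%N -> level_stab n `<=` level_stab m.
Proof. by move=> mn g gn v vm; apply: gn; apply: leq_trans mn. Qed.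

Lemma actJ g x u : act (x ^ g) u = act g^-1 (act x (act g u)).
Proof. by rewrite conjgE !actM. Qed.

Lemma level_stab_normal n : normalised [set: G] (level_stab n).
Proof.
by move=> g x _ xn v vn; rewrite actJ xn ?actK // dep_act.
Qed.

Lemma ristS w w' : below par w w' -> rist w' `<=` rist w.
Proof. by move=> ww' x xw u nu; apply: xw => w'u; apply: nu; exact: below_trans ww' w'u. Qed.

Lemma rist_level_stab n w : (n <= dep w)%N -> rist w `<=` level_stab n.
Proof.
move=> nw x xw u un; have [b|nb] := pselect (below par w u); last exact: xw.
have -> : u = w; last exact: rist_fix.
apply: (below_eq_dep (below_refl _ _) b _).
by apply/eqP; rewrite eqn_leq (leq_trans un nw) (below_dep rp b).
Qed.

Lemma ristJ w g x : rist w x -> rist (act g^-1 w) (x ^ g).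
Proof.
move=> xw u nu; rewrite actJ xw ?actK //.
by rewrite below_actV.
Qed.

Lemma agree_trans g h k w : agree g h w -> agree h k w -> agree g k w.
Proof. by move=> a b u wu; rewrite a // b. Qed.

Lemma agreeM g h g' h' w : act g' w = w -> agree g h w -> agree g' h' w ->
  agree (g * g') (h * h') w.
Proof.
move=> g'w a a' u wu; rewrite !actM -a' // a //.
by apply/below_fixed.
Qed.

Lemma agreeV g h w : act g w = w -> agree g h w -> agree g^-1 h^-1 w.
Proof.
move=> gw a u wu; apply: (@act_inj h); rewrite actKV -a ?actKV //.
by apply/below_fixed => //; exact: fix_inv.
Qed.

Lemma agreeJ g h k w : agree g h (act k w) -> agree (g ^ k) (h ^ k) w.
Proof. by move=> a u wu; rewrite !actJ a //; exact: below_act. Qed.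

Lemma prod_rist (I : eqType) (s : seq I) (f : I -> V) (x : I -> G) m :
  uniq s -> {in s &, injective f} -> (forall i, i \in s -> dep (f i) = m) ->
  (forall i, i \in s -> rist (f i) (x i)) ->
  (forall i, i \in s -> agree (\prod_(j <- s) x j) (x i) (f i)) /\
  (forall u, (forall i, i \in s -> ~ below par (f i) u) ->
    act (\prod_(j <- s) x j) u = u).
Proof.
elim: s => [|i s IHs] /=; first by rewrite big_nil; split=> // u _; exact: act1.
move=> /andP [nis us] inj df xf; rewrite big_cons.
have sub j : j \in s -> j \in i :: s by move=> js; rewrite inE js orbT.
have [|||agr fixd] := IHs us _ _ _.
- by move=> j k js ks; apply: inj; exact: sub.
- by move=> j js; apply: df; exact: sub.
- by move=> j js; apply: xf; exact: sub.
have ii : i \in i :: s by rewrite mem_head.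
have other j : j \in s -> forall u, below par (f j) u -> ~ below par (f i) u.
  move=> js u ju iu.
  have e : f i = f j by apply: (below_eq_dep iu ju); rewrite (df _ ii) (df _ (sub _ js)).
  by move: nis; rewrite (inj _ _ ii (sub _ js) e) js.
split=> [j|u nu].
  rewrite inE => /orP [/eqP ->|js] u ju; rewrite actM.
    by rewrite fixd // => k ks ku; apply: other ks _ ku ju.
  rewrite (agr j js u ju) (xf i ii) //; apply: (other j js).
  by apply/below_fixed => //; apply: rist_fix; apply: xf; exact: sub.
rewrite actM fixd; first by apply: (xf i ii); exact: nu.
by move=> j js; apply: nu; exact: sub.
Qed.

Lemma combine_rist K (s : seq V) (g : V -> G) m :
  is_subgroup K -> uniq s -> (forall w, w \in s -> dep w = m) ->
  (forall w, w \in s -> exists x, [/\ K x, rist w x & agree x (g w) w]) ->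
  exists x, [/\ K x, forall w, w \in s -> agree x (g w) w &
    forall u, (forall w, w \in s -> ~ below par w u) -> act x u = u].
Proof.
move=> sK us ds ex.
have [x Px] : {x : V -> G & forall w, w \in s ->
    [/\ K (x w), rist w (x w) & agree (x w) (g w) w]}.
  apply: (@boolp.choice _ _ (fun w x => w \in s ->
    [/\ K x, rist w x & agree x (g w) w])) => w.
  have [ws|nws] := boolP (w \in s); last by exists 1.
  by have [x Px] := ex w ws; exists x.
have [||agr fixd] := @prod_rist _ s id x m us _ ds _.
- by [].
- by move=> w /Px [].
exists (\prod_(w <- s) x w); split=> // [|w ws].
- rewrite big_seq; apply: (big_ind K); first exact: subg1.
    by move=> a b; exact: subgM.
  by move=> w /Px [].
- by apply: agree_trans (agr w ws) _; have [] := Px w ws.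
Qed.

Hypothesis fa : faithful_action.

Lemma act_ext g h : (forall v, act g v = act h v) -> g = h.
Proof.
move=> e; apply/eqP; rewrite -(inj_eq (mulgI h^-1)) mulVg; apply/eqP.
by apply: fa => v; rewrite actM e actK.
Qed.

Lemma rist_commute w w' x y : dep w = dep w' -> w <> w' -> rist w x ->
  rist w' y -> commute x y.
Proof.
move=> dw nw xw yw; apply: act_ext => u; rewrite !actM.
have [b|nb] := pselect (below par w u).
  have nb' v : below par w v -> ~ below par w' v.
    by move=> bv bv'; apply: nw; exact: below_eq_dep bv bv' dw.
  rewrite !(yw _ (nb' _ _)) //; apply/below_fixed => //; exact: rist_fix.
have [b'|nb'] := pselect (below par w' u).
  have nb'' v : below par w' v -> ~ below par w v.
    by move=> bv' bv; apply: nw; exact: below_eq_dep bv bv' dw.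
  rewrite !(xw _ (nb'' _ _)) //; apply/below_fixed => //; exact: rist_fix.
by rewrite (yw u) // (xw u) // yw.
Qed.

(* If k in K moves w then, for x, y in rist w, the commutator [x, y] equals
   [c, y] where c = [k, x] lies in K. *)
Lemma moved_commutator K k w x y : is_subgroup K -> normalised (rist w) K ->
  K k -> act k w <> w -> rist w x -> rist w y -> K [~ x, y].
Proof.
move=> sK nK Kk kw xw yw; pose z := (x^-1) ^ k.
have zw : rist (act k^-1 w) z by apply: ristJ; exact: (subgV (rist_subgroup w) xw).
have Kc : K (z * x).
  have -> : z * x = k^-1 * k ^ x by rewrite /z !conjgE !mulgA.
  by apply: (subgM sK (subgV sK Kk)); exact: nK.
have nzw : w <> act k^-1 w by move=> e; apply: kw; rewrite {1}e actKV.
have zy : commute z y.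
  apply/commute_sym; apply: (rist_commute _ nzw yw zw).
  by rewrite dep_act.
have -> : [~ x, y] = (z * x)^-1 * (z * x) ^ y.
  by rewrite conjMg (conj_fix zy) invgM -mulgA mulKg.
by apply: (subgM sK (subgV sK Kc)); exact: nK.
Qed.

End TreeAction.

Lemma finite_uniq_seq (T : choiceType) (A : set T) : finite_set A ->
  exists2 s : seq T, uniq s & forall x, x \in s <-> A x.
Proof.
move=> /finite_seqP [s ->]; exists (undup s); first exact: undup_uniq.
by move=> x; rewrite mem_undup.
Qed.

Lemma open_finite_bigcap (T : topologicalType) (I : choiceType) (A : set I)
    (F : I -> set T) :
  finite_set A -> (forall i, A i -> open (F i)) -> open (\bigcap_(i in A) F i).
Proof.
move=> fA oF; rewrite -[X in open X]setCK setC_bigcap; apply: closed_openC.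
by apply: closed_bigcup => // i Ai; apply: open_closedC; exact: oF.
Qed.

(** * Just infinite branch groups *)

Section BranchAction.
Context {B : topGroupType} {V : choiceType}.
Variables (par : V -> V) (dep : V -> nat) (r : V) (act : B -> V -> V).
Implicit Types (g h x y : B) (u v w : V) (K L : set B).
Local Notation below := (below par).
Local Notation rist := (rist par act).
Local Notation agree := (agree par act).
Local Notation St := (level_stab dep act).

Record level_action : Prop := LevelAction {
  la_root : rooted_parent par dep r;
  la_act : tree_action par dep act;
  la_faithful : faithful_action act;
  la_stab : forall v, open [set g | act g v = v];
  la_level : forall n, finite_set [set v | dep v = n];
  la_trans : forall v w, dep v = dep w -> exists g, act g v = w }.

(** [ba_rist] says that the product of the rigid stabilisers of level n contains a level stabiliser,
    hence is open; it is phrased through the factors of g, one vertex at a time. *)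
Record branch_action : Prop := BranchAction {
  ba_level :> level_action;
  ba_rist : forall n, exists l, forall g, St l g -> forall w, dep w = n ->
    exists2 x, rist w x & agree x g w }.

Section LevelAction.
Hypothesis la : level_action.
Hypothesis cB : compact [set: B].

Let rp := la_root la.
Let ta := la_act la.
Let fa := la_faithful la.

Lemma open_act u (P : set V) : open [set g | P (act g u)].
Proof.
rewrite openE => g Pg; rewrite /interior /= nbhsE.
exists [set h | act (g^-1 * h) u = u].
  split; first exact: (@open_coset _ _ g (la_stab la u)).
  by rewrite /= mulVg (act1 ta).
by move=> h /= hu; rewrite -[h](mulVKg g) (actM ta) hu.
Qed.

Lemma closed_act u (P : set V) : closed [set g | P (act g u)].
Proof. by rewrite -[X in closed X]setCK; apply: open_closedC; exact: (open_act u (~` P)). Qed.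

Lemma closed_agree g w k :
  closed [set x | forall u, below w u -> (dep u <= k)%N -> act x u = act g u].
Proof.
have -> : [set x | forall u, below w u -> (dep u <= k)%N -> act x u = act g u] =
    \bigcap_(u in [set u | below w u /\ (dep u <= k)%N])
      [set x | [set act g u] (act x u)].
  by apply/seteqP; split=> x xg u => [[]|wu uk]; [apply: xg|apply: xg; split].
by apply: closed_bigI => u _; exact: closed_act.
Qed.

Lemma closed_rist w : closed (rist w).
Proof.
have -> : rist w = \bigcap_(u in [set u | ~ below w u]) [set x | [set u] (act x u)].
  by apply/seteqP; split=> x xg u nu; exact: xg.
by apply: closed_bigI => u _; exact: closed_act.
Qed.

Lemma open_level_stab n : open (St n).
Proof.
elim: n => [|n IHn].
  have -> : St 0%N = setT; last exact: openT.
  apply/seteqP; split=> // g _ v; rewrite leqn0 (dep_eq0 rp) => /eqP ->.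
  by apply/eqP; rewrite -(dep_eq0 rp) (dep_act ta) (dep_root rp).
have -> : St n.+1 = St n `&`
    \bigcap_(v in [set v | dep v = n.+1]) [set g | [set v] (act g v)].
  apply/seteqP; split=> [g gS|g [gn gS] v].
    split; first exact: (level_stabS (leqnSn n) gS).
    by move=> v vn; apply: gS; rewrite vn.
  by rewrite leq_eqVlt => /orP [/eqP /gS|/gn].
apply: openI => //; apply: open_finite_bigcap; first exact: (la_level la).
by move=> v _; exact: open_act.
Qed.

Lemma level_stab_base : nbhs1_base St.
Proof.
split=> [n|m n|U oU U1].
- by split; [exact: open_level_stab|exact: (subg1 (level_stab_subgroup ta n))].
- exact: level_stabS.
apply: contrapT => nU.
have [|||x Ux] := @compact_decreasing B setT (fun n => St n `&` ~` U) cB (@subsetT _ _).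
- move=> n; apply: closedI; last exact: open_closedC.
  apply: closed_open_subg; last exact: open_level_stab.
  exact: (level_stab_subgroup ta).
- by move=> m n mn x [/(level_stabS mn)].
- move=> n; apply: contrapT => ne; apply: nU; exists n => x Sx.
  by apply: contrapT => nUx; apply: ne; exists x.
have [_ nUx] := Ux 0%N; apply: nUx; suff -> : x = 1 by [].
by apply: fa => v; have [+ _] := Ux (dep v); apply.
Qed.

(** Agreement on the whole subtree is the intersection over k of the closed conditions of agreement
    down to depth k. *)
Lemma agree_compact K g w : closed K ->
  (forall k, exists2 x, K x &
    forall u, below w u -> (dep u <= k)%N -> act x u = act g u) ->
  exists2 x, K x & agree x g w.
Proof.
move=> cK ex.
have [|||x Kx] := @compact_decreasing B setT (fun k => K `&`
  [set x | forall u, below w u -> (dep u <= k)%N -> act x u = act g u]) cB (@subsetT _ _).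
- by move=> k; apply: closedI => //; exact: closed_agree.
- by move=> m n mn x [Kx xn]; split=> // u wu um; apply: xn => //; exact: leq_trans mn.
- by move=> k; have [x Kx xk] := ex k; exists x.
exists x; first by have [] := Kx 0%N.
by move=> u wu; have [_] := Kx (dep u); apply.
Qed.

End LevelAction.

Hypothesis ba : branch_action.
Hypothesis cB : compact [set: B].
Hypothesis jiB : just_infinite B.

Let rp := la_root ba.
Let ta := la_act ba.
Let fa := la_faithful ba.

Lemma just_infinite_open N : is_subgroup N -> normalised [set: B] N ->
  closed N -> N <> [set 1] -> open N.
Proof.
move=> sN nN cN N1; apply: (@open_of_finite_index _ setT) => //.
- exact: openT.
- case: jiB => _; apply=> //; apply/normal_inP; first exact: is_subgroupT.
  by split.
Qed.

Lemma level_stab_neq1 n : exists2 g, St n g & g <> 1.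
Proof.
apply: contrapT => nex; case: jiB => + _; apply.
have [s ss] := compact_coset_reps cB (level_stab_subgroup ta n)
  (open_level_stab ba n).
apply: (@sub_finite_set _ _ [set` s]); last exact: finite_seq.
move=> x _ /=; have [c cs Sc] := ss x I; suff -> : x = c by [].
have : c^-1 * x = 1 by apply: contrapT => n1; apply: nex; exists (c^-1 * x).
by move=> e; rewrite -(mulVKg c x) e mulg1.
Qed.

Lemma moved_vertex g : g <> 1 -> exists u, act g u <> u.
Proof.
move=> g1; apply: contrapT => nex; apply: g1; apply: fa => v.
by apply: contrapT => gv; apply: nex; exists v.
Qed.

Lemma deep_vertex n : exists v, dep v = n.
Proof.
have [g Sg /moved_vertex [u gu]] := level_stab_neq1 n.
exists (anc par dep n u); apply: (dep_anc rp); apply: contrapT => /negP.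
by rewrite -ltnNge => /ltnW /Sg.
Qed.

Lemma child v : exists2 w, par w = v & dep w = (dep v).+1.
Proof.
have [w dw] := deep_vertex (dep v).+1.
have [g gw] : exists g, act g (par w) = v.
  by apply: (la_trans ba); rewrite (dep_par rp) dw.
by exists (act g w); rewrite ?(par_act ta) ?(dep_act ta).
Qed.

Lemma deep_below v n : (dep v <= n)%N -> exists2 w, below v w & dep w = n.
Proof.
move=> vn; rewrite -(subnKC vn); elim: (n - dep v)%N => [|k [w vw dw]].
  by exists v; [exact: below_refl|rewrite addn0].
have [w' pw' dw'] := child w; exists w'; last by rewrite dw' dw addnS.
by apply: below_trans vw _; exists 1%N.
Qed.

(** A nontrivial element of a deep level stabiliser moves some vertex, hence has a nontrivial factor
    in the rigid stabiliser of an ancestor at the depth of w. Transitivity on the level carries it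
    to w. *)
Lemma rist_neq1 w : exists2 x, rist w x & x <> 1.
Proof.
have [l rl] := ba_rist ba (dep w).
have [g Sg g1] := level_stab_neq1 (maxn l (dep w)).
have [u gu] := moved_vertex g1.
have wu : (dep w <= dep u)%N.
  apply: contrapT => /negP; rewrite -ltnNge => /ltnW uw; apply: gu; apply: Sg.
  by rewrite leq_max uw orbT.
have du := dep_anc rp wu.
have [x xw ax] := rl g (level_stabS (leq_maxl _ _) Sg) _ du.
have [h hw] := la_trans ba du.
exists (x ^ h^-1).
  by have := ristJ ta (g := h^-1) xw; rewrite invgK hw.
move=> /eqP; rewrite conjg_eq1 => /eqP x1; apply: gu.
by rewrite -ax; [rewrite x1 (act1 ta)|exact: below_anc].
Qed.

(** Let x move a vertex u, and let y in the rigid stabiliser of u move v. Then x takes v out of the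
    support of y, so that x and y do not commute. *)
Lemma rist_nonabelian w : exists x y, [/\ rist w x, rist w y & ~ commute x y].
Proof.
have [x xw x1] := rist_neq1 w; have [u xu] := moved_vertex x1.
have wu : below w u by apply: contrapT => /xw.
have [y yu y1] := rist_neq1 u; have [v yv] := moved_vertex y1.
have uv : below u v by apply: contrapT => /yu.
exists x, y; split=> //; first exact: ristS yu.
move=> xy; apply: yv; apply: (act_inj ta (g := x)).
rewrite -(actM ta) xy (actM ta); apply: yu => uxv; apply: xu; apply/esym.
apply: (below_eq_dep rp uxv); rewrite ?(dep_act ta) //.
exact: (below_act ta).
Qed.

(* Elements acting on each subtree T_(b w) as an element of L ^ (b^-1) form a
   closed normal subgroup, which is open since B is just infinite. *)
Lemma rist_subgroup_open w L : is_subgroup L -> closed L -> L `<=` rist w ->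
  normalised [set h | act h w = w] L -> L <> [set 1] ->
  exists l, forall g, St l g -> exists2 x, L x & agree x g w.
Proof.
move=> sL cL Lw nL L1.
pose n := dep w.
pose Q := [set g | St n g /\
  forall b, exists2 x, L x & agree (x ^ b^-1) g (act b w)].
have fixL x b : L x -> act (x ^ b^-1) (act b w) = act b w.
  move=> /Lw xw; apply: (rist_fix rp ta).
  by have := ristJ ta (g := b^-1) xw; rewrite invgK.
have sQ : is_subgroup Q.
  have sS := level_stab_subgroup ta n; split.
  - split=> [|b]; first exact: (subg1 sS).
    by exists 1; [exact: (subg1 sL)|rewrite conj1g].
  - move=> g g' [Sg Lg] [Sg' Lg']; split=> [|b]; first exact: (subgM sS).
    have [x Lx ax] := Lg b; have [x' Lx' ax'] := Lg' b.
    exists (x * x'); first exact: (subgM sL).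
    by rewrite conjMg; apply: (agreeM ta) => //; exact: fixL.
  - move=> g [Sg Lg]; split=> [|b]; first exact: (subgV sS).
    have [x Lx ax] := Lg b; exists (x^-1); first exact: (subgV sL).
    by rewrite conjVg; apply: (agreeV ta) => //; exact: fixL.
have nQ : normalised [set: B] Q.
  move=> h g _ [Sg Lg]; split=> [|b]; first exact: (level_stab_normal ta).
  have [x Lx ax] := Lg (h * b); exists x => //.
  by move: ax; rewrite (actM ta) => /(agreeJ ta); rewrite -conjgM invgM mulgVK.
have cQ : closed Q.
  have -> : Q = St n `&` \bigcap_b [set g | exists2 x, L x &
      agree (x ^ b^-1) g (act b w)].
    by apply/seteqP; split=> g [Sg Lg]; split=> // b; have := Lg b; [|apply].
  apply: closedI.
    by apply: closed_open_subg; [exact: (level_stab_subgroup ta)|exact: (open_level_stab ba)].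
  (* A limit point g is matched on the subtree at [act b w], to every finite depth, by conjugates of
     elements of L; compactness merges these into one element. *)
  apply: closed_bigI => b _; rewrite closure_id; apply/seteqP; split.
    exact: subset_closure.
  move=> g clg; have [||x Lx ax] := agree_compact ba cB (K := conj_set L b^-1) (g := g) (w := act b w).
  - exact: closed_conj_set.
  - move=> k; have [|h [/= [x Lx ax] hk]] := clg [set h | St k (g^-1 * h)].
      apply: open_nbhs_nbhs; split; first exact: (open_coset g (open_level_stab ba k)).
      by rewrite /= mulVg; exact: (subg1 (level_stab_subgroup ta _)).
    exists (x ^ b^-1); first by exists x.
    move=> u bu uk; rewrite ax // -[in LHS](mulVKg g h) (actM ta) hk //.
  by case: Lx ax => y Ly <- ay; exists y.
have Q1 : Q <> [set 1].
  have [x0 Lx0 x01] : exists2 x, L x & x <> 1.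
    apply: contrapT => nex; apply: L1; apply/seteqP; split=> [x Lx|_ ->].
      by apply: contrapT => x1; apply: nex; exists x.
    exact: subg1.
  (* Any nontrivial [x0] in L belongs to Q: it is trivial on the subtree at [act b w] unless b fixes
     w, and in that case its conjugate by b stays in L. *)
  suff Qx : Q x0 by move=> eQ; rewrite eQ in Qx.
  split=> [|b]; first exact: (rist_level_stab rp ta (leqnn _) (Lw _ Lx0)).
  have [bw|nbw] := pselect (act b w = w).
    exists (x0 ^ b); first exact: nL.
    by rewrite conjgK bw.
  exists 1; first exact: subg1.
  rewrite conj1g => u bu; rewrite (act1 ta) (Lw _ Lx0) // => wu.
  by apply: nbw; apply: (below_eq_dep rp bu wu); rewrite (dep_act ta).
have [l Sl] := (let: And3 _ _ h := level_stab_base ba cB in h) _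
  (just_infinite_open sQ nQ cQ Q1) (subg1 sQ).
exists l => g /Sl [_ /(_ 1)] [x Lx].
by rewrite invg1 conjg1 (act1 ta) => ax; exists x.
Qed.

End BranchAction.

(** * Closed subgroups of a branch group normalised by a level stabiliser *)

Section LocallyNormal.
Context {B : topGroupType} {V : choiceType}.
Variables (par : V -> V) (dep : V -> nat) (r : V) (act : B -> V -> V).
Implicit Types (g h x y k : B) (u v w : V) (K L : set B) (Y : set V).
Local Notation below := (below par).
Local Notation rist := (rist par act).
Local Notation agree := (agree par act).
Local Notation St := (level_stab dep act).

Hypothesis ba : branch_action par dep r act.
Hypothesis cB : compact [set: B].
Hypothesis jiB : just_infinite B.

Let rp := la_root ba.
Let ta := la_act ba.
Let fa := la_faithful ba.

(** K contains the elements of [rist w] lying in [St l], and these are asked to realise the whole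
    action of [St l] on the subtree at w. The depth l is explicit because it survives conjugation
    and can be made uniform over a level. *)
Definition rist_in K w l := forall g, St l g ->
  exists x, [/\ K x, rist w x & agree x g w].

Lemma moved_rist_in K k w n : is_subgroup K -> closed K ->
  normalised (St n) K -> (n <= dep w)%N -> K k -> act k w <> w ->
  exists l, rist_in K w l.
Proof.
move=> sK cK nK nw Kk kw.
have RS : rist w `<=` St n by exact: (rist_level_stab rp ta).
have commK x y : rist w x -> rist w y -> K [~ x, y].
  by apply: (moved_commutator rp ta fa sK _ Kk kw) => v z /RS; exact: nK.
(* The largest subgroup of K /\ [rist w] normalised by the stabiliser of w. It contains every
   commutator of elements of [rist w], since conjugating such a commutator by the stabiliser gives
   another one; as [rist w] is nonabelian, L is nontrivial. *)
pose L := \bigcap_(h in [set h | act h w = w]) conj_set (K `&` rist w) h.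
have LE x : L x <-> forall h, act h w = w -> (K `&` rist w) (x ^ h).
  split=> Lx h hw.
    by have := Lx h^-1 (fix_inv ta hw); rewrite conj_setE /= invgK.
  by rewrite conj_setE /=; apply: Lx; exact: (fix_inv ta).
have [|||||l Sl] := rist_subgroup_open ba cB jiB (w := w) (L := L).
- apply: is_subgroup_bigcap => h _; apply: is_subgroup_conj_set.
  exact: is_subgroupI sK (rist_subgroup ta w).
- apply: closed_bigI => h _; apply: closed_conj_set; apply: closedI => //.
  exact: (closed_rist ba).
- by move=> x /LE /(_ 1 (act1 ta w)); rewrite conjg1 => -[].
- move=> h x hw /LE Lx; apply/LE => h' hw'; rewrite -conjgM; apply: Lx.
  by rewrite (actM ta) hw' hw.
- have [x [y [xw yw nxy]]] := rist_nonabelian ba cB jiB w.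
  move=> L1; apply: nxy; apply/commgP/eqP.
  suff : L [~ x, y] by rewrite L1.
  apply/LE => h hw; rewrite conjRg.
  have xh z : rist w z -> rist w (z ^ h).
    by move=> zw; have := ristJ ta (g := h) zw; rewrite (fix_inv ta hw).
  split; first by apply: commK; exact: xh.
  have sR := rist_subgroup ta w.
  by rewrite commgEl; apply: (subgM sR); [apply: (subgV sR)|apply: (subgJ sR)]; exact: xh.
exists l => g /Sl [x /LE /(_ 1 (act1 ta w))]; rewrite conjg1 => -[Kx xw] ax.
by exists x.
Qed.

Lemma rist_in_conj n K k w l : normalised (St n) K -> St n k ->
  rist_in K w l -> rist_in K (act k w) l.
Proof.
move=> nK Sk Kl g Sg.
have [x [Kx xw ax]] := Kl (g ^ k) (level_stab_normal ta I Sg).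
have sS := level_stab_subgroup ta n.
exists (x ^ k^-1); split.
- by apply: nK Kx; exact: (subgV sS).
- by have := ristJ ta (g := k^-1) xw; rewrite invgK.
- have := @agreeJ _ _ _ dep _ ta x (g ^ k) k^-1 (act k w).
  by rewrite conjgK (actK ta); apply.
Qed.

Lemma rist_inS K w l l' : (l <= l')%N -> rist_in K w l -> rist_in K w l'.
Proof. by move=> ll' Kl g /(level_stabS ll'); exact: Kl. Qed.

Lemma finite_below w m : finite_set [set u | dep u = m /\ below w u].
Proof. by apply: sub_finite_set (la_level ba m) => u []. Qed.

Lemma below_level m w u : below w u -> (dep w <= m)%N ->
  (m <= dep u)%N -> exists2 v, dep v = m & below w v /\ below v u.
Proof.
move=> wu wm mu; exists (anc par dep m u); first exact: (dep_anc rp).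
split; last exact: below_anc.
by apply: (below_cmp rp wu (below_anc _ _ _ _)); rewrite (dep_anc rp).
Qed.

(** The elements found at the vertices of level m below w are multiplied together. The bound m in
    [maxn l m] makes g trivial between w and level m, where the product is trivial too. *)
Lemma rist_in_up K w m l : is_subgroup K -> (dep w <= m)%N ->
  (forall u, dep u = m -> below w u -> rist_in K u l) ->
  rist_in K w (maxn l m).
Proof.
move=> sK wm Ku g Sg.
have [s us sP] := finite_uniq_seq (finite_below w m).
have [|u us'|x [Kx ax fx]] := combine_rist rp ta (g := fun=> g) (m := m) sK us.
- by move=> u /sP [].
- have /sP [um wu] := us'; apply: (Ku u um wu).
  exact: (level_stabS (leq_maxl _ _) Sg).
exists x; split=> // [u nu|u wu].
  by apply: fx => v /sP [_ wv] vu; apply: nu; exact: below_trans wv vu.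
case: (ltnP (dep u) m) => [um|mu]; last first.
  have [v vm [wv vu]] := below_level wu wm mu.
  by apply: (ax v) => //; apply/sP.
rewrite (Sg u) ?leq_max ?(ltnW um) ?orbT //; apply: fx => v /sP [vm wv] vu.
by have := below_dep rp vu; rewrite vm leqNgt um.
Qed.

Lemma ray : exists c : nat -> V, forall m, dep (c m) = m /\ par (c m.+1) = c m.
Proof.
have [f Pf] : {f : V -> V & forall v, par (f v) = v /\ dep (f v) = (dep v).+1}.
  apply: (@boolp.choice _ _ (fun v w => par w = v /\ dep w = (dep v).+1)) => v.
  by have [w ? ?] := child ba cB jiB v; exists w.
exists (fun m => iter m f r) => m; split; last by rewrite iterS; case: (Pf (iter m f r)).
elim: m => [|m IHm]; first exact: (dep_root rp).
by rewrite iterS; case: (Pf (iter m f r)) => _ ->; rewrite IHm.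
Qed.

(* The number of orbits of St n on a level is bounded by the index of St n; from
   the level m where it is maximal on, orbits are determined by level m. *)
Lemma stable_orbits n m0 : exists2 m, (m0 <= m)%N &
  forall u u' w, dep w = m -> below w u -> below w u' -> dep u = dep u' ->
  exists2 k, St n k & act k u = u'.
Proof.
have sS := level_stab_subgroup ta n.
have [s ss] := compact_coset_reps cB sS (open_level_stab ba n).
have [c cP] := ray.
have cd m : dep (c m) = m by case: (cP m).
have cpar d m : iter d par (c (d + m)%N) = c m.
  by elim: d => [//|d IHd]; rewrite addSn iterSr; case: (cP (d + m)%N) => _ ->.
pose sg (i : 'I_(size s)) := nth 1 s i.
(* [E m] records the pairs of coset representatives that send [c m] into one orbit of [St n]. It
   shrinks as m grows, hence is constant from the m of least cardinality on. *)
pose E m : {set 'I_(size s) * 'I_(size s)} :=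
  finset.finset (fun p => `[< exists2 k, St n k &
      act (k * sg p.1) (c m) = act (sg p.2) (c m) >]).
have ES m m' : (m <= m')%N -> E m' \subset E m.
  move=> mm'; apply/fintype.subsetP => p; rewrite !finset.inE => /asboolP [k Sk ek].
  apply/asboolP; exists k => //; rewrite -(cpar (m' - m)%N m) subnK //.
  elim: (m' - m)%N => [//|d IHd] /=.
  by rewrite -!(par_act ta) IHd.
have [m m0m mE] : exists2 m, (m0 <= m)%N & forall m', (m <= m')%N -> E m' = E m.
  have ex : exists a, `[< exists2 m, (m0 <= m)%N & #|E m| = a >].
    by exists #|E m0|; apply/asboolP; exists m0.
  case: (ex_minnP ex) => a /asboolP [m m0m am] amin; exists m => // m' mm'.
  apply/eqP; rewrite eqEcard ES // am; apply: amin; apply/asboolP.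
  by exists m' => //; exact: leq_trans mm'.
exists m => // u u' w wm wu wu' du.
have repr v : exists k i, St n k /\ act (k * sg i) (c (dep v)) = v.
  have [b bv] := la_trans ba (cd (dep v)); have [c0 c0s Sc] := ss b I.
  exists ((c0^-1 * b) ^ c0^-1).
  have is_ : (index c0 s < size s)%N by rewrite index_mem.
  exists (Ordinal is_); split; first exact: (level_stab_normal ta).
  by rewrite /sg /= nth_index // conjgE invgK !mulgA mulgV mul1g mulgVK.
have [k1 [i1 [Sk1 u1]]] := repr u; have [k2 [i2 [Sk2 u2]]] := repr u'.
rewrite -du in u2; have md : (m <= dep u)%N by rewrite -wm (below_dep rp wu).
have cb : below (c m) (c (dep u)).
  by exists (dep u - m)%N; have := cpar (dep u - m)%N m; rewrite subnK.
have w1 : w = act (k1 * sg i1) (c m).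
  apply: (below_eq_dep rp wu); last by rewrite (dep_act ta) cd.
  by rewrite -[X in below _ X]u1; exact: (below_act ta).
have w2 : w = act (k2 * sg i2) (c m).
  apply: (below_eq_dep rp wu'); last by rewrite (dep_act ta) cd.
  by rewrite -[X in below _ X]u2; exact: (below_act ta).
have : (i1, i2) \in E m.
  rewrite finset.inE; apply/asboolP; exists (k2^-1 * k1).
    exact: (subgM sS (subgV sS Sk2) Sk1).
  by rewrite /= -mulgA (actM ta) -w1 w2 !(actM ta) (actK ta).
rewrite -(mE _ md) finset.inE => /asboolP [k Sk /= ek].
exists (k2 * k * k1^-1).
  exact: (subgM sS (subgM sS Sk2 Sk) (subgV sS Sk1)).
rewrite -[X in act _ X]u1 -(actM ta) -!mulgA mulKg (actM ta) ek -(actM ta).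
exact: u2.
Qed.

(** If K moves some u below w, it contains an open part of the rigid stabiliser of u. The vertices
    below w at the depth of u form part of one orbit of [St n], which normalises K, so the same
    holds at each of them, and then at w. *)
Lemma level_dichotomy n : exists m, [/\ (0 < m)%N, (n <= m)%N &
  forall K, is_subgroup K -> closed K -> normalised (St n) K ->
  forall w, dep w = m ->
  (exists l, rist_in K w l) \/ forall k, K k -> agree k 1 w].
Proof.
(* Starting at n + 1 makes m positive, so that the root is not among the chosen vertices when the
   forest is built. *)
have [m nm om] := stable_orbits n n.+1.
exists m; split; [exact: leq_trans nm|exact: leq_trans nm|].
move=> K sK cK nK w wm.
have [[k Kk [u wu ku]]|nex] :=
  pselect (exists2 k, K k & exists2 u, below w u & act k u <> u); last first.
  right=> k Kk u wu; rewrite (act1 ta); apply: contrapT => ku.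
  by apply: nex; exists k => //; exists u.
left; have mu : (m <= dep u)%N by rewrite -wm (below_dep rp wu).
have [l Kl] := moved_rist_in sK cK nK (leq_trans (ltnW nm) mu) Kk ku.
exists (maxn l (dep u)); apply: rist_in_up => //; first by rewrite wm.
move=> u' du' wu'; have [h Sh <-] := om u u' w wm wu wu' (esym du').
exact: (rist_in_conj nK Sh Kl).
Qed.

(** Its elements may still permute Y and move vertices above level m. Only the intersection with a
    deep level stabiliser is a subgroup of the product of the [rist w] with w in Y. *)
Definition supp m Y : set B :=
  [set g | forall w, dep w = m -> ~ Y w -> agree g 1 w].

(* Up to passing to an open subgroup, every closed locally normal subgroup is
   the product of the rigid stabilizers of some vertices of a level. *)
Lemma locally_supp n : exists m, [/\ (0 < m)%N, (n <= m)%N &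
  forall K, is_subgroup K -> closed K -> normalised (St n) K ->
  exists Y l, [/\ Y `<=` [set w | dep w = m], (m <= l)%N, K `<=` supp m Y &
    St l `&` supp m Y `<=` K]].
Proof.
have [m [m0 nm dm]] := level_dichotomy n; exists m; split=> // K sK cK nK.
pose Y := [set w | dep w = m /\ exists l, rist_in K w l].
have [s us sP] := finite_uniq_seq (la_level ba m).
have [l lP] : exists l, forall w, w \in s -> Y w -> rist_in K w l.
  elim: {us sP}s => [|w s [l lP]]; first by exists 0%N.
  have [[wm [l' lw]]|nYw] := pselect (Y w).
    exists (maxn l l') => v; rewrite inE => /orP [/eqP -> _|vs Yv].
      exact: rist_inS (leq_maxr _ _) lw.
    exact: rist_inS (leq_maxl _ _) (lP v vs Yv).
  by exists l => v; rewrite inE => /orP [/eqP ->|] //; exact: lP.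
exists Y, (maxn l m); split; first by move=> w [].
- exact: leq_maxr.
- move=> k Kk w wm nYw; have [ex|] := dm K sK cK nK w wm; last exact.
  by case: nYw.
move=> g [Sg gY].
have [|||x [Kx ax fx]] := combine_rist rp ta (g := fun=> g) (m := m)
  (s := [seq w <- s | `[< Y w >]]) sK.
- by rewrite filter_uniq.
- by move=> w; rewrite mem_filter => /andP [_ /sP].
- move=> w; rewrite mem_filter => /andP [/asboolP Yw ws].
  by apply: (lP w ws Yw); exact: (level_stabS (leq_maxl _ _) Sg).
suff <- : x = g by [].
apply: (act_ext ta fa) => u; case: (ltnP (dep u) m) => [um|mu].
  rewrite (Sg u) ?leq_max ?(ltnW um) ?orbT //; apply: fx => v.
  rewrite mem_filter => /andP [_ /sP vm] vu.
  by have := below_dep rp vu; rewrite vm leqNgt um.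
pose v := anc par dep m u; have vm : dep v = m by rewrite (dep_anc rp).
have vu : below v u by exact: below_anc.
have [Yv|nYv] := pselect (Y v).
  apply: (ax v) vu; rewrite mem_filter; apply/andP; split; first exact/asboolP.
  exact/sP.
rewrite (gY v) // (act1 ta); apply: fx => v'; rewrite mem_filter.
move=> /andP [/asboolP Yv' /sP v'm] v'u; apply: nYv.
by rewrite (below_eq_dep rp vu v'u) // vm v'm.
Qed.

(** For z deep enough, the part a of z over Y lies in K. The rest of z is trivial over Y, whereas K
    is trivial below the other vertices of level m and permutes Y; hence the rest centralises K. *)
Lemma locally_complemented n K : is_subgroup K -> closed K ->
  normalised (St n) K ->
  exists l, forall z, St l z -> exists2 a, K a & cent K (a^-1 * z).
Proof.
move=> sK cK nK; have [m [m0 nm /(_ K sK cK nK)]] := locally_supp n.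
move=> [Y [l [Ym ml KY YK]]].
have [l1 r1] := ba_rist ba m.
have [s us sP] := finite_uniq_seq (sub_finite_set Ym (la_level ba m)).
exists (maxn l l1) => z Sz.
have Slz := level_stabS (leq_maxl l l1) Sz.
have [|w|a [_ az fa_]] := combine_rist rp ta (g := fun=> z) (m := m)
  is_subgroupT us.
- by move=> w /sP /Ym.
- move=> /sP /Ym wm.
  by have [x xw xz] := r1 z (level_stabS (leq_maxr l l1) Sz) w wm; exists x.
have aE u : (exists2 w, Y w & below w u) -> act a u = act z u.
  by move=> [w /sP ws wu]; exact: (az w).
have aF u : (forall w, Y w -> ~ below w u) -> act a u = u.
  by move=> nY; apply: fa_ => w /sP; exact: nY.
have Ka : K a.
  apply: YK; split=> [u ul|w wm nYw u wu].
    have [ex|nex] := pselect (exists2 w, Y w & below w u).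
      by rewrite aE // Slz.
    by rewrite aF // => w Yw wu; apply: nex; exists w.
  rewrite (act1 ta); apply: aF => w' Yw' w'u; apply: nYw.
  by rewrite (below_eq_dep rp wu w'u) // wm (Ym _ Yw').
exists a => // k Kk.
have cY w u : Y w -> below w u -> act (a^-1 * z) u = u.
  by move=> Yw wu; rewrite (actM ta) -(aE u) ?(actK ta) //; exists w.
have ck u : (dep u < m)%N -> act (a^-1 * z) u = u.
  move=> um; rewrite (actM ta) Slz ?(fix_inv ta) ?aF // => [w /Ym wm wu|].
    by have := below_dep rp wu; rewrite wm leqNgt um.
  exact: leq_trans (ltnW um) ml.
apply: (act_ext ta fa) => u; rewrite !(actM ta k) (actM ta _ k).
case: (ltnP (dep u) m) => [um|mu].
  by rewrite !ck ?(dep_act ta).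
pose v := anc par dep m u; have vm : dep v = m by rewrite (dep_anc rp).
have vu : below v u by exact: below_anc.
have [Yv|nYv] := pselect (Y v).
  rewrite (cY v u) // (cY (act k v) (act k u)) //; last exact: (below_act ta).
  (* If [act k v] were outside Y, then [k^-1], an element of K, would fix it, so that it would equal
     v, which is in Y. *)
  apply: contrapT => nYkv.
  have := KY _ (subgV sK Kk) (act k v) _ nYkv (act k v) (below_refl _ _).
  rewrite (dep_act ta) => /(_ vm); rewrite (actK ta) (act1 ta) => e.
  by rewrite -e in nYkv.
have kf v1 : below v v1 -> act k v1 = v1.
  by move=> vv1; rewrite (KY k Kk v) // (act1 ta).
rewrite !kf //; apply/(below_fixed ta) => //.
rewrite (actM ta) Slz ?vm // (fix_inv ta) // aF // => w Yw wv; apply: nYv.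
by rewrite -(below_eq_dep rp wv (below_refl _ _)) // vm (Ym _ Yw).
Qed.

End LocallyNormal.

(** * Passage between the definition of branch groups and parent functions *)

Lemma branch_group_action (B : topGroupType) : compact [set: B] ->
  branch_group B ->
  exists (V : choiceType) (par : V -> V) (dep : V -> nat) (r : V)
    (act : B -> V -> V), branch_action par dep r act.
Proof.
move=> cB [_ [V [e [r [act [te lfe [[a1 aM] ae ar astab] fa branch]]]]]].
have [par [dep [rp eE]]] := tree_parent r te.
have sE n := sphereE rp n te eE.
have actK g v : act g^-1 (act g v) = v by rewrite -aM mulVg a1.
have ainj g : injective (act g) by move=> u v euv; rewrite -(actK g u) euv actK.
have dep_act g v : dep (act g v) = dep v.
  have : sphere e r (dep v) (act g v).
    have : sphere e r (dep v) v by rewrite sE.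
    move=> [p [pp up lp] sp]; exists (map (act g) p); last by rewrite size_map.
    split.
    - rewrite -{1}(ar g) path_map; apply: sub_path pp => x y /=.
      by rewrite ae.
    - by rewrite -{1}(ar g) -map_cons map_inj_uniq.
    - by rewrite -{1}(ar g) last_map lp.
  by rewrite sE.
have par_act g v : par (act g v) = act g (par v).
  have [->|nr] := eqVneq v r; first by case: rp => pr _ _; rewrite ar pr ar.
  have := ae g v (par v); rewrite !eE par_edge_par //.
  case/orP => /andP [ng /eqP ge //].
  (* The other orientation of the image edge would make [act g v] the parent of [act g (par v)],
     against the depths. *)
  have := congr1 dep ge; rewrite (dep_par rp) !dep_act (dep_par rp).
  have : dep v != 0%N by rewrite (dep_eq0 rp).
  case: (dep v) => // d _ /= /eqP; rewrite -[d.+1]addn1 -{1}(subn0 d).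
  by case: d => // d; rewrite subn0 addn1 eqn_leq ltnNge leqnSn andbF.
have la : level_action par dep r act.
  split=> //.
  - elim=> [|n IHn].
      apply: (@sub_finite_set _ _ [set r]) => // v /= /eqP.
      by rewrite (dep_eq0 rp) => /eqP.
    apply: (@sub_finite_set _ _ (\bigcup_(v in [set v | dep v = n]) [set w | e v w])).
      move=> w dw; exists (par w); first by rewrite /= (dep_par rp) dw.
      by rewrite /= eE par_edge_sym par_edge_par // -(dep_eq0 rp) dw.
    by apply: bigcup_finite => // v _; exact: lfe.
  - move=> v w dvw; have [tr _] := branch (dep v); by apply: tr; rewrite sE.
exists V, par, dep, r, act; split=> // n.
have [_ [K [S [R [[sK cK] fK SE dp RS]]]]] := branch n.
have oK : open K.
  by apply: (@open_of_finite_index _ setT) => //; exact: openT.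
have [l Sl] := (let: And3 _ _ h := level_stab_base la cB in h) _ oK (subg1 sK).
exists l => g /Sl Kg w dw.
have wS : w \in S by have : [set` S] w by rewrite SE sE.
case: dp => _ _ [_ _ surj] _ _; have [x Dx xg] := surj g Kg.
have xR (i : S) : rist par act (val i) (x i).
  move=> u nu; apply: (RS i (x i) u (Dx i)) => /(descendsE rp _ _ te eE).
  exact: nu.
have ta := la_act la.
have [] := prod_rist rp ta (f := val) (x := x) (m := n) (index_enum_uniq S).
- by move=> i j _ _; exact: val_inj.
- move=> i _; have : [set` S] (val i) by exact: (valP i).
  by rewrite SE sE.
- by move=> i _; exact: xR.
move=> agr _; exists (x [` wS]%fset); first exact: (xR [` wS]%fset).
move=> u wu; rewrite -xg; apply/esym/(agr [` wS]%fset) => //.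
exact: mem_index_enum.
Qed.

Section BranchActionGroup.
Context {B : topGroupType} {V : choiceType}.
Variables (par : V -> V) (dep : V -> nat) (r : V) (act : B -> V -> V).
Local Notation below := (below par).
Local Notation rist := (rist par act).
Local Notation agree := (agree par act).
Local Notation St := (level_stab dep act).

Lemma level_action_zero_dim : level_action par dep r act -> zero_dimensional B.
Proof.
move=> la x y /eqP xy.
have [u xyu] : exists u, act x u <> act y u.
  apply: contrapT => nex; apply: xy; apply: (act_ext (la_act la) (la_faithful la)).
  by move=> u; apply: contrapT => n; apply: nex; exists u.
exists [set g | [set act x u] (act g u)]; split=> //=; last exact/nesym.
split; first exact: (open_act la u [set act x u]).
exact: (@closed_act _ _ _ _ _ _ la u [set act x u]).
Qed.

Lemma level_action_hausdorff : level_action par dep r act -> hausdorff_space B.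
Proof.
move=> /level_action_zero_dim zd; rewrite open_hausdorff => x y /zd.
move=> [U [[oU cU] Ux nUy]]; exists (U, ~` U).
  by split=> /=; apply/mem_set.
by split=> //=; [exact: closed_openC|apply/eqP/setICr].
Qed.

Hypothesis ba : branch_action par dep r act.
Hypothesis cB : compact [set: B].

Let rp := la_root ba.
Let ta := la_act ba.
Let fa := la_faithful ba.

Lemma branch_action_product n : exists (K : set B) (S : {fset V}) (R : S -> set B),
  [/\ is_subgroup K /\ closed K, finite_index [set: B] K,
      [set` S] = [set v | dep v = n], direct_product R K &
      forall (v : S) g w, R v g -> ~ below (val v) w -> act g w = w].
Proof.
pose S : {fset V} := fset_set [set v | dep v = n].
have SE : [set` S] = [set v | dep v = n] by rewrite fset_setK //; exact: (la_level ba).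
have Sn (i : S) : dep (val i) = n.
  have : [set` S] (val i) by exact: (valP i).
  by rewrite SE.
have inS v : dep v = n -> exists i : S, val i = v.
  move=> vn; have vS : v \in S.
    by suff : [set` S] v by []; rewrite SE.
  by exists [` vS]%fset.
pose R (v : S) := rist (val v).
have sR v : is_subgroup (R v) by exact: (rist_subgroup ta).
have prodE (x : S -> B) : boxed R x ->
    (forall i, agree (\prod_j x j) (x i) (val i)) /\
    (forall u, (forall i : S, ~ below (val i) u) -> act (\prod_j x j) u = u).
  move=> Rx; have [] := prod_rist rp ta (f := val) (x := x) (m := n)
    (index_enum_uniq S).
  - by move=> i j _ _; exact: val_inj.
  - by move=> i _.
  - by move=> i _; exact: Rx.
  move=> agr fixd; split=> [i|u nu]; first by apply: agr; exact: mem_index_enum.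
  by apply: fixd => i _; exact: nu.
have prodP (x : S -> B) g : boxed R x -> (forall i, agree (x i) g (val i)) ->
    (forall u, (forall i : S, ~ below (val i) u) -> act g u = u) ->
    g = \prod_i x i.
  move=> Rx xg gf; have [agr fixd] := prodE x Rx; apply: (act_ext ta fa) => u.
  have [[i iu]|nex] := pselect (exists i : S, below (val i) u).
    by rewrite (agr i) // (xg i).
  by rewrite gf ?fixd // => i iu; apply: nex; exists i.
pose K := [set g | exists2 x, boxed R x & g = \prod_i x i].
have cR i j : i <> j -> R i `<=` cent (R j).
  move=> ij x Rx y Ry; apply: (rist_commute rp ta fa _ _ Rx Ry).
    by rewrite !Sn.
  by move/val_inj.
have sK : is_subgroup K.
  split.
  - by exists (fun=> 1) => [i|]; [exact: (subg1 (sR i))|rewrite big1].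
  - move=> _ _ [x Rx ->] [y Ry ->]; exists (fun i => x i * y i).
      by move=> i; exact: (subgM (sR i) (Rx i) (Ry i)).
    by rewrite (prod_commuting_mul cR).
  - move=> _ [x Rx ->]; exists (fun i => (x i)^-1).
      by move=> i; exact: (subgV (sR i) (Rx i)).
    have Rx' : boxed R (fun i => (x i)^-1) by move=> i; exact: (subgV (sR i) (Rx i)).
    apply: (mulgI (\prod_i x i)); rewrite mulgV -(prod_commuting_mul cR Rx Rx').
    by rewrite big1 // => i _; rewrite mulgV.
have [l Sl] : exists l, St l `<=` K.
  have [l rl] := ba_rist ba n; exists (maxn l n) => g Sg.
  have [x Px] : {x : S -> B & forall i, R i (x i) /\ agree (x i) g (val i)}.
    apply: (@boolp.choice _ _ (fun i x => R i x /\ agree x g (val i))) => i.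
    have [x ? ?] := rl g (level_stabS (leq_maxl _ _) Sg) (val i) (Sn i).
    by exists x.
  exists x; first by move=> i; have [] := Px i.
  apply: prodP => [i|i|u nu]; [by have [] := Px i|by have [] := Px i|].
  case: (leqP n (dep u)) => [nu'|un]; last first.
    by apply: Sg; rewrite leq_max (ltnW un) orbT.
  have [i ei] := inS _ (dep_anc rp nu').
  by case: (nu i); rewrite ei; exact: below_anc.
have oK : open K.
  apply: (open_subgS sK (open_level_stab ba l) _ Sl).
  exact: (level_stab_subgroup ta).
exists K, S, R; split=> //.
- by split=> //; exact: closed_open_subg.
- exact: compact_finite_index.
- apply: (direct_product_commuting sR cR (level_stab_base ba cB)) => //.
  + move=> i; exists (R i); first exact: (closed_rist ba).
    apply/seteqP; split=> [g Rg|g []] //; split=> //.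
    have Rx : boxed R (fun j => if j == i then g else 1).
      by move=> j; case: eqP => [->|_] //; exact: (subg1 (sR j)).
    exists (fun j => if j == i then g else 1) => //; apply: prodP => // [j|u nu].
      case: eqP => [->|ji] // u ju; rewrite (act1 ta) Rg // => iu.
      by apply: ji; apply: val_inj; apply: (below_eq_dep rp ju iu); rewrite !Sn.
    by apply: Rg; exact: nu.
  + move=> k; exists k => x Rx Sx i u uk.
    have [agr fixd] := prodE x Rx.
    have [iu|niu] := pselect (below (val i) u); last exact: (Rx i).
    by rewrite -(agr i) // Sx.
  + by move=> x Sx; apply: fa => v; exact: (Sx (dep v)).
- by move=> v g w Rg; exact: Rg.
Qed.

Lemma branch_action_group : branch_group B.
Proof.
have te := par_edge_tree rp.
split; first by left.
exists V, (par_edge par r), r, act; split=> //.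
- move=> v; apply: (@sub_finite_set _ _
    ([set w | dep w = (dep v).-1] `|` [set w | dep w = (dep v).+1])).
    by move=> w /(dep_edge rp) [e|e]; [left|right]; rewrite /= e.
  by rewrite finite_setU; split; exact: (la_level ba).
- split=> [|g v w|g|v].
  + by split; [exact: (act1 ta)|exact: (actM ta)].
  + rewrite /par_edge !(par_act ta) !(inj_eq (act_inj ta (g := g))).
    by rewrite -!(dep_eq0 rp) !(dep_act ta).
  + by apply/eqP; rewrite -(dep_eq0 rp) (dep_act ta) (dep_root rp).
  + exact: (la_stab ba).
move=> n; rewrite (sphereE rp n te (fun _ _ => erefl)); split.
  by move=> v w /= <- vw; exact: (la_trans ba).
have [K [S [R [sK fK SE dp RS]]]] := branch_action_product n.
exists K, S, R; split=> // v g w Rg nd; apply: RS Rg _ => b; apply: nd.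
exact/(descendsE rp _ _ te (fun _ _ => erefl)).
Qed.

End BranchActionGroup.

(** * The group of piecewise elements *)

(* Data from which a just infinite branch group with an open subgroup
   isomorphic to the product of the rist w, w in Y, is built. *)
Record piece_data := PieceData {
  pd_B : topGroupType;
  pd_V : choiceType;
  pd_par : pd_V -> pd_V;
  pd_dep : pd_V -> nat;
  pd_r : pd_V;
  pd_act : pd_B -> pd_V -> pd_V;
  pd_ba : branch_action pd_par pd_dep pd_r pd_act;
  pd_m : nat;
  pd_Y : set pd_V;
  pd_Ym : pd_Y `<=` [set w | pd_dep w = pd_m] }.

Section PieceMaps.
Variable D : piece_data.
Local Notation B := (pd_B D).
Local Notation V := (pd_V D).
Local Notation par := (@pd_par D).
Local Notation dep := (@pd_dep D).
Local Notation act := (@pd_act D).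
Local Notation below := (below par).
Local Notation Y := (@pd_Y D).
Local Notation m := (pd_m D).
Implicit Types (u v w : V) (b : V -> B) (s t : V -> V).

Let ba := pd_ba D.
Let rp := la_root ba.
Let ta := la_act ba.

Definition over_Y u := exists2 w, Y w & below w u.

Definition permuting b :=
  (forall w, Y w -> Y (act (b w) w)) /\
  (forall w w', Y w -> Y w' -> act (b w) w = act (b w') w' -> w = w').

Definition pieces_of b s :=
  (forall w u, Y w -> below w u -> s u = act (b w) u) /\
  (forall u, ~ over_Y u -> s u = u).

(** Such a map is the identity above level m even when it permutes Y, so it need not be an
    automorphism of the original tree; it acts by automorphisms on the forest over Y. *)
Definition piecewise s := exists2 b, permuting b & pieces_of b s.

Lemma Y_dep w : Y w -> dep w = m. Proof. exact: pd_Ym. Qed.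

Lemma Y_uniq w w' u : Y w -> Y w' -> below w u -> below w' u -> w = w'.
Proof.
by move=> Yw Yw' wu w'u; apply: (below_eq_dep rp wu w'u); rewrite !Y_dep.
Qed.

Lemma permuting_surj b w : permuting b -> Y w ->
  exists2 w0, Y w0 & act (b w0) w0 = w.
Proof.
move=> [bY binj] Yw.
have [s us sP] := finite_uniq_seq (sub_finite_set (@pd_Ym D) (la_level ba m)).
have usb : uniq [seq act (b v) v | v <- s].
  by rewrite map_inj_in_uniq // => v v' /sP Yv /sP Yv'; exact: binj.
have [||_ sE] := uniq_min_size usb (s2 := s) _ _.
- by move=> _ /mapP [v /sP Yv ->]; apply/sP; exact: bY.
- by rewrite size_map.
have /mapP [w0 /sP Yw0 ->] : w \in [seq act (b v) v | v <- s].
  by rewrite sE; exact/sP.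
by exists w0.
Qed.

Lemma piecewise_over s b u : permuting b -> pieces_of b s -> over_Y u ->
  over_Y (s u).
Proof.
move=> [bY _] [sb _] [w Yw wu]; rewrite (sb w) //; exists (act (b w) w).
  exact: bY.
exact: (below_act ta).
Qed.

Lemma piecewise_inj s : piecewise s -> injective s.
Proof.
move=> [b pb ps] u u'.
have [[w Yw wu]|nu] := pselect (over_Y u);
  have [[w' Yw' wu']|nu'] := pselect (over_Y u').
- have [bY binj] := pb; have [sb _] := ps; rewrite (sb w) // (sb w') // => e.
  have ww' : w = w'.
    apply: binj => //; apply: (@Y_uniq _ _ (act (b w) u)); try exact: bY.
      exact: (below_act ta).
    by rewrite e; exact: (below_act ta).
  by move: e; rewrite ww' => /(act_inj ta).
- have [_ sf] := ps; rewrite (sf u') // => e.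
  by case: nu'; rewrite -e; apply: (piecewise_over pb ps); exists w.
- have [_ sf] := ps; rewrite (sf u) // => e.
  by case: nu; rewrite e; apply: (piecewise_over pb ps); exists w'.
- by have [_ sf] := ps; rewrite !sf.
Qed.

Lemma piecewise_surj s u : piecewise s -> exists v, s v = u.
Proof.
move=> [b pb [sb sf]]; have [[w Yw wu]|nu] := pselect (over_Y u); last first.
  by exists u; exact: sf.
have [w0 Yw0 e] := permuting_surj pb Yw.
exists (act (b w0)^-1 u); rewrite (sb w0) ?(actKV ta) //.
by rewrite -e in wu; rewrite -(below_actE ta (b w0)) (actKV ta).
Qed.

Lemma piecewise_dep s u : piecewise s -> dep (s u) = dep u.
Proof.
move=> [b pb [sb sf]]; have [[w Yw wu]|nu] := pselect (over_Y u).
  by rewrite (sb w) ?(dep_act ta).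
by rewrite sf.
Qed.

Lemma piecewise_id : piecewise id.
Proof.
exists (fun=> 1); first by split=> [w|w w' _ _]; rewrite !(act1 ta).
by split=> // w u _ _; rewrite (act1 ta).
Qed.

Lemma piecewise_comp s t : piecewise s -> piecewise t -> piecewise (s \o t).
Proof.
move=> [b pb [sb sf]] [c pc [tc tf]].
have [bY binj] := pb; have [cY cinj] := pc.
exists (fun w => b (act (c w) w) * c w).
  split=> [w Yw|w w' Yw Yw']; first by rewrite (actM ta); exact/bY/cY.
  by rewrite !(actM ta) => /binj e; apply: cinj => //; apply: e; exact: cY.
split=> [w u Yw wu|u nu] /=; last by rewrite tf // sf.
rewrite (tc w) // (actM ta) (sb (act (c w) w)) //; first exact: cY.
exact: (below_act ta).
Qed.

Definition piece_inv s u := xget u [set v | s v = u].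

Lemma piece_invK s u : piecewise s -> s (piece_inv s u) = u.
Proof.
move=> /(piecewise_surj u) [v sv]; rewrite /piece_inv.
exact: (xgetPex u (ex_intro (fun v => s v = u) v sv)).
Qed.

Lemma piece_Kinv s u : piecewise s -> piece_inv s (s u) = u.
Proof. by move=> ps; apply: (piecewise_inj ps); exact: piece_invK. Qed.

Lemma piecewise_inv s : piecewise s -> piecewise (piece_inv s).
Proof.
move=> ps; have [b pb [sb sf]] := ps; have [bY binj] := pb.
have [c Pc] : {c : V -> V & forall w, Y w -> Y (c w) /\ act (b (c w)) (c w) = w}.
  apply: (@boolp.choice _ _ (fun w v => Y w -> Y v /\ act (b v) v = w)) => w.
  have [Yw|nYw] := pselect (Y w); last by exists w.
  by have [v Yv ev] := permuting_surj pb Yw; exists v.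
have cE w : Y w -> act (b (c w))^-1 w = c w.
  by move=> /Pc [_ e]; rewrite -{2}e (actK ta).
exists (fun w => (b (c w))^-1).
  split=> [w Yw|w w' Yw Yw'].
    by rewrite cE //; case: (Pc w Yw).
  rewrite !cE // => e; have [_ <-] := Pc w Yw; have [_ <-] := Pc w' Yw'.
  by rewrite e.
split=> [w u Yw wu|u nu]; apply: (piecewise_inj ps); rewrite piece_invK //.
  have [Yc e] := Pc w Yw; rewrite (sb (c w)) ?(actKV ta) //.
  by rewrite -(below_actE ta (b (c w))) (actKV ta) e.
by rewrite sf.
Qed.

End PieceMaps.

Definition pieces (D : piece_data) := {s : pd_V D -> pd_V D | piecewise s}.

(** * The topological group of piecewise maps *)

Section PiecesGroup.
Variable D : piece_data.
Local Notation V := (pd_V D).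
Local Notation dep := (@pd_dep D).
Implicit Types (x y z : pieces D) (u : V).

HB.instance Definition _ := gen_eqMixin (pieces D).
HB.instance Definition _ := gen_choiceMixin (pieces D).

Lemma pieces_ext x y : (forall u, sval x u = sval y u) -> x = y.
Proof. by case: x y => s ps [t pt] /= /funext e; exact: eq_exist. Qed.

Definition pieces_mul x y : pieces D :=
  exist _ _ (piecewise_comp (svalP x) (svalP y)).
Definition pieces_one : pieces D := exist _ _ (piecewise_id D).
Definition pieces_inv x : pieces D := exist _ _ (piecewise_inv (svalP x)).

Lemma pieces_mulA : associative pieces_mul.
Proof. by move=> x y z; exact: pieces_ext. Qed.
Lemma pieces_mul1 : left_id pieces_one pieces_mul.
Proof. by move=> x; exact: pieces_ext. Qed.
Lemma pieces_mulr1 : right_id pieces_one pieces_mul.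
Proof. by move=> x; exact: pieces_ext. Qed.
Lemma pieces_mulV : left_inverse pieces_one pieces_inv pieces_mul.
Proof.
by move=> x; apply: pieces_ext => u /=; rewrite piece_Kinv //; exact: svalP.
Qed.
Lemma pieces_mulrV : right_inverse pieces_one pieces_inv pieces_mul.
Proof.
by move=> x; apply: pieces_ext => u /=; rewrite piece_invK //; exact: svalP.
Qed.

HB.instance Definition _ := isGroup.Build (pieces D) pieces_mulA pieces_mul1
  pieces_mulr1 pieces_mulV pieces_mulrV.

Definition pieces_ball x n : set (pieces D) :=
  [set y | forall u, (dep u <= n)%N -> sval y u = sval x u].

Definition pieces_nbhs x : set_system (pieces D) :=
  filter_from [set: nat] (pieces_ball x).

HB.instance Definition _ := hasNbhs.Build (pieces D) pieces_nbhs.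

Lemma pieces_nbhs_filter x : ProperFilter (nbhs x).
Proof.
apply: filter_from_proper; last by move=> n _; exists x.
apply: filter_from_filter; first by exists 0%N.
move=> n k _ _; exists (maxn n k) => // y yx; split=> u un; apply: yx;
  by rewrite leq_max un ?orbT.
Qed.

Lemma pieces_nbhs_singleton x (A : set (pieces D)) : nbhs x A -> A x.
Proof. by move=> [n _]; apply. Qed.

Lemma pieces_nbhs_nbhs x (A : set (pieces D)) : nbhs x A -> nbhs x (nbhs^~ A).
Proof.
move=> [n _ nA]; exists n => // y yx; exists n => // z zy; apply: nA => u un.
by rewrite zy // yx.
Qed.

HB.instance Definition _ := Nbhs_isNbhsTopological.Build (pieces D)
  pieces_nbhs_filter pieces_nbhs_singleton pieces_nbhs_nbhs.

Lemma pieces_mulg_continuous : continuous (fun x : pieces D * pieces D => x.1 * x.2).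
Proof.
move=> [x y] A [n _ nA]; exists (pieces_ball x n, pieces_ball y n) => /=.
  by split; exists n.
move=> [x' y'] /= [xx' yy']; apply: nA => u un /=.
rewrite yy' // xx' // (piecewise_dep _ (svalP y)) //.
Qed.

Lemma pieces_invg_continuous : continuous (fun x : pieces D => x^-1).
Proof.
move=> x A [n _ nA]; exists n => // x' xx'; apply: nA => u un /=.
apply: (piecewise_inj (svalP x')); rewrite piece_invK; last exact: svalP.
rewrite xx' ?piece_invK //; try exact: svalP.
by rewrite (piecewise_dep _ (piecewise_inv (svalP x))).
Qed.

HB.instance Definition _ := Topological_isTopologicalGroup.Build (pieces D)
  pieces_mulg_continuous pieces_invg_continuous.

End PiecesGroup.

Section RistOpen.
Context {B : topGroupType} {V : choiceType}.
Variables (par : V -> V) (dep : V -> nat) (r : V) (act : B -> V -> V).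
Hypothesis ba : branch_action par dep r act.
Hypothesis cB : compact [set: B].

(** Here g is controlled only on the subtree at w. The elements fixing w and agreeing on its subtree
    with some element of [rist w] in the level stabiliser form an open subgroup A. The conditions of
    being trivial on the subtree down to depth k decrease to its pointwise stabiliser, which lies in
    A; by compactness one of them already implies membership in A. *)
Lemma agree_rist_near w l : exists k, forall g,
  (forall u, below par w u -> (dep u <= k)%N -> act g u = u) ->
  exists x, [/\ rist par act w x, level_stab dep act l x & agree par act x g w].
Proof.
have ta := la_act ba; have rp := la_root ba.
have sS n := level_stab_subgroup ta n; have sR := rist_subgroup ta w.
pose A := [set g | act g w = w /\ exists x, [/\ rist par act w x,
  level_stab dep act l x & agree par act x g w]].
have sA : is_subgroup A.
  split.
  - split; first exact: (act1 ta).
    by exists 1; split; [exact: subg1 sR|exact: subg1 (sS l)|].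
  - move=> g h [gw [x [xw xl xg]]] [hw [y [yw yl yh]]]; split.
      by rewrite (actM ta) hw.
    exists (x * y); split; [exact: (subgM sR)|exact: (subgM (sS l))|].
    by apply: (agreeM ta) => //; exact: (rist_fix rp ta).
  - move=> g [gw [x [xw xl xg]]]; split; first exact: (fix_inv ta).
    exists x^-1; split; [exact: (subgV sR)|exact: (subgV (sS l))|].
    by apply: (agreeV ta) => //; exact: (rist_fix rp ta).
have oA : open A.
  have [l1 r1] := ba_rist ba (dep w).
  apply: (open_subgS sA (open_level_stab ba (maxn l1 (maxn l (dep w))))) => //.
  move=> g Sg; split; first by apply: Sg; rewrite !leq_max leqnn !orbT.
  have [x xw xg] := r1 g (level_stabS (leq_maxl _ _) Sg) w erefl.
  exists x; split=> // u ul; have [wu|] := pselect (below par w u); last exact: xw.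
  by rewrite xg // Sg // !leq_max ul orbT.
apply: contrapT => nex.
have [|||g Fg] := @compact_decreasing B setT (fun k => [set g | forall u,
    below par w u -> (dep u <= k)%N -> act g u = act 1 u] `&` ~` A) cB (@subsetT _ _).
- move=> k; apply: closedI; first exact: (closed_agree ba).
  exact: open_closedC.
- move=> i j ij g [gj nA]; split=> // u wu ui; apply: gj => //.
  exact: leq_trans ij.
- move=> k; apply: contrapT => ne; apply: nex; exists (maxn k (dep w)) => g gk.
  apply: contrapT => nx; apply: ne; exists g; split=> [u wu uk|[_ ex]].
    by rewrite (act1 ta) gk // leq_max uk.
  exact: nx.
have [_ nA] := Fg 0%N; apply: nA; split.
  have [gw _] := Fg (dep w); rewrite (gw w) ?(act1 ta) //; exact: below_refl.
exists 1; split; [exact: subg1 sR|exact: subg1 (sS l)|move=> u wu].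
by have [gu _] := Fg (dep u); rewrite gu.
Qed.

End RistOpen.

(** * The forest over Y as a rooted tree *)

Section PiecesTree.
Variable D : piece_data.
Local Notation B := (pd_B D).
Local Notation V := (pd_V D).
Local Notation par := (@pd_par D).
Local Notation dep := (@pd_dep D).
Local Notation act := (@pd_act D).
Local Notation r := (pd_r D).
Local Notation bel := (below par).
Local Notation Y := (@pd_Y D).
Local Notation m := (pd_m D).
Local Notation Q := (pieces D).
Local Notation over_Y := (@over_Y D).
Implicit Types (u v w : V) (x y : Q) (g h b : B).

Hypothesis m0 : (0 < m)%N.

Let ba := pd_ba D.
Let rp := la_root ba.
Let ta := la_act ba.

(** The vertex r is reused as the common root of the trees over Y. As m is positive it does not lie
    over Y. *)
Definition in_forest u := (u == r) || `[< over_Y u >].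
Definition forest := {u : V | in_forest u}.
HB.instance Definition _ := Choice.on forest.
Implicit Types (p q : forest).

Lemma in_forest_root : in_forest r. Proof. by rewrite /in_forest eqxx. Qed.
Definition forest_root : forest := exist _ r in_forest_root.

(** The parent of a vertex of Y falls outside the forest, and the default value of [insubd] replaces
    it by the root. *)
Definition forest_par p : forest := insubd forest_root (par (val p)).
(** The shift puts Y at depth 1; truncation gives the root depth 0. *)
Definition forest_dep p : nat := dep (val p) - m.-1.
Definition forest_act x p : forest := insubd forest_root (sval x (val p)).

Lemma over_dep u : over_Y u -> (m <= dep u)%N.
Proof. by move=> [w /Y_dep <- wu]; exact: (below_dep rp). Qed.

Lemma root_not_over : ~ over_Y r.
Proof. by move/over_dep; rewrite (dep_root rp) leqNgt m0. Qed.

Lemma forestP p : val p = r \/ over_Y (val p).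
Proof. by case/orP: (valP p) => [/eqP|/asboolP]; [left|right]. Qed.

Lemma over_forest u : over_Y u -> exists2 p, val p = u & p <> forest_root.
Proof.
move=> ou; have fu : in_forest u by rewrite /in_forest; apply/orP; right; apply/asboolP.
exists (exist _ u fu) => // e; apply: root_not_over.
by have /= <- := congr1 val e.
Qed.

Lemma forest_over p : p <> forest_root -> over_Y (val p).
Proof. by case: (forestP p) => // e np; case: np; exact: val_inj. Qed.

Lemma insubd_over u : over_Y u -> val (insubd forest_root u) = u.
Proof. by move=> ou; rewrite val_insubd /in_forest (asboolT ou) orbT. Qed.

Lemma insubd_not_over u : ~ over_Y u -> insubd forest_root u = forest_root.
Proof.
move=> nu; apply: val_inj; rewrite val_insubd /in_forest asboolF // orbF.
by case: eqP.
Qed.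

Lemma over_below u v : over_Y u -> bel u v -> over_Y v.
Proof. by move=> [w Yw wu] uv; exists w => //; exact: below_trans wu uv. Qed.

Lemma over_par u : over_Y u -> over_Y (par u) \/ dep u = m /\ ~ over_Y (par u).
Proof.
move=> [w Yw wu]; case: (below_eq_or wu) => [<-|]; [right|by left; exists w].
split; first exact: Y_dep.
by move/over_dep; rewrite (dep_par rp) (Y_dep Yw) leqNgt prednK ?leqnn.
Qed.

Lemma forest_par_root : forest_par forest_root = forest_root.
Proof.
rewrite /forest_par /=; case: rp => -> _ _.
exact/insubd_not_over/root_not_over.
Qed.

Lemma forest_dep_root : forest_dep forest_root = 0%N.
Proof. by rewrite /forest_dep /= (dep_root rp). Qed.

Lemma forest_rooted : rooted_parent forest_par forest_dep forest_root.
Proof.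
split; [exact: forest_par_root|exact: forest_dep_root|move=> p /eqP /forest_over op].
have mp := over_dep op; rewrite /forest_par /forest_dep.
case: (over_par op) => [ou|[dm nu]].
  rewrite insubd_over // (dep_par rp); have := over_dep ou.
  rewrite (dep_par rp) => mp'.
  have m1 : (m.-1 <= (dep (val p)).-1)%N by apply: leq_trans mp'; exact: leq_pred.
  by rewrite -subSn // prednK // (leq_trans m0).
rewrite insubd_not_over //= (dep_root rp) dm sub0n.
by rewrite -{1}(prednK m0) subSn // subnn.
Qed.

Lemma below_forest p q : p <> forest_root ->
  below forest_par p q <-> bel (val p) (val q).
Proof.
move=> np; split=> [[k]|[k]].
  have : iter k forest_par q = forest_root \/ val (iter k forest_par q) = iter k par (val q).
    elim: k => [|k [e|e]] /=; [by right|by left; rewrite e forest_par_root|].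
    have [o|no] := pselect (over_Y (par (val (iter k forest_par q)))).
      by right; rewrite /forest_par insubd_over // e.
    by left; rewrite /forest_par insubd_not_over.
  move=> H e; rewrite e in H; case: H => // e'.
  by exists k.
elim: k q => [|k IHk] q; first by move/val_inj => <-; exact: below_refl.
rewrite iterSr => e.
have o : over_Y (par (val q)).
  by apply: over_below (forest_over np) _; exists k.
have [j <-] : below forest_par p (forest_par q).
  by apply: IHk; rewrite /forest_par insubd_over.
by exists j.+1; rewrite iterSr.
Qed.

Lemma pieces_over x u : over_Y u -> over_Y (sval x u).
Proof. by case: x => s [b pb ps] /=; exact: (piecewise_over pb ps). Qed.

Lemma pieces_fix x u : ~ over_Y u -> sval x u = u.
Proof. by case: x => s [b pb [_ sf]] /=; exact: sf. Qed.

Lemma forest_act_root x : forest_act x forest_root = forest_root.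
Proof.
rewrite /forest_act /= (pieces_fix x root_not_over).
exact/insubd_not_over/root_not_over.
Qed.

Lemma val_forest_act x p : val (forest_act x p) = sval x (val p).
Proof.
case: (forestP p) => [e|o]; last by rewrite /forest_act insubd_over //; exact: pieces_over.
have -> : p = forest_root by exact: val_inj.
by rewrite forest_act_root /= (pieces_fix x root_not_over).
Qed.

Lemma pieces_dep x u : dep (sval x u) = dep u.
Proof. exact: (piecewise_dep _ (svalP x)). Qed.

Lemma forest_action : tree_action forest_par forest_dep forest_act.
Proof.
split=> [p|x y p|x p|x p].
- by apply: val_inj; rewrite val_forest_act.
- by apply: val_inj; rewrite !val_forest_act.
- by rewrite /forest_dep val_forest_act pieces_dep.
have [->|np] := pselect (p = forest_root); first by rewrite forest_par_root forest_act_root forest_par_root.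
have op := forest_over np; have oxp := pieces_over x op.
apply: val_inj; rewrite val_forest_act {1}/forest_par val_forest_act.
case: (over_par op) => [o|[dm no]]; last first.
  rewrite [in RHS]/forest_par (insubd_not_over no) /= (pieces_fix x root_not_over).
  rewrite insubd_not_over // => /over_dep; rewrite (dep_par rp) pieces_dep dm.
  by rewrite leqNgt prednK ?leqnn.
rewrite [in RHS]/forest_par (insubd_over o); case: x oxp => s [b pb [sb sf]] /= oxp.
have [w Yw wp] := o; have wp' : bel w (val p) by exact: below_trans wp (below_par _ _).
have e : par (s (val p)) = s (par (val p)).
  by rewrite (sb w) // (sb w (par (val p))) // (par_act ta).
rewrite insubd_over // e.
by apply: (@pieces_over (exist _ s (ex_intro2 _ _ b pb (conj sb sf)))).
Qed.

Lemma forest_faithful : faithful_action forest_act.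
Proof.
move=> x xp; apply: pieces_ext => u /=.
have [o|no] := pselect (over_Y u); last exact: pieces_fix.
by have [p <- _] := over_forest o; rewrite -val_forest_act xp.
Qed.

Lemma glue (c : V -> B) : permuting c -> exists x : Q, pieces_of c (sval x).
Proof.
move=> pc.
pose s u := if `[< over_Y u >] then act (c (anc par dep m u)) u else u.
have ps : pieces_of c s.
  split=> [w u Yw wu|u nu]; last by rewrite /s asboolF.
  rewrite /s asboolT; last by exists w.
  have du : (m <= dep u)%N by apply: over_dep; exists w.
  suff -> : anc par dep m u = w by [].
  by apply/(ancP rp) => //; split=> //; exact: Y_dep.
by exists (exist _ s (ex_intro2 _ _ c pc ps)).
Qed.

(** The pieces at w and w' are exchanged by b and its inverse, the others stay fixed. These elements
    provide transitivity on the levels of the forest and conjugate one piece onto another. *)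
Lemma swap_piece w w' b : Y w -> Y w' -> act b w = w' ->
  exists x : Q, forall u, bel w u -> sval x u = act b u.
Proof.
move=> Yw Yw' bw.
pose c v := if v == w then b else if v == w' then b^-1 else 1.
have cE v : act (c v) v = if v == w then w' else if v == w' then w else v.
  rewrite /c; case: eqP => [->//|_]; case: eqP => [->|_]; last exact: (act1 ta).
  by rewrite -bw (actK ta).
have [|x [xc _]] := @glue c.
  split=> [v Yv|v v' Yv Yv']; rewrite !cE.
    by case: eqP => // _; case: eqP.
  by do ![case: eqP => [->|]] => // *; congruence.
by exists x => u wu; rewrite (xc w) // /c eqxx.
Qed.

(** Let g act on all pieces at once. This makes sense for g in [level_stab dep act m], which fixes
    each vertex of Y; 1 is the default when no such piecewise map exists. *)
Definition iota g : Q := xget 1 [set x : Q | pieces_of (fun=> g) (sval x)].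

Lemma iotaP g : level_stab dep act m g -> pieces_of (fun=> g) (sval (iota g)).
Proof.
move=> Sg; have [|x xg] := @glue (fun=> g).
  have gY w : Y w -> act g w = w by move=> /Y_dep wm; apply: Sg; rewrite wm.
  by split=> [w Yw|w w' Yw Yw']; rewrite !gY.
exact: (xgetPex 1 (ex_intro (fun x : Q => pieces_of (fun=> g) (sval x)) x xg)).
Qed.

Lemma iota_over g u : level_stab dep act m g -> over_Y u ->
  sval (iota g) u = act g u.
Proof. by move=> /iotaP [gP _] [w Yw wu]; exact: (gP w). Qed.

Lemma iota_eq g x : level_stab dep act m g ->
  (forall u, over_Y u -> sval x u = act g u) -> x = iota g.
Proof.
move=> Sg xg; apply: pieces_ext => u.
have [o|no] := pselect (over_Y u); first by rewrite xg // iota_over.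
by rewrite !pieces_fix.
Qed.

Lemma iotaM g h : level_stab dep act m g -> level_stab dep act m h ->
  iota (g * h) = iota g * iota h.
Proof.
move=> Sg Sh; apply/esym/iota_eq => [|u ou].
  exact: (subgM (level_stab_subgroup ta m)).
rewrite (actM ta) -(iota_over Sh) // -(iota_over Sg) //; exact: pieces_over.
Qed.

Lemma iota1 : iota 1 = 1.
Proof.
apply/esym/iota_eq => [|u ou]; last by rewrite (act1 ta).
exact: subg1 (level_stab_subgroup ta m).
Qed.

Lemma iotaV g : level_stab dep act m g -> iota g^-1 = (iota g)^-1.
Proof.
move=> Sg; apply: (mulgI (iota g)); rewrite mulgV -iotaM ?mulgV ?iota1 //.
exact: (subgV (level_stab_subgroup ta m)).
Qed.

Lemma iotaR g h : level_stab dep act m g -> level_stab dep act m h ->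
  iota [~ g, h] = [~ iota g, iota h].
Proof.
have sS := level_stab_subgroup ta m => Sg Sh.
have SV k : level_stab dep act m k -> level_stab dep act m k^-1 by exact: subgV.
have SM k l : level_stab dep act m k -> level_stab dep act m l ->
  level_stab dep act m (k * l) by exact: subgM.
rewrite !commgEl !conjgE (iotaM (SV _ Sg) (SM _ _ (SV _ Sh) (SM _ _ Sg Sh))).
by rewrite (iotaM (SV _ Sh) (SM _ _ Sg Sh)) (iotaM Sg Sh) !iotaV.
Qed.

Lemma iota_inj g : level_stab dep act m g -> supp par dep act m Y g ->
  iota g = 1 -> g = 1.
Proof.
move=> Sg Yg g1; apply: (la_faithful ba) => u.
have [o|no] := pselect (over_Y u); first by rewrite -iota_over // g1.
case: (leqP (dep u) m) => [um|/ltnW mu]; first exact: Sg.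
have [Ya|nYa] := pselect (Y (anc par dep m u)).
  by case: no; exists (anc par dep m u) => //; exact: below_anc.
rewrite (Yg (anc par dep m u)) ?(act1 ta) //; last exact: below_anc.
by rewrite (dep_anc rp).
Qed.

Lemma iota_rist g p : p <> forest_root -> rist par act (val p) g ->
  rist forest_par forest_act p (iota g).
Proof.
move=> np pg q nq.
have Sg := rist_level_stab rp ta (over_dep (forest_over np)) pg.
apply: val_inj; rewrite val_forest_act; have [o|no] := pselect (over_Y (val q)).
  by rewrite iota_over // pg // => b; apply: nq; apply/below_forest.
exact: pieces_fix.
Qed.

End PiecesTree.

(** * The group of piecewise maps is a just infinite branch group *)

Section PiecesBranch.
Variable D : piece_data.
Local Notation B := (pd_B D).
Local Notation V := (pd_V D).
Local Notation par := (@pd_par D).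
Local Notation dep := (@pd_dep D).
Local Notation act := (@pd_act D).
Local Notation r := (pd_r D).
Local Notation bel := (below par).
Local Notation Y := (@pd_Y D).
Local Notation m := (pd_m D).
Local Notation Q := (pieces D).
Local Notation over_Y := (@over_Y D).
Local Notation St := (level_stab dep act).
Implicit Types (u v w : V) (x y : Q) (g h b : B).

Hypothesis m0 : (0 < m)%N.
Hypothesis cB : compact [set: B].
Hypothesis jiB : just_infinite B.
Hypothesis Y0 : exists w, Y w.

Let ba := pd_ba D.
Let rp := la_root ba.
Let ta := la_act ba.
Local Notation forest_par := (@forest_par D).
Local Notation forest_dep := (@forest_dep D).
Local Notation forest_act := (@forest_act D).
Local Notation forest_root := (@forest_root D).
Implicit Types (p q : forest D).

Let frp : rooted_parent forest_par forest_dep forest_root := forest_rooted m0.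
Let fta : tree_action forest_par forest_dep forest_act := forest_action m0.
Let ffa : faithful_action forest_act := forest_faithful m0.

Lemma forest_level_action : level_action forest_par forest_dep forest_root forest_act.
Proof.
split=> //.
- move=> p; rewrite openE => x xp; exists (dep (val p)) => // y yx.
  by apply: val_inj; rewrite (val_forest_act m0) yx // -(val_forest_act m0) xp.
- move=> n; have fV : finite_set (\bigcup_(i in `I_(n + m)) [set v | dep v = i]).
    by apply: bigcup_finite => // i _; exact: (la_level ba).
  apply: (sub_finite_set _ (finite_preimage (f := val) _ fV)).
    move=> p /= pn; exists (dep (val p)) => //=; move: pn; rewrite /forest_dep => <-.
    case: (leqP m.-1 (dep (val p))) => [h|h].
      by rewrite -{1}(subnK h) ltn_add2l prednK.
    by apply: leq_trans h _; rewrite (leq_trans (leq_pred _)) // leq_addl.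
  by move=> p q _ _; exact: val_inj.
- move=> p q pq.
  have root0 p' : forest_dep p' = forest_dep forest_root -> p' = forest_root.
    by move=> e; apply/eqP; rewrite -(dep_eq0 frp) e (dep_root frp).
  have [e|np] := pselect (p = forest_root).
    exists 1; rewrite (act1 fta) e; apply/esym/root0; by rewrite -pq e.
  have op := forest_over np.
  have oq : over_Y (val q).
    by apply: forest_over => e; apply: np; apply: root0; rewrite pq e.
  have dpq : dep (val p) = dep (val q).
    have h u : over_Y u -> (m.-1 <= dep u)%N.
      by move=> /over_dep; apply: leq_trans; exact: leq_pred.
    by rewrite -(subnK (h _ op)) -(subnK (h _ oq)); congr addn.
  (* An element b of B taking one vertex to the other also takes the piece root above the first to
     that above the second; a swap of these two pieces by b is piecewise. *)
  have [b bpq] := la_trans ba dpq; case: op oq => [w Yw wp] [w' Yw' wq].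
  have bw : act b w = w'.
    apply: (below_eq_dep rp _ wq); last by rewrite (dep_act ta) !(Y_dep Yw, Y_dep Yw').
    by rewrite -bpq; exact: (below_act ta).
  have [x xb] := swap_piece Yw Yw' bw; exists x.
  by apply: val_inj; rewrite (val_forest_act m0) xb.
Qed.

(** A piecewise map that is trivial to a large depth is given on each piece by an element of B
    trivial to that depth there, hence by an element of the rigid stabiliser of the piece root; the
    product of these is g. *)
Lemma iota_open l : exists n, forall x : Q,
  (forall u, (dep u <= n)%N -> sval x u = u) ->
  exists g, [/\ St l g, St m g, supp par dep act m Y g & x = iota g].
Proof.
have [s us sP] := finite_uniq_seq (sub_finite_set (@pd_Ym D) (la_level ba m)).
have [n nP] : exists n, forall w, w \in s -> forall g,
    (forall u, bel w u -> (dep u <= n)%N -> act g u = u) ->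
    exists h, [/\ rist par act w h, St (maxn l m) h & agree par act h g w].
  elim: {us sP}s => [|w s [n nP]]; first by exists 0%N.
  have [k kP] := agree_rist_near ba cB w (maxn l m); exists (maxn n k) => v.
  rewrite inE => /orP [/eqP -> |vs] g gf.
    by apply: kP => u wu uk; apply: gf => //; rewrite leq_max uk orbT.
  by apply: nP => // u wu uk; apply: gf => //; rewrite leq_max uk.
exists n => x xf; have [b pb [xb xF]] := svalP x.
have [|w ws|g [Sg gb gF]] := combine_rist rp ta (g := b) (m := m)
  (level_stab_subgroup ta (maxn l m)) us.
- by move=> w /sP /Y_dep.
- have [h [hw Sh hb]] : exists h, [/\ rist par act w h, St (maxn l m) h &
      agree par act h (b w) w].
    by apply: nP => // u wu un; rewrite -(xb w) ?xf //; exact/sP.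
  by exists h.
have Sm : St m g by exact: (level_stabS (leq_maxr _ _) Sg).
exists g; split=> //; first exact: (level_stabS (leq_maxl _ _) Sg).
  move=> v vm nYv u vu; rewrite (act1 ta); apply: gF => w /sP Yw wu.
  by apply: nYv; rewrite (below_eq_dep rp vu wu) // vm Y_dep.
apply: iota_eq => // u [w Yw wu]; by rewrite (xb w) // (gb w) //; exact/sP.
Qed.

(** The group is the continuous image of the set of permuting families b, which is closed in a power
    of B: the values [act (b w) w] depend on b in a locally constant way. *)
Lemma pieces_compact : compact [set: Q].
Proof.
pose T := prod_topology (fun _ : V => B).
pose A : set T := [set b | @permuting D b].
have cT : compact [set: T].
  have -> : [set: T] = [set f : T | forall v, [set: B] (f v)] by apply/seteqP; split.
  exact: (@tychonoff V (fun _ => B) (fun _ => setT) (fun _ => cB)).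
have projc v : continuous (fun b : T => b v) by exact: proj_continuous.
have cA : closed A.
  have -> : A = (\bigcap_(w in Y) [set b : T | Y (act (b w) w)]) `&`
      (\bigcap_(w in Y) \bigcap_(w' in Y)
        ~` (\bigcup_v [set b : T | [/\ w <> w', act (b w) w = v & act (b w') w' = v]])).
    apply/seteqP; split=> [b [bY binj]|b [bY bI]].
      split=> [w Yw|w Yw w' Yw' [v _ [nw <- e]]]; first exact: bY.
      by apply: nw; exact: binj.
    split=> [w Yw|w w' Yw Yw' e]; first exact: bY.
    apply: contrapT => nw; apply: (bI w Yw w' Yw').
    by exists (act (b w) w).
  apply: closedI; apply: closed_bigI => w Yw.
    have := closed_preim (projc w) (@closed_act _ _ _ _ _ _ ba w Y).
    exact.
  apply: closed_bigI => w' Yw'; apply: open_closedC; apply: bigcup_open => v _.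
  have [ww'|nw] := pselect (w = w').
    have -> : [set b : T | [/\ w <> w', act (b w) w = v & act (b w') w' = v]] = set0.
      by apply/seteqP; split=> b // [].
    exact: open0.
  have -> : [set b : T | [/\ w <> w', act (b w) w = v & act (b w') w' = v]] =
     [set b : T | [set v] (act (b w) w)] `&` [set b : T | [set v] (act (b w') w')].
    by apply/seteqP; split=> b; [move=> []|move=> [? ?]; split].
  apply: openI.
    exact: (open_preim (projc w) (@open_act _ _ _ _ _ _ ba w [set v])).
  exact: (open_preim (projc w') (@open_act _ _ _ _ _ _ ba w' [set v])).
have cpA : compact A by exact: (subclosed_compact cA cT).
pose f (b : T) : Q := xget 1 [set x : Q | pieces_of b (sval x)].
have fP (b : T) : A b -> pieces_of b (sval (f b)).
  move=> Ab; have [x xb] := glue Ab.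
  exact: (xgetPex 1 (ex_intro (fun x : Q => pieces_of b (sval x)) x xb)).
have -> : [set: Q] = f @` A.
  apply/seteqP; split=> // x _; have [b pb xb] := svalP x.
  exists b => //; apply: pieces_ext => u; have [fb fF] := fP b pb; case: xb => xb xF.
  have [[w Yw wu]|no] := pselect (over_Y u); first by rewrite (fb w) // (xb w).
  by rewrite fF // xF.
apply: continuous_compact => //; apply/subspace_continuousP => b Ab.
move=> N [n _ nN]; rewrite /nbhs /=.
have oU : open (\bigcap_(w in Y) [set b' : T | St n ((b w)^-1 * b' w)]).
  apply: open_finite_bigcap.
    exact: sub_finite_set (@pd_Ym D) (la_level ba m).
  move=> w _.
  exact: (open_preim (projc w) (open_coset (b w) (open_level_stab ba n))).
apply: filterS (open_nbhs_nbhs (conj oU _)) => [b' b'U Ab'|w Yw].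
  apply: nN => u un; have [fb fF] := fP b Ab; have [fb' fF'] := fP b' Ab'.
  have [[w Yw wu]|no] := pselect (over_Y u); last by rewrite fF // fF'.
  rewrite (fb w) // (fb' w) // -[b' w](mulVKg (b w)) (actM ta).
  by rewrite (b'U w Yw).
by rewrite /= mulVg; exact: subg1 (level_stab_subgroup ta n).
Qed.

Lemma iota_conj (x : Q) b w g : Y w -> rist par act w g ->
  (forall u, bel w u -> sval x u = act b u) -> Y (act b w) ->
  iota g ^ x^-1 = iota (g ^ b^-1).
Proof.
move=> Yw gw xb Ybw.
have Sg : St m g by apply: (rist_level_stab rp ta _ gw); rewrite Y_dep.
apply: iota_eq; first exact: (level_stab_normal ta).
have xK v : sval x (sval x^-1 v) = v.
  by rewrite -[LHS]/(sval (x * x^-1) v) mulgV.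
move=> u ou; rewrite conjgE invgK /=.
have gw' : rist par act (act b w) (g ^ b^-1).
  by have := ristJ ta (g := b^-1) gw; rewrite invgK.
have [bu|nbu] := pselect (bel (act b w) u).
  have wv : bel w (act b^-1 u).
    by rewrite -(below_actE ta b) (actKV ta).
  have -> : piece_inv (sval x) u = act b^-1 u.
    apply: (piecewise_inj (svalP x)); rewrite (xK u) xb ?(actKV ta) //.
  rewrite iota_over //; last by exists w.
  rewrite (actJ ta) invgK xb //; apply/(below_fixed ta) => //.
  exact: (rist_fix rp ta gw).
rewrite gw' //; set v := piece_inv _ _.
have xv : sval x v = u by exact: (xK u).
have ov : over_Y v.
  by apply: contrapT => no; move: ou; rewrite -xv (pieces_fix x no).
rewrite iota_over // gw // => wv; apply: nbu.
by rewrite -xv xb //; exact: (below_act ta).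
Qed.

Lemma pieces_infinite : infinite_set [set: Q].
Proof.
move=> fQ; have [s us sP] := finite_uniq_seq fQ.
have [n nP] : exists n, forall x, x \in s -> x <> 1 ->
    exists2 u, (dep u <= n)%N & sval x u <> u.
  elim: {us sP}s => [|x s [n nP]]; first by exists 0%N.
  have [x1|x1] := pselect (x = 1).
    by exists n => y; rewrite inE => /orP [/eqP ->|/nP].
  have [u xu] : exists u, sval x u <> u.
    apply: contrapT => nex; apply: x1; apply: pieces_ext => u.
    by apply: contrapT => xu; apply: nex; exists u.
  exists (maxn n (dep u)) => y; rewrite inE => /orP [/eqP -> _|ys y1].
    by exists u => //; exact: leq_maxr.
  have [v vn yv] := nP y ys y1; exists v => //.
  by rewrite leq_max vn.
have [w Yw] := Y0.
have [u wu du] : exists2 u, bel w u & dep u = (maxn n.+1 m).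
  by apply: (deep_below ba cB jiB); rewrite Y_dep // leq_maxr.
have [g gu g1] := rist_neq1 ba cB jiB u.
have ou : over_Y u by exists w.
have Sg k : (k <= dep u)%N -> St k g by move=> ku; exact: (rist_level_stab rp ta ku gu).
have Smg : St m g by apply: Sg; rewrite du leq_maxr.
have [p pu np] := over_forest m0 ou.
have [||v vn] := nP (iota g) _ _.
- exact/sP.
- move=> i1; apply: g1; apply: iota_inj Smg _ i1 => // v vm nYv t vt.
  rewrite (act1 ta); apply: gu => ut; apply: nYv.
  by rewrite (below_eq_dep rp vt (below_trans wu ut)) // vm Y_dep.
have [ov|no] := pselect (over_Y v); last by rewrite pieces_fix.
rewrite iota_over // => h; apply: h; apply: (Sg n) => //.
by rewrite du leq_max leqnSn.
Qed.

(** Let N be normal and move a vertex p over [w0]. The group M of elements of the rigid stabiliser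
    of [w0] whose image under [iota] is in N contains the commutators of that of p, so it is
    nontrivial. It is normalised by the stabiliser of [w0] in B, because piecewise maps realise this
    action on one piece. Just infiniteness of B makes M locally the whole rigid stabiliser, and
    swaps carry this to all of Y. *)
Lemma pieces_just_infinite : just_infinite Q.
Proof.
split; first exact: pieces_infinite.
move=> N /(normal_inP _ is_subgroupT) [sN _ nN] cN N1.
apply: compact_finite_index; [exact: pieces_compact|by []|].
have [x Nx x1] : exists2 x, N x & x <> 1.
  apply: contrapT => nex; apply: N1; apply/seteqP; split=> [x Nx|_ ->].
    by apply: contrapT => x1; apply: nex; exists x.
  exact: subg1.
have [p xp] : exists p, forest_act x p <> p.
  apply: contrapT => nex; apply: x1; apply: ffa => p.
  by apply: contrapT => xp; apply: nex; exists p.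
have np : p <> forest_root by move=> e; apply: xp; rewrite e forest_act_root.
have [w0 Yw0 wp] := forest_over np.
have wm : dep w0 = m by exact: Y_dep.
pose M := [set g | rist par act w0 g /\ N (iota g)].
have RM g w : Y w -> rist par act w g -> St m g.
  by move=> Yw; apply: (rist_level_stab rp ta); rewrite Y_dep.
have sM : is_subgroup M.
  have sR := rist_subgroup ta w0; split.
  - by split; [exact: (subg1 sR)|rewrite iota1; exact: (subg1 sN)].
  - move=> g h [gw Ng] [hw Nh]; split; first exact: (subgM sR).
    by rewrite (iotaM (RM _ _ Yw0 gw) (RM _ _ Yw0 hw)); exact: (subgM sN).
  - move=> g [gw Ng]; split; first exact: (subgV sR).
    by rewrite (iotaV (RM _ _ Yw0 gw)); exact: (subgV sN).
have cM : closed M.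
  move=> g clg; have gw : rist par act w0 g.
    apply: (closed_rist ba) => U /clg [h [[hw _] Uh]].
    by exists h.
  split=> //; apply: cN => U [n _ nU].
  have [|h [[hw Nh] Sh]] := clg [set h | St n (g^-1 * h)].
    apply: open_nbhs_nbhs; split; first exact: (open_coset g (open_level_stab ba n)).
    by rewrite /= mulVg; exact: subg1 (level_stab_subgroup ta n).
  exists (iota h); split=> //; apply: nU => u un.
  have [ou|no] := pselect (over_Y u); last by rewrite !pieces_fix.
  rewrite (iota_over (RM _ _ Yw0 hw)) // (iota_over (RM _ _ Yw0 gw)) // -[h](mulVKg g) (actM ta) Sh //.
have nM : normalised [set h | act h w0 = w0] M.
  move=> h g hw [gw Ng].
  have [y yh] := swap_piece Yw0 Yw0 (fix_inv ta hw).
  have := iota_conj Yw0 gw yh; rewrite (fix_inv ta hw) invgK => /(_ Yw0) e.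
  split; first by have := ristJ ta (g := h) gw; rewrite (fix_inv ta hw).
  by rewrite -e; exact: nN.
have M1 : M <> [set 1].
  have [g [h [gp hp ngh]]] := rist_nonabelian ba cB jiB (val p).
  move=> M1; apply: ngh; apply/commgP/eqP.
  suff : M [~ g, h] by rewrite M1.
  have sR := rist_subgroup ta w0.
  have gw : rist par act w0 g by exact: (ristS wp gp).
  have hw : rist par act w0 h by exact: (ristS wp hp).
  have ghw : rist par act w0 [~ g, h].
    by rewrite commgEl; apply: (subgM sR); [apply: (subgV sR)|apply: (subgJ sR)].
  split=> //.
  have -> : iota [~ g, h] = [~ iota g, iota h].
    exact: (iotaR (RM _ _ Yw0 gw) (RM _ _ Yw0 hw)).
  apply: (moved_commutator frp fta ffa sN _ Nx xp).
  - by move=> v t _; exact: nN.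
  - exact: (iota_rist m0).
  - exact: (iota_rist m0).
have [l lP] := rist_subgroup_open ba cB jiB sM cM (fun g => @proj1 _ _) nM M1.
have [n nP] := iota_open (maxn l m).
apply: (open_subg sN (U := pieces_ball 1 n)).
- rewrite openE => y yn; exists n => // z zy u un.
  by rewrite zy // yn.
- by [].
move=> y /nP [g [Sg _ _ ->]].
have [s us sP] := finite_uniq_seq (sub_finite_set (@pd_Ym D) (la_level ba m)).
pose K := [set h | St m h /\ N (iota h)].
have sS := level_stab_subgroup ta m.
have sK : is_subgroup K.
  split.
  - by split; [exact: (subg1 sS)|rewrite iota1; exact: (subg1 sN)].
  - move=> h k [Sh Nh] [Sk Nk]; split; first exact: (subgM sS).
    rewrite iotaM //; exact: (subgM sN).
  - move=> h [Sh Nh]; split; first exact: (subgV sS).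
    rewrite iotaV //; exact: (subgV sN).
have [|w ws|h [[Sh Nh] hg _]] := combine_rist rp ta (g := fun=> g) (m := m) sK us.
- by move=> w /sP /Y_dep.
- have /sP Yw := ws.
  have [b bw] : exists b, act b w0 = w by apply: (la_trans ba); rewrite !Y_dep.
  have [h [hw Nh] hg] := lP (g ^ b) (level_stab_normal ta I (level_stabS (leq_maxl _ _) Sg)).
  have [t tb] := swap_piece Yw0 Yw bw.
  have e := iota_conj Yw0 hw tb; rewrite bw in e.
  have hw' : rist par act w (h ^ b^-1).
    by have := ristJ ta (g := b^-1) hw; rewrite invgK bw.
  exists (h ^ b^-1); split=> //.
    by split; [exact: RM hw'|rewrite -e //; exact: nN].
  rewrite -[g](conjgK b); apply: (agreeJ ta).
  by rewrite -bw (actK ta).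
suff -> : iota g = iota h by [].
have Smg := level_stabS (leq_maxr l m) Sg.
apply: iota_eq => // u ou; rewrite iota_over //.
by case: ou => w /sP ws wu; rewrite (hg w ws).
Qed.

Lemma pieces_branch_action : branch_action forest_par forest_dep forest_root forest_act.
Proof.
split; first exact: forest_level_action.
move=> n; have [->|n0] := posnP n.
  exists 0%N => x _ p /eqP; rewrite (dep_eq0 frp) => /eqP ->; exists x => //.
  by move=> q nq; case: nq; exact: (below_root frp).
(* Depth n of the forest is depth [n + m.-1] of the original tree. *)
have [l0 r0] := ba_rist ba (n + m.-1)%N; have [k kP] := iota_open l0.
exists k => x xk p pn.
have np : p <> forest_root by move=> e; move: n0; rewrite -pn e (dep_root frp).
have op := forest_over np.
have dp : dep (val p) = (n + m.-1)%N.
  by rewrite -pn /forest_dep subnK // (leq_trans (leq_pred _)) // over_dep.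
have [|g [Sg Smg _ ->]] := kP x.
  move=> u uk; have [ou|no] := pselect (over_Y u); last exact: pieces_fix.
  have [q qu _] := over_forest m0 ou.
  rewrite -qu -(val_forest_act m0) xk // /forest_dep qu.
  exact: leq_trans (leq_subr _ _) uk.
have [h hp hg] := r0 g Sg _ dp; exists (iota h); first exact: (iota_rist m0).
move=> q pq; apply: val_inj; rewrite !(val_forest_act m0).
have bpq : bel (val p) (val q) by apply/(below_forest m0).
have oq : over_Y (val q) by exact: over_below op bpq.
have Smh : St m h by apply: (rist_level_stab rp ta _ hp); exact: over_dep.
by rewrite !iota_over // hg.
Qed.

End PiecesBranch.

Lemma pieces_group (B : topGroupType) (V : choiceType) (par : V -> V)
    (dep : V -> nat) (r : V) (act : B -> V -> V) (m : nat) (Y : set V) :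
  branch_action par dep r act -> compact [set: B] -> just_infinite B ->
  (0 < m)%N -> Y `<=` [set w | dep w = m] -> (exists w, Y w) ->
  exists (Q : topGroupType) (iota : B -> Q),
  [/\ profinite Q /\ just_infinite Q /\ branch_group Q,
      forall g h, level_stab dep act m g -> level_stab dep act m h ->
        iota (g * h) = iota g * iota h,
      forall g, level_stab dep act m g -> supp par dep act m Y g ->
        iota g = 1 -> g = 1,
      forall U, open U -> U 1 -> exists n, forall g, level_stab dep act m g ->
        level_stab dep act n g -> U (iota g) &
      forall l, exists U, [/\ open U, U 1 & forall x, U x -> exists g,
        [/\ level_stab dep act l g, level_stab dep act m g,
            supp par dep act m Y g & x = iota g]]].
Proof.
move=> ba cB jiB m0 Ym Y0; pose D := PieceData ba Ym.
have la := @forest_level_action D m0.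
have cQ := @pieces_compact D cB.
exists (pieces D), (@iota D); split.
- split; last split.
  + split=> //; first exact: level_action_hausdorff la.
    exact/zero_dimension_totally_disconnected/(level_action_zero_dim la).
  + exact: (@pieces_just_infinite D m0 cB jiB Y0).
  + exact: (branch_action_group (@pieces_branch_action D m0 cB) cQ).
- exact: (@iotaM D).
- exact: (@iota_inj D).
- move=> U oU U1; have [n _ nU] := open_nbhs_nbhs (conj oU U1).
  exists n => g Sm Sn; apply: nU => u un.
  have [ou|no] := pselect (over_Y (D := D) u); last exact: pieces_fix.
  by rewrite iota_over //= Sn.
move=> l; have [n nP] := @iota_open D cB l.
exists (pieces_ball 1 n); split=> //.
rewrite openE => y yn; exists n => // z zy u un.
by rewrite zy // yn.
Qed.

Lemma finite_subsets (T : choiceType) (A : set T) : finite_set A ->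
  finite_set [set Y | Y `<=` A].
Proof.
move=> fA; apply: (@sub_finite_set _ _
  ((fun X : {fset T} => [set` X]) @` [set` fpowerset (fset_set A)])).
  move=> Y /= YA; have fY := sub_finite_set YA fA.
  exists (fset_set Y); last exact: fset_setK.
  rewrite /= fpowersetE; apply/fsubsetP => x.
  by rewrite !in_fset_set // => /set_mem /YA /mem_set.
by apply: finite_image; exact: finite_fset.
Qed.

(** * The local structure of the group *)

(** This is all that the study of G retains of the branch group: a base W at 1 for which the closed
    subgroups normalised by [W k] are locally complemented, have finitely many germs when contained
    in [W k], and are locally isomorphic to a just infinite branch group unless discrete. *)
Record local_structure (G : topGroupType) (W : nat -> set G) : Prop := {
  ls_base : nbhs1_base W;
  ls_subgroup : forall n, is_subgroup (W n);
  ls_normal : forall n, normalised (W 0%N) (W n);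
  ls_complement : forall k K, is_subgroup K -> closed K -> K `<=` W k ->
    normalised (W k) K ->
    exists l, forall z, W l z -> exists2 a, K a & cent K (a^-1 * z);
  ls_finite : forall k, exists2 F : set (set G), finite_set F &
    forall K, is_subgroup K -> closed K -> K `<=` W k -> normalised (W k) K ->
    exists2 A, F A & exists l, K `&` W l = A `&` W l;
  ls_branch : forall k K, is_subgroup K -> closed K -> normalised (W k) K ->
    (forall l, ~ K `&` W l `<=` [set 1]) -> loc_just_infinite_branch K }.

(** * Pulling the level stabilisers back to G *)

Section Transport.
Context {G B : topGroupType} {V : choiceType}.
Variables (par : V -> V) (dep : V -> nat) (r : V) (act : B -> V -> V).
Variables (U : set G) (f : G -> B) (n0 : nat).
Local Notation St := (level_stab dep act).
Hypothesis ba : branch_action par dep r act.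
Hypothesis cB : compact [set: B].
Hypothesis jiB : just_infinite B.
Hypothesis sU : is_subgroup U.
Hypothesis oU : open U.
Hypothesis fM : forall x y, U x -> U y -> f (x * y) = f x * f y.
Hypothesis finj : set_inj U f.
Hypothesis fcont : {within U, continuous f}.
Hypothesis fopen : forall A, open A -> open (f @` (U `&` A)).
Hypothesis Sn0 : St n0 `<=` f @` U.

Let rp := la_root ba.
Let ta := la_act ba.
Let sS := level_stab_subgroup ta.

Let f_inj x y : U x -> U y -> f x = f y -> x = y.
Proof. by move=> Ux Uy; apply: finj; exact: mem_set. Qed.

Let f1 : f 1 = 1.
Proof.
have U1 := subg1 sU; apply: (mulgI (f 1)).
by rewrite -fM // !mulg1.
Qed.

Let fV x : U x -> f x^-1 = (f x)^-1.
Proof.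
move=> Ux; apply: (mulgI (f x)); rewrite -fM //; last exact: subgV.
by rewrite !mulgV f1.
Qed.

Let fJ x y : U x -> U y -> f (x ^ y) = f x ^ f y.
Proof.
move=> Ux Uy; have UV := subgV sU Uy; have Uxy := subgM sU Ux Uy.
by rewrite !conjgE (fM UV Uxy) (fM Ux Uy) fV.
Qed.

Let f_preim O : open O -> open [set x | U x /\ O (f x)].
Proof.
move=> oO; rewrite openE => x [Ux Ofx].
move/subspace_continuousP: fcont => /(_ x Ux) cx.
have NO : nbhs x [set y | U y -> O (f y)] := cx O (open_nbhs_nbhs (conj oO Ofx)).
have NU : nbhs x U := open_nbhs_nbhs (conj oU Ux).
apply: filterS (filterI NO NU) => y [yO Uy]; split=> //; exact: yO.
Qed.

(** The shift by [n0] places the level stabilisers inside the image of U, so that f maps [W k]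
    bijectively onto [St (n0 + k)]. *)
Definition pull_level k : set G := [set x | U x /\ St (n0 + k) (f x)].
Local Notation W := pull_level.

Lemma pull_level_subgroup k : is_subgroup (W k).
Proof.
split=> [|x y [Ux Sx] [Uy Sy]|x [Ux Sx]].
- by split; [exact: (subg1 sU)|rewrite f1; exact: (subg1 (sS _))].
- by split; [exact: (subgM sU)|rewrite fM //; exact: (subgM (sS _))].
- by split; [exact: (subgV sU)|rewrite fV //; exact: (subgV (sS _))].
Qed.

Lemma pull_levelS k l : (k <= l)%N -> W l `<=` W k.
Proof.
by move=> kl x [Ux Sx]; split=> //; apply: level_stabS Sx; rewrite leq_add2l.
Qed.

Lemma pull_level_stab k x : W k x -> St k (f x).
Proof. by move=> [_]; apply: level_stabS; exact: leq_addl. Qed.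

Lemma pull_level_surj k y : St (n0 + k) y -> exists2 x, W k x & f x = y.
Proof.
move=> Sy; have [x Ux xy] := Sn0 (level_stabS (leq_addr _ _) Sy).
by exists x => //; split=> //; rewrite xy.
Qed.

Lemma pull_level_base : nbhs1_base W.
Proof.
split=> [k|k l|O oO O1].
- split; last exact: (subg1 (pull_level_subgroup k)).
  exact: (f_preim (open_level_stab ba _)).
- exact: pull_levelS.
have [_ _ bS] := level_stab_base ba cB.
have [|n Sn] := bS _ (fopen oO).
  by exists 1 => //; split=> //; exact: (subg1 sU).
exists n => x [Ux Sx]; have [|y [Uy Oy] yx] := Sn (f x).
  exact: (level_stabS (leq_addl _ _) Sx).
by rewrite (f_inj Ux Uy).
Qed.

Lemma pull_level_normal n : normalised (W 0%N) (W n).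
Proof.
move=> v x [Uv _] [Ux Sx]; split; first exact: (subgJ sU).
by rewrite fJ //; exact: (level_stab_normal ta).
Qed.

Lemma image_closed_subgroup k K : is_subgroup K -> closed K -> K `<=` W k ->
  normalised (W k) K ->
  [/\ is_subgroup (f @` K), closed (f @` K) & normalised (St (n0 + k)) (f @` K)].
Proof.
move=> sK cK KW nK; have KU x : K x -> U x by move/KW => [].
split.
- split.
  + by exists 1 => //; exact: subg1.
  + move=> _ _ [x Kx <-] [y Ky <-]; exists (x * y); first exact: subgM.
    by rewrite fM //; exact: KU.
  + move=> _ [x Kx <-]; exists x^-1; first exact: subgV.
    by rewrite fV //; exact: KU.
(* The local isomorphism is known to be open, so closedness is read off the complement: inside the
   level stabiliser it is the image of an open set. *)
- have -> : f @` K = St (n0 + k) `&` ~` (f @` (U `&` (W k `&` ~` K))).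
    apply/seteqP; split=> [_ [x Kx <-]|y [Sy ny]].
      split; first by case: (KW x Kx).
      move=> [z [Uz [_ nKz]] zx]; apply: nKz.
      by rewrite (f_inj Uz (KU x Kx) zx).
    have [x Wx xy] := pull_level_surj Sy; exists x => //.
    apply: contrapT => nKx; apply: ny; exists x => //; split=> //.
    by case: Wx.
  apply: closedI; first by apply: closed_open_subg => //; exact: (open_level_stab ba).
  apply: open_closedC; apply: fopen; apply: openI; last exact: closed_openC.
  by have [/(_ k) []] := pull_level_base.
- move=> y _ Sy [x Kx <-]; have [v Wv <-] := pull_level_surj Sy.
  exists (x ^ v); first exact: nK.
  by rewrite fJ //; [exact: KU|case: Wv].
Qed.

(** Near 1 the image of K is [supp m Y], and [iota] identifies a small part of the latter with a
    neighbourhood of 1 in the group of piecewise maps; the local isomorphism is [iota \o f]. *)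
Lemma pull_level_branch k K : is_subgroup K -> closed K -> normalised (W k) K ->
  profinite B -> (forall l, ~ K `&` W l `<=` [set 1]) ->
  loc_just_infinite_branch K.
Proof.
move=> sK cK nK _ K1.
have sW := pull_level_subgroup; have [oW dW bW] := pull_level_base.
have [||||sL cL nL] := @image_closed_subgroup k (K `&` W k).
- exact: is_subgroupI.
- apply: closedI => //; apply: closed_open_subg => //; by case: (oW k).
- by move=> x [].
- by apply: normalisedI => //; exact: normalised_self.
have [m [m0 _ /(_ _ sL cL nL)]] := locally_supp ba cB jiB (n0 + k).
move=> [Y [l [Ym ml LY YL]]].
(* With Y empty a small element of K would act trivially on the tree, and K would be discrete. *)
have Y0 : exists w, Y w.
  apply: contrapT => nY; apply: (K1 (maxn k l)) => x [Kx Wx].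
  have Wkx := dW _ _ (leq_maxl k l) _ Wx.
  have Wlx := dW _ _ (leq_maxr k l) _ Wx.
  have Ux : U x by case: Wx.
  apply: f_inj => //; first exact: subg1.
  rewrite f1; apply: (la_faithful ba) => u.
  case: (leqP (dep u) m) => [um|/ltnW mu].
    by apply: (pull_level_stab Wlx); exact: leq_trans ml.
  rewrite (LY (f x) _ (anc par dep m u)) ?(act1 ta) //.
  - by exists x.
  - by rewrite (dep_anc rp).
  - by move=> Ya; apply: nY; exists (anc par dep m u).
  - exact: below_anc.
have [Q [iota [pQ iM i1 icont iopen]]] := pieces_group ba cB jiB m0 Ym Y0.
(* The domain A of the isomorphism is so small that its image lies in both [St m] and [supp m Y],
   where [iota] is multiplicative and injective. *)
exists Q; case: pQ => ? [? ?]; split=> //.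
pose A := K `&` W (maxn k l).
have sA : is_subgroup A by exact: is_subgroupI.
have AU x : A x -> U x by move=> [_ []].
have AS x : A x -> St m (f x).
  move=> [_ /(dW _ _ (leq_maxr k l)) /pull_level_stab]; exact: level_stabS.
have AY x : A x -> supp par dep act m Y (f x).
  by move=> [Kx /(dW _ _ (leq_maxl k l)) Wx]; apply: LY; exists x.
have gM x y : A x -> A y -> iota (f (x * y)) = iota (f x) * iota (f y).
  by move=> Ax Ay; rewrite fM ?iM //; [exact: AS|exact: AS|exact: AU|exact: AU].
exists A, (iota \o f); split.
- by split=> //; exists (W (maxn k l)) => //; case: (oW (maxn k l)).
- by split=> // x y; exact: gM.
- move=> x y /set_mem Ax /set_mem Ay /= e.
  have Axy : A (x^-1 * y) by apply: subgM => //; exact: subgV.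
  have e1 : f (x^-1 * y) = 1.
    apply: i1; [exact: AS|exact: AY|].
    by apply: (mulgI (iota (f x))); rewrite -gM // mulVKg mulg1.
  have : x^-1 * y = 1.
    by apply: f_inj; [exact: AU|exact: subg1|rewrite f1].
  by move=> e2; rewrite -(mulVKg x y) e2 mulg1.
- apply/subspace_continuousP => x Ax N; rewrite nbhsE => -[O [oO Ox] ON].
  have [|n nO] := icont [set q | O (iota (f x) * q)] (open_preim (@continuous_mull _ _) oO).
    by rewrite /= mulg1.
  apply: filterS (open_nbhs_nbhs (conj (open_coset x (proj1 (oW n))) _)).
    move=> y Wy Ay; apply: ON => /=; rewrite -(mulVKg x y).
    have Axy : A (x^-1 * y) by apply: subgM => //; exact: subgV.
    rewrite /from_subspace /= gM //; apply: nO; first exact: AS.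
    exact: (pull_level_stab Wy).
  by rewrite /= mulVg; case: (oW n).
- move=> _ [O oO ->]; exists ((iota \o f) @` (A `&` O)); last by rewrite setTI.
  rewrite openE => _ [x [Ax Ox] <-].
  have [|n nO] := bW [set z | O (x * z)] (open_preim (@continuous_mull _ _) oO).
    by rewrite /= mulg1.
  have [P [oP P1 PE]] := iopen (n0 + maxn n (maxn k l))%N.
  rewrite /interior /= nbhsE; exists [set q | P ((iota (f x))^-1 * q)].
    by split; [exact: open_coset|rewrite /= mulVg].
  move=> q /PE [g [Sg Smg Yg eg]].
  have [|y [Ky Wky] yg] := YL g.
    split=> //; apply: level_stabS Sg.
    by apply: leq_trans (leq_addl _ _); rewrite !leq_max leqnn !orbT.
  have Wy : W (maxn n (maxn k l)) y by split; [case: Wky|rewrite yg].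
  have Ay : A y by split=> //; exact: dW (leq_maxr _ _) _ Wy.
  exists (x * y).
    split; first exact: subgM.
    by apply: nO; exact: dW (leq_maxl _ _) _ Wy.
  by rewrite /= gM // yg -eg mulVKg.
Qed.

Lemma pull_level_structure : profinite B -> local_structure W.
Proof.
move=> pB; have sW := pull_level_subgroup; have [oW dW bW] := pull_level_base.
split.
- exact: pull_level_base.
- exact: pull_level_subgroup.
- exact: pull_level_normal.
- move=> k K sK cK KW nK; have [sL cL nL] := image_closed_subgroup sK cK KW nK.
  have [l lP] := locally_complemented ba cB jiB sL cL nL.
  have KU x : K x -> U x by move/KW => [].
  exists l => z Wz; have [_ [a Ka <-] az] := lP _ (pull_level_stab Wz).
  have Uz : U z by case: Wz.
  have Uaz : U (a^-1 * z) by apply: subgM => //; apply: subgV => //; exact: KU.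
  exists a => // x Kx; have Ux := KU x Kx.
  have UaV := subgV sU (KU a Ka).
  apply: f_inj; [exact: (subgM sU Uaz Ux)|exact: (subgM sU Ux Uaz)|].
  rewrite (fM Uaz Ux) (fM Ux Uaz) (fM UaV Uz) (fV (KU a Ka)).
  by apply: az; exists x.
- move=> k; have [m [m0 _ LP]] := locally_supp ba cB jiB (n0 + k).
  exists ((fun Y => [set x | U x /\ supp par dep act m Y (f x)]) @`
    [set Y | Y `<=` [set w | dep w = m]]).
    exact/finite_image/finite_subsets/(la_level ba).
  move=> K sK cK KW nK; have [sL cL nL] := image_closed_subgroup sK cK KW nK.
  have [Y [l [Ym ml LY YL]]] := LP _ sL cL nL.
  exists [set x | U x /\ supp par dep act m Y (f x)]; first by exists Y.
  exists l; apply/seteqP; split=> [x [Kx Wx]|x [[Ux Yx] Wx]]; split=> //.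
    by split; [case: Wx|apply: LY; exists x].
  have [|y Ky yx] := YL (f x); first by split=> //; exact: pull_level_stab.
  by rewrite (f_inj Ux _ (esym yx)) //; case: (KW y Ky).
- by move=> k K sK cK nK; exact: (pull_level_branch sK cK nK pB).
Qed.

End Transport.

Lemma local_structure_exists (G : topGroupType) :
  loc_just_infinite_branch [set: G] -> exists W, @local_structure G W.
Proof.
move=> [B [pB jiB bB [U [f [[sU [O oO UE]] [_ fM] finj fcont fopen]]]]].
have cB : compact [set: B] by case: pB.
have oU : open U by rewrite UE setTI.
have [V [par [dep [r [act ba]]]]] := branch_group_action cB bB.
have fo A : open A -> open (f @` (U `&` A)).
  move=> oA; have [|C oC ->] := fopen (U `&` A); first by exists A.
  by rewrite setTI.
have [_ _ bS] := level_stab_base ba cB.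
have [|n0 Sn0] := bS _ (fo _ openT).
  exists 1; first by split=> //; exact: subg1.
  have U1 := subg1 sU; apply: (mulgI (f 1)).
  by rewrite -fM // !mulg1.
rewrite setIT in Sn0.
exists (pull_level dep act U f n0).
exact: (pull_level_structure ba cB jiB sU oU fM finj fcont fo Sn0 pB).
Qed.

(** * Centralisers of locally normal subgroups *)

Section LocallyNormalTheory.
Context {G : topGroupType}.
Variable W : nat -> set G.
Implicit Types (K L X Y S : set G) (x y z g h : G).
Hypothesis ls : local_structure W.
Hypothesis hG : hausdorff_space G.
Hypothesis qzG : QZ [set: G] = [set 1].

Let sW := ls_subgroup ls.
Let oW n : open (W n). Proof. by case: (ls_base ls) => /(_ n) []. Qed.
Let dW m n : (m <= n)%N -> W n `<=` W m.
Proof. by case: (ls_base ls) => _ d _; exact: d. Qed.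
Let bW U : open U -> U 1 -> exists n, W n `<=` U.
Proof. by case: (ls_base ls) => _ _ b; exact: b. Qed.

Lemma commute_near_eq1 g n : (forall y, W n y -> commute g y) -> g = 1.
Proof.
move=> gn; suff : QZ [set: G] g by rewrite qzG.
split=> //; exists (cent [set g]).
  apply: (open_subgS (is_subgroup_cent _) (oW n) (sW n)) => y /gn gy _ ->.
  exact: commute_sym.
rewrite setTI; apply/seteqP; split=> y; first by move=> [_ gy] _ ->; exact: commute_sym.
by move=> /(_ g erefl) /commute_sym.
Qed.

Lemma near1 (f : G -> G) n : continuous f -> f 1 = 1 ->
  exists i, forall y, W i y -> W n (f y).
Proof.
move=> cf f1; have [|i fi] := bW (open_preim cf (oW n)); last by exists i.
by rewrite /= f1; exact: (subg1 (sW n)).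
Qed.

Lemma closed_cent S : closed (cent S).
Proof.
have -> : cent S = \bigcap_(x in S) [set g | [set 1] [~ x, g]].
  apply/seteqP; split=> g Cg x Sx; have := Cg x Sx.
    by move=> /commute_sym /commgP /eqP.
  by move=> /= /eqP /commgP /commute_sym.
apply: closed_bigI => x _; apply: (closed_preim (@continuous_commg _ x)).
exact: (accessible_closed_set1 (hausdorff_accessible hG)).
Qed.

(** The closed locally normal subgroups of G, openness of the normaliser being tested on the base
    W. *)
Definition lnc K := [/\ is_subgroup K, closed K & exists n, normalised (W n) K].

Lemma lncI K L : lnc K -> lnc L -> lnc (K `&` L).
Proof.
move=> [sK cK [i iK]] [sL cL [j jL]]; split.
- exact: is_subgroupI.
- exact: closedI.
exists (maxn i j); apply: normalisedI.
  exact: (normalisedS (dW (leq_maxl _ _)) iK).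
exact: (normalisedS (dW (leq_maxr _ _)) jL).
Qed.

Lemma lnc_cent K : lnc K -> lnc (cent K).
Proof.
move=> [_ _ [n nK]]; split; [exact: is_subgroup_cent|exact: closed_cent|].
by exists n; exact: normalised_cent.
Qed.

Lemma lnc_conj K g : lnc K -> lnc (conj_set K g).
Proof.
move=> [sK cK [n nK]]; split.
- exact: is_subgroup_conj_set.
- exact: closed_conj_set.
have [i iP] := near1 n (@continuous_conjl _ g^-1) (conj1g _).
exists i => v _ Wv [k Kk <-]; exists (k ^ (v ^ g^-1)).
  by apply: nK => //; exact: iP.
by rewrite -!conjgM; congr (_ ^ _); rewrite conjgE invgK !mulgA mulgVK.
Qed.

(* For z in S and y near 1, the commutator [z, y] lies in S and is near 1, so
   that z is quasi-central. *)
Lemma discrete_eq1 S i j : is_subgroup S -> normalised (W j) S ->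
  S `&` W i `<=` [set 1] -> S `<=` [set 1].
Proof.
move=> sS nS S1 z Sz.
have [k kP] := near1 i (@continuous_commg _ z) (commg1 z).
apply: (@commute_near_eq1 _ (maxn j k)) => y Wy.
have Wj := dW (leq_maxl j k) Wy; have Wk := dW (leq_maxr j k) Wy.
apply/commgP/eqP/S1; split; last exact: kP.
by rewrite commgEl; apply: (subgM sS (subgV sS Sz)); exact: nS.
Qed.

(** A central element of K commutes with K and with C(K), hence with the neighbourhood of 1
    contained in K C(K). *)
Lemma level_center K k : is_subgroup K -> closed K -> K `<=` W k ->
  normalised (W k) K -> K `&` cent K `<=` [set 1].
Proof.
move=> sK cK KW nK z [Kz Cz]; have [l lP] := ls_complement ls sK cK KW nK.
apply: (@commute_near_eq1 _ l) => y /lP [a Ka Cay].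
rewrite -(mulVKg a y); apply: commuteM; first exact: Cz.
exact/commute_sym/Cay.
Qed.

Section Germ.
Variables (K : set G) (j : nat).
Hypothesis (sK : is_subgroup K) (cK : closed K) (nK : normalised (W j) K).

Let A i := K `&` W i.

Let AS i i' : (i <= i')%N -> A i' `<=` A i.
Proof. by move=> ii z [Kz /(dW ii)]. Qed.

Let sA i : is_subgroup (A i). Proof. exact: is_subgroupI. Qed.

Let nA i : normalised (W j) (A i).
Proof.
apply: normalisedI => //; apply: normalisedS (ls_normal ls (n := i)).
exact: dW.
Qed.

Let level i : (j <= i)%N -> [/\ is_subgroup (A i), closed (A i),
  A i `<=` W i & normalised (W i) (A i)].
Proof.
move=> ji; split=> //.
- by apply: closedI => //; apply: closed_open_subg.
- by move=> z [].
- exact: (normalisedS (dW ji) (@nA i)).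
Qed.

Let cent_small i : (j <= i)%N -> A j `&` cent (A i) `<=` [set 1].
Proof.
move=> ji; have [s1 c1 l1 n1] := level ji; apply: (@discrete_eq1 _ i j).
- exact: is_subgroupI (sA j) (is_subgroup_cent _).
- by apply: normalisedI => //; exact: normalised_cent.
- move=> z [[[Kz _] Cz] Wz]; apply: (level_center s1 c1 l1 n1).
  by split.
Qed.

Let cent_up i y : (j <= i)%N -> W j y -> cent (A i) y -> cent (A j) y.
Proof.
move=> ji Wy Cy a Aa; apply/commgP/eqP/(cent_small ji); split.
  rewrite commgEr; apply: (subgM (sA j) _ Aa).
  by apply: nA => //; exact: (subgV (sA j)).
have sC := is_subgroup_cent (A i).
rewrite commgEl; apply: (subgM sC (subgV sC Cy)).
apply: (normalised_cent (sW j) (@nA i)) => //.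
by case: Aa.
Qed.

(* For g centralising the germ of K and x in K, the commutator [g, x]
   centralises the germs of K and of its centraliser, hence is trivial. *)
Lemma cent_level : cent (K `&` W j) `<=` cent K.
Proof.
move=> g Cg x Kx.
have [i1 i1P] := near1 j (@continuous_conjl _ x^-1) (conj1g _).
have [i2 i2P] := near1 j (@continuous_commg _ x) (commg1 x).
pose i := maxn j (maxn i1 i2).
have ji : (j <= i)%N by rewrite leq_maxl.
have Ax z : A i z -> A j (z ^ x^-1).
  move=> [Kz Wz]; split; first by apply: (subgJ sK Kz); exact: subgV.
  by apply: i1P; apply: (dW _ Wz); rewrite !leq_max leqnn !orbT.
have Cx y : cent (A j) y -> cent (A i) (y ^ x).
  move=> Cy z Az; have := commuteJ x (Cy _ (Ax z Az)).
  by rewrite conjgKV.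
have sCi := is_subgroup_cent (A i); have sCj := is_subgroup_cent (A j).
(* For y near 1 and centralising [A j], the commutator [x, y] is a small element of K centralising
   [A i], and by [cent_small] there is no such element but 1. *)
have xy y : W i y -> cent (A j) y -> commute x y.
  move=> Wy Cy; have Wj := dW ji Wy.
  apply/commgP/eqP/(cent_small ji); split; first split.
  - rewrite commgEl; apply: (subgM sK (subgV sK Kx)).
    exact: nK.
  - by apply: i2P; apply: (dW _ Wy); rewrite !leq_max leqnn !orbT.
  - rewrite commgEr; apply: (subgM sCi).
      by apply: Cx; exact: (subgV sCj).
    by apply: cent_anti (AS ji) _ Cy.
have [i3 i3P] := near1 i (@continuous_conjl _ g^-1) (conj1g _).
pose k := maxn i i3; have ik : (i <= k)%N := leq_maxl _ _.
have jk := leq_trans ji ik; have [s1 c1 l1 n1] := level jk.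
have [l lP] := ls_complement ls s1 c1 l1 n1.
(* A small y is a product of some a in [A k] and some c centralising [A k]; the commutator [g, x] is
   tested against a and c separately. *)
apply/commgP/eqP; apply: (@commute_near_eq1 _ (maxn l k)) => y Wy.
have [a Aa Ca] := lP y (dW (leq_maxl _ _) Wy).
have Wc : W k (a^-1 * y).
  apply: (subgM (sW k)); last exact: (dW (leq_maxr l k)).
  by apply: (subgV (sW k)); case: Aa.
rewrite -(mulVKg a y); move: (a^-1 * y) Ca Wc => c Cc Wc.
apply: commuteM; apply/commute_sym.
  rewrite commgEl; apply: commuteM; apply/commute_sym.
    by apply: (subgV sCj Cg); exact: (AS jk).
  by apply: Cx => //; exact: (AS ik).
have Cjc : cent (A j) c by apply: (cent_up jk) => //; exact: (dW jk).
rewrite commgEr; apply: commuteM; last first.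
  by apply/commute_sym/xy => //; exact: (dW ik).
have cg : commute x (c ^ g^-1).
  apply: xy; first by apply: i3P; exact: (dW (leq_maxr _ _) Wc).
  by apply: (subgJ sCj) => //; exact: (subgV sCj).
by have := commuteJ g (commute_sym (commuteV1 cg)); rewrite conjgKV.
Qed.

End Germ.

Lemma cent_germ K i : lnc K -> cent (K `&` W i) = cent K.
Proof.
move=> [sK cK [j nK]]; apply/seteqP; split; last first.
  by apply: cent_anti => z [].
apply: subset_trans (@cent_level K (maxn i j) sK cK _).
  by apply: cent_anti => z [Kz Wz]; split=> //; exact: (dW (leq_maxl _ _) Wz).
exact: (normalisedS (dW (leq_maxr _ _)) nK).
Qed.

Definition near_sub K L := exists i, K `&` W i `<=` L.

Lemma near_sub_sub K L : K `<=` L -> near_sub K L.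
Proof. by move=> KL; exists 0%N => z [/KL]. Qed.

Lemma near_sub_trans K L S : near_sub K L -> near_sub L S -> near_sub K S.
Proof.
move=> [i iP] [j jP]; exists (maxn i j) => z [Kz Wz]; apply: jP; split.
  by apply: iP; split=> //; exact: (dW (leq_maxl _ _) Wz).
exact: (dW (leq_maxr _ _) Wz).
Qed.

Lemma cent_near K L : lnc K -> near_sub K L -> cent L `<=` cent K.
Proof. by move=> lK [i iP]; rewrite -(cent_germ i lK); exact: cent_anti. Qed.

Lemma lnc_center K : lnc K -> K `&` cent K `<=` [set 1].
Proof.
move=> lK; have [sK cK [j nK]] := lK.
move=> z [Kz Cz].
have [||||l lP] := ls_complement ls (k := j) (K := K `&` W j).
- exact: is_subgroupI.
- by apply: closedI => //; apply: closed_open_subg.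
- by move=> y [].
- by apply: normalisedI => //; exact: normalised_self.
apply: (@commute_near_eq1 _ l) => y /lP [a [Ka _] Ca].
rewrite -(mulVKg a y); apply: commuteM; first exact: Cz.
by rewrite (cent_germ j lK) in Ca; exact/commute_sym/Ca.
Qed.

Lemma lnc_complement K i : lnc K -> exists l, forall z, W l z ->
  exists a, [/\ K a, W i a & cent K (a^-1 * z)].
Proof.
move=> lK; have [sK cK [j nK]] := lK; pose k := maxn i j.
have nKk : normalised (W k) K by exact: (normalisedS (dW (leq_maxr _ _)) nK).
have [||||l lP] := ls_complement ls (k := k) (K := K `&` W k).
- exact: is_subgroupI.
- by apply: closedI => //; apply: closed_open_subg.
- by move=> y [].
- by apply: normalisedI => //; exact: normalised_self.
exists l => z /lP [a [Ka Wa] Ca]; exists a; split=> //.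
  exact: (dW (leq_maxl _ _) Wa).
by rewrite (cent_germ k lK) in Ca.
Qed.

Lemma near_cent2 K : lnc K -> near_sub (cent (cent K)) K.
Proof.
move=> lK; have [l lP] := lnc_complement 0 lK; exists l => z [CCz /lP [a [Ka _ Ca]]].
have sCC := is_subgroup_cent (cent K).
have e : a^-1 * z = 1.
  apply: (lnc_center (lnc_cent lK)); split=> //.
  by apply: (subgM sCC _ CCz); apply: (subgV sCC); exact: sub_cent2.
by rewrite -(mulVKg a z) e mulg1.
Qed.

(** Small elements of K and L normalise L and K, so their commutators lie in K /\ L; [cent_germ],
    applied to each side, extends the commutation to all of K and L. *)
Lemma disjoint_cent K L : lnc K -> lnc L -> K `&` L `<=` [set 1] -> L `<=` cent K.
Proof.
move=> lK lL KL; have [sK _ [i nK]] := lK; have [sL _ [j nL]] := lL.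
pose k := maxn i j.
rewrite -(cent_germ k lK); apply: sub_centC; rewrite -(cent_germ k lL).
move=> x [Kx Wx] y [Ly Wy]; apply/commgP/eqP/KL; split.
  rewrite commgEl; apply: (subgM sK (subgV sK Kx)); apply: nK => //.
  exact: (dW (leq_maxl _ _) Wy).
rewrite commgEr; apply: (subgM sL _ Ly); apply: nL; last exact: subgV.
exact: (dW (leq_maxr _ _) Wx).
Qed.

(** Among the closed locally normal subgroups with a given double centraliser, the regular one is a
    canonical representative: it is determined by its germ, see [regular_near]. *)
Definition regular X := lnc X /\ cent (cent X) = X.

Lemma regular_cent K : lnc K -> regular (cent K).
Proof. by move=> lK; split; [exact: lnc_cent|exact: cent3]. Qed.

Lemma regular_cent2 K : lnc K -> regular (cent (cent K)).
Proof. by move=> lK; apply: regular_cent; exact: lnc_cent. Qed.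

Lemma regularI X Y : regular X -> regular Y -> regular (X `&` Y).
Proof.
move=> [lX cX] [lY cY]; split; first exact: lncI.
apply/seteqP; split; last exact: sub_cent2.
move=> z Cz; split; [rewrite -cX|rewrite -cY];
  by apply: cent_anti z Cz; apply: cent_anti => x [].
Qed.

Lemma regular_conj X g : regular X -> regular (conj_set X g).
Proof.
by move=> [lX cX]; split; [exact: lnc_conj|rewrite !cent_conj_set cX].
Qed.

Lemma cent2_sub K X : regular X -> K `<=` X -> cent (cent K) `<=` X.
Proof.
by move=> [_ e] KX; rewrite -[X in _ `<=` X]e; exact/cent_anti/cent_anti.
Qed.

Lemma cent2_eq1 K : lnc K -> cent (cent K) = [set 1] -> K = [set 1].
Proof.
move=> lK e; apply/seteqP; split; first by rewrite -e; exact: sub_cent2.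
by move=> _ ->; apply: subg1; case: lK.
Qed.

Lemma regular_near X Y : regular X -> regular Y -> near_sub X Y -> X `<=` Y.
Proof.
move=> [lX cX] [lY cY] XY; rewrite -cX -cY; apply: cent_anti.
exact: cent_near.
Qed.

(** Only finitely many germs are available and each belongs to at most one regular subgroup; [xget]
    chooses it for a given germ. *)
Lemma finite_regular n : finite_set [set X | regular X /\ normalised (W n) X].
Proof.
have [F fF FP] := ls_finite ls n.
pose rel A X := [/\ regular X, normalised (W n) X &
  exists l, (X `&` W n) `&` W l = A `&` W l].
apply: (@sub_finite_set _ _ ((fun A => xget setT (rel A)) @` F)); last first.
  exact: finite_image.
move=> X [rX nX]; have [lX _] := rX; have [sX cX _] := lX.
have [||||A FA [l lA]] := FP (X `&` W n).
- exact: is_subgroupI.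
- by apply: closedI => //; apply: closed_open_subg.
- by move=> y [].
- by apply: normalisedI => //; exact: normalised_self.
exists A => //; have rAX : rel A X by split=> //; exists l.
have [rY nY [l' lA']] : rel A (xget setT (rel A)) by exact: (xgetPex setT (ex_intro (rel A) X rAX)).
move: (xget _ _) rY nY l' lA' => Y rY nY l' lA'.
have near X1 Y1 l1 l2 : (X1 `&` W n) `&` W l1 = A `&` W l1 ->
    (Y1 `&` W n) `&` W l2 = A `&` W l2 -> near_sub X1 Y1.
  move=> e1 e2; exists (maxn n (maxn l1 l2)) => z [Xz Wz].
  have H k : (k <= maxn n (maxn l1 l2))%N -> W k z by move=> h; exact: (dW h Wz).
  have : (A `&` W l1) z.
    by rewrite -e1; split; [split=> //|]; apply: H; rewrite !leq_max leqnn ?orbT.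
  move=> [Az _]; have : (A `&` W l2) z.
    by split=> //; apply: H; rewrite !leq_max leqnn ?orbT.
  by rewrite -e2 => -[[]].
apply/seteqP; split; apply: regular_near => //; apply: near; eassumption.
Qed.

End LocallyNormalTheory.

(** * Components *)

Lemma finite_minimal (T : Type) (F : set (set T)) (Z : set T) :
  finite_set F -> F Z ->
  exists X, [/\ F X, X `<=` Z & forall Y, F Y -> Y `<=` X -> Y = X].
Proof.
move=> /finite_uniq_seq [s us sF].
have [n] := ubnP (size [seq Y <- s | `[< Y `<=` Z >]]).
elim: n Z => // n IHn Z; rewrite ltnS => sn FZ.
have [[Y [FY YZ nYZ]]|nex] := pselect (exists Y, [/\ F Y, Y `<=` Z & Y <> Z]).
  have [|//|X [FX XY mX]] := IHn Y.
    apply: leq_trans sn; have -> : (size [seq Y0 <- s | `[< Y0 `<=` Y >]]).+1 =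
      size (Z :: [seq Y0 <- s | `[< Y0 `<=` Y >]]) by [].
    apply: uniq_leq_size => [|X].
      rewrite /= filter_uniq // andbT mem_filter; apply/negP => /andP [/asboolP ZY _].
      by apply: nYZ; apply/seteqP.
    rewrite inE !mem_filter => /orP [/eqP ->|/andP [/asboolP XY Xs]].
      by apply/andP; split; [exact/asboolP|exact/sF].
    by rewrite Xs andbT; apply/asboolP; exact: subset_trans YZ.
  by exists X; split=> //; exact: subset_trans YZ.
exists Z; split=> // Y FY YZ; apply: contrapT => nYZ.
by apply: nex; exists Y.
Qed.

(** * Open normal subgroups and their intersections *)

Section OpenNormal.
Context {G : topGroupType}.
Implicit Types (H K M N S : set G) (D : set (set G)) (g x y : G).

Definition open_normal H : set (set G) :=
  [set N | [/\ is_subgroup N, N `<=` H, normalised H N & open_in H N]].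

Lemma open_normalP H N : is_subgroup H ->
  open_normal H N <-> normal_in H N /\ open_in H N.
Proof.
move=> sH; split=> [[sN NH nN oN]|[/(normal_inP _ sH) [sN NH nN] oN]] //.
by split=> //; apply/normal_inP.
Qed.

Lemma open_inT (U : set G) : open_in [set: G] U <-> open U.
Proof. by split=> [[V oV ->]|oU]; [rewrite setTI|exists U; rewrite ?setTI]. Qed.

Lemma open_in_conj H S g : open_in H S -> open_in (conj_set H g) (conj_set S g).
Proof.
move=> [U oU ->]; exists (conj_set U g).
  by rewrite conj_setE; apply: open_preim oU; exact: continuous_conjl.
by rewrite !conj_setE.
Qed.

Lemma open_normal_conj H N g : open_normal H N ->
  open_normal (conj_set H g) (conj_set N g).
Proof.
move=> [sN NH nN oN]; split.
- exact: is_subgroup_conj_set.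
- exact: conj_set_mono.
- move=> _ _ [h Hh <-] [x Nx <-]; exists (x ^ h); first exact: nN.
  by rewrite conjJg.
- exact: open_in_conj.
Qed.

(** The family D is left open so that the residual and the intersection of the maximal open normal
    subgroups are treated alike. An empty D gives H. *)
Definition meet H D : set G := [set h | H h /\ forall N, D N -> N h].

(* An open subgroup N of H is relatively closed: the closure in G of a subset
   of N meets H in a subset of N. *)
Lemma meet_closed H D : is_subgroup H -> D `<=` open_normal H ->
  [/\ is_subgroup (meet H D), normalised H (meet H D) & closed_in H (meet H D)].
Proof.
move=> sH DH; split.
- split=> [|x y [Hx Rx] [Hy Ry]|x [Hx Rx]].
  + by split=> [|N /DH [sN _ _ _]]; [exact: (subg1 sH)|exact: (subg1 sN)].
  + split=> [|N DN]; first exact: (subgM sH).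
    by have [sN _ _ _] := DH N DN; apply: (subgM sN); [exact: Rx|exact: Ry].
  + split=> [|N DN]; first exact: (subgV sH).
    by have [sN _ _ _] := DH N DN; apply: (subgV sN); exact: Rx.
- move=> g x Hg [Hx Rx]; split=> [|N DN]; first exact: (subgJ sH).
  by have [_ _ nHN _] := DH N DN; apply: nHN => //; exact: Rx.
- exists (closure (meet H D)); first exact: closed_closure.
  apply/seteqP; split=> x.
    by move=> Rx; split; [case: Rx|exact: subset_closure].
  move=> [Hx cx]; split=> // N DN; have [sN NH _ [U oU NU]] := DH N DN.
  have U1 : U 1 by have := subg1 sN; rewrite NU => -[].
  have [|y [[Hy Ry] Uy]] := cx [set y | U (x^-1 * y)].
    apply: open_nbhs_nbhs; split; first exact: open_coset.
    by rewrite /= mulVg.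
  have Ny : N y by exact: Ry.
  have Nxy : N (x^-1 * y).
    by rewrite NU; split=> //; apply: (subgM sH) => //; exact: (subgV sH).
  by apply: (subgVP sN); apply: (subg_cancelr sN Ny).
Qed.

Lemma meet_conj H g (D : set G -> set (set G)) :
  (forall K N h, D K N -> D (conj_set K h) (conj_set N h)) ->
  conj_set (meet H (D H)) g `<=` meet (conj_set H g) (D (conj_set H g)).
Proof.
move=> DJ _ [h [Hh Dh] <-]; split=> [|N DN]; first by exists h.
have := DJ _ _ g^-1 DN; rewrite conj_setK => /Dh Nh.
by rewrite -(conj_setKV N g); exists h.
Qed.

Lemma ResE H : is_subgroup H -> Res H = meet H (open_normal H).
Proof.
move=> sH; apply/seteqP; split=> h [Hh Rh]; split=> // N.
  by move=> /(open_normalP _ sH) [nN oN]; exact: Rh.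
by move=> nN oN; apply: Rh; apply/(open_normalP _ sH).
Qed.

Lemma Res_closed H : is_subgroup H ->
  [/\ is_subgroup (Res H), normalised H (Res H) & closed_in H (Res H)].
Proof. by move=> sH; rewrite ResE //; exact: meet_closed. Qed.

Lemma Res_sub H N : is_subgroup H -> open_normal H N -> Res H `<=` N.
Proof. by move=> sH oN h; rewrite ResE // => -[_]; exact. Qed.

Definition max_open_normal H : set (set G) :=
  [set M | [/\ open_normal H M, M <> H &
    forall N, open_normal H N -> M `<=` N -> N = M \/ N = H]].

Lemma max_open_normal_conj H M g : max_open_normal H M ->
  max_open_normal (conj_set H g) (conj_set M g).
Proof.
move=> [oM MH mM]; split; first exact: open_normal_conj.
  by move=> e; apply: MH; rewrite -(conj_setK M g) e conj_setK.
move=> N /(@open_normal_conj _ _ g^-1); rewrite conj_setK => oN.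
move=> /(@conj_set_mono _ _ _ g^-1); rewrite conj_setK => MN.
by rewrite -(conj_setKV N g); have [->|->] := mM _ oN MN; [left|right].
Qed.

Definition mulset S K : set G := [set z | exists2 a, S a & K (a^-1 * z)].

Lemma mulset_subgroup S K : is_subgroup S -> is_subgroup K -> normalised S K ->
  is_subgroup (mulset S K).
Proof.
move=> sS sK nK; split.
- by exists 1; [exact: subg1|rewrite invg1 mulg1; exact: (subg1 sK)].
- move=> z z' [a Sa Ka] [a' Sa' Ka']; exists (a * a'); first exact: subgM.
  have -> : (a * a')^-1 * (z * z') = (a^-1 * z) ^ a' * (a'^-1 * z').
    by rewrite conjgE invgM -!mulgA mulVKg.
  by apply: (subgM sK) => //; exact: nK.
- move=> z [a Sa Ka]; exists a^-1; first exact: subgV.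
  have -> : a^-1^-1 * z^-1 = ((a^-1 * z) ^ a^-1)^-1.
    by rewrite conjgE !invgK !mulgA mulgV mul1g invgM invgK.
  by apply: (subgV sK); apply: nK => //; exact: subgV.
Qed.

Lemma mulset_sub S K : is_subgroup K -> S `<=` mulset S K.
Proof. by move=> sK a Sa; exists a => //; rewrite mulVg; exact: (subg1 sK). Qed.

Lemma mulset_conj S K g z :
  mulset S K z -> mulset (conj_set S g) (conj_set K g) (z ^ g).
Proof.
by move=> [a Sa Ka]; exists (a ^ g); [exists a|rewrite -conjVg -conjMg; exists (a^-1 * z)].
Qed.

End OpenNormal.

(** * Atoms and the components they define *)

Section Components.
Context {G : topGroupType}.
Variable W : nat -> set G.
Implicit Types (K L X Y Z A : set G) (x y z g h : G).
Hypothesis ls : local_structure W.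
Hypothesis hG : hausdorff_space G.
Hypothesis qzG : QZ [set: G] = [set 1].

Local Notation lnc := (lnc W).
Local Notation regular := (regular W).
Local Notation near_sub := (near_sub W).
Local Notation R := (Res [set: G]).

Let sW := ls_subgroup ls.
Let oW n : open (W n). Proof. by case: (ls_base ls) => /(_ n) []. Qed.

Lemma lnc_normal K : is_subgroup K -> closed K -> normalised [set: G] K -> lnc K.
Proof. by move=> sK cK nK; split=> //; exists 0%N; exact: normalisedS nK. Qed.

Lemma lnc_Res : lnc R.
Proof.
have [sR nR [C cC RC]] := Res_closed (@is_subgroupT G).
by apply: lnc_normal => //; rewrite RC setTI.
Qed.

Lemma normal_Res : normalised [set: G] R.
Proof. by have [] := Res_closed (@is_subgroupT G). Qed.

Definition mulc A X : set G := mulset A (cent X).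

Lemma mulc_subgroup A X : is_subgroup A -> A `<=` X -> is_subgroup (mulc A X).
Proof.
move=> sA AX; apply: mulset_subgroup (is_subgroup_cent X) _ => // a c Aa Cc.
by rewrite conj_fix //; apply: Cc; exact: AX.
Qed.

Lemma mulc_open A X : lnc X -> is_subgroup A -> A `<=` X -> near_sub X A ->
  open (mulc A X).
Proof.
move=> lX sA AX [i iP]; have [l lP] := lnc_complement ls qzG i lX.
apply: (open_subgS (mulc_subgroup sA AX) (oW l) (sW l)) => z /lP [a [Xa Wa Ca]].
by exists a => //; apply: iP.
Qed.

Lemma mulc_conj A X g z : mulc A X z -> mulc (conj_set A g) (conj_set X g) (z ^ g).
Proof. by rewrite /mulc cent_conj_set; exact: mulset_conj. Qed.

Definition Oc := mulc R R.
Local Notation O := Oc.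

Lemma Oc_subgroup : is_subgroup O.
Proof. by apply: mulc_subgroup => //; have [] := Res_closed (@is_subgroupT G). Qed.

Lemma conj_normal K g : normalised [set: G] K -> conj_set K g = K.
Proof. by move=> nK; apply: conj_set_sub (is_subgroupT) nK I. Qed.

Lemma Oc_normal : normalised [set: G] O.
Proof.
move=> g z _ /(mulc_conj g); rewrite conj_normal //; exact: normal_Res.
Qed.

Lemma Oc_open : open O.
Proof. by apply: mulc_open; [exact: lnc_Res|case: lnc_Res| |exact: near_sub_sub]. Qed.

Lemma Oc_level : exists n, W n `<=` O.
Proof. by case: (ls_base ls) => _ _; apply; [exact: Oc_open|exact: (subg1 Oc_subgroup)]. Qed.

Lemma lnc_Oc K : is_subgroup K -> closed K -> normalised O K -> lnc K.
Proof.
move=> sK cK nK; split=> //; have [n nO] := Oc_level; exists n.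
exact: normalisedS nK.
Qed.

Lemma finite_Oc : finite_set [set X | regular X /\ normalised O X].
Proof.
have [n nO] := Oc_level.
apply: sub_finite_set (finite_regular ls qzG n) => X [rX nX]; split=> //.
exact: normalisedS nX.
Qed.

Definition atom X := [/\ regular X /\ normalised O X, X `<=` cent (cent R), X <> [set 1] &
  forall Z, regular Z -> normalised O Z -> Z `<=` X -> Z = [set 1] \/ Z = X].

Lemma atom_lnc X : atom X -> lnc X. Proof. by case=> [[[]]]. Qed.

Lemma finite_atom : finite_set atom.
Proof. by apply: sub_finite_set finite_Oc => X []. Qed.

Lemma normalised_conj_set X g : normalised O X -> normalised O (conj_set X g).
Proof.
move=> nX v _ Ov [x Xx <-]; exists (x ^ (v ^ g^-1)).
  by apply: nX => //; apply: Oc_normal.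
by rewrite -!conjgM; congr (_ ^ _); rewrite conjgE invgK !mulgA mulgVK.
Qed.

Lemma atom_conj X g : atom X -> atom (conj_set X g).
Proof.
move=> [[rX nX] XR X1 mX]; split.
- by split; [exact: regular_conj|exact: normalised_conj_set].
- have e : conj_set (cent (cent R)) g = cent (cent R).
    by apply: conj_normal; do 2!apply: normalised_cent (is_subgroupT) _; exact: normal_Res.
  by rewrite -e; exact: conj_set_mono.
- by move=> e; apply: X1; rewrite -(conj_setK X g) e /conj_set image_set1 conj1g.
- move=> Z rZ nZ ZX; have [| | |e|e] := mX (conj_set Z g^-1).
  + exact: regular_conj.
  + exact: normalised_conj_set.
  + by rewrite -(conj_setK X g); exact: conj_set_mono.
  + by left; rewrite -(conj_setKV Z g) e /conj_set image_set1 conj1g.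
  + by right; rewrite -e conj_setKV.
Qed.

Lemma exists_atom K : lnc K -> normalised O K -> K `<=` cent (cent R) ->
  K <> [set 1] -> exists2 X, atom X & X `<=` cent (cent K).
Proof.
move=> lK nK KR K1.
pose F := [set X | (regular X /\ normalised O X) /\ X <> [set 1]].
have fF : finite_set F by apply: sub_finite_set finite_Oc => X [].
have nCK : normalised O (cent (cent K)).
  by do 2!apply: normalised_cent (Oc_subgroup) _.
have [|X [[[rX nX] X1] XK mX]] := @finite_minimal _ F (cent (cent K)) fF.
  split; first by split=> //; exact: regular_cent2.
  by move/(cent2_eq1 lK).
exists X => //; split=> //.
  apply: subset_trans XK _; apply: cent2_sub KR.
  exact: (regular_cent2 ls hG lnc_Res).
move=> Z rZ nZ ZX; have [Z1|Z1] := pselect (Z = [set 1]); [by left|right].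
by apply: mX.
Qed.

Lemma atom_disjoint X Y : atom X -> atom Y -> X <> Y -> X `<=` cent Y.
Proof.
move=> aX aY nXY.
suff XY1 : X `&` Y = [set 1].
  apply: (disjoint_cent ls qzG (atom_lnc aY) (atom_lnc aX)).
  by rewrite setIC XY1.
have [[rX nX] _ X1 mX] := aX; have [[rY nY] _ Y1 mY] := aY.
have rXY := regularI ls rX rY; have nXY' := normalisedI nX nY.
have [//|eX] := mX _ rXY nXY' (@subIsetl _ _ _).
have XY : X `<=` Y by move=> x; rewrite -eX => -[].
have [e|e] := mY _ rX nX XY; [by case: X1|by case: nXY].
Qed.

(** Let Z be the subgroup of C(C(R)) centralising all atoms. If Z were nontrivial, C(C(Z)) would
    contain an atom X; but Z centralises X, so C(C(Z)) <= C(X), and X would be abelian, against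
    [lnc_center]. *)
Lemma atoms_cover z : R z -> (forall X, atom X -> cent X z) -> z = 1.
Proof.
move=> Rz Cz; have lR := lnc_Res.
pose Z := cent (cent R) `&` \bigcap_(X in atom) cent X.
have sZ : is_subgroup Z.
  apply: is_subgroupI (is_subgroup_cent _) _.
  by apply: is_subgroup_bigcap => X _; exact: is_subgroup_cent.
have nZ : normalised O Z.
  apply: normalisedI.
    do 2!apply: normalised_cent (Oc_subgroup) _.
    exact: normalisedS (@subsetT _ _) normal_Res.
  move=> v x Ov Zx X aX; apply: (normalised_cent Oc_subgroup _ Ov (Zx X aX)).
  by case: aX => [[]].
have cZ : closed Z.
  apply: closedI; first exact: closed_cent.
  by apply: closed_bigI => X _; exact: closed_cent.
have lZ := lnc_Oc sZ cZ nZ.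
have [Z1|Z1] := pselect (Z = [set 1]).
  have : Z z by split; [exact: sub_cent2|exact: Cz].
  by rewrite Z1.
have [X aX XZ] := exists_atom lZ nZ (@subIsetl _ _ _) Z1.
have XC : X `<=` cent X.
  apply: subset_trans XZ _; apply: cent2_sub; first exact: (regular_cent ls hG (atom_lnc aX)).
  by move=> x [_ /(_ X aX)].
have [_ _ X1 _] := aX; case: X1; apply/seteqP; split=> [x Xx|_ ->].
  by apply: (lnc_center ls qzG (atom_lnc aX)); split=> //; exact: XC.
by apply: subg1; case: (atom_lnc aX).
Qed.

Definition comp X := R `&` X.

Lemma comp_lnc X : atom X -> lnc (comp X).
Proof. by move=> /atom_lnc; apply: lncI lnc_Res. Qed.

Lemma comp_subgroup X : atom X -> is_subgroup (comp X).
Proof. by case/comp_lnc. Qed.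

Lemma comp_sub X : comp X `<=` X. Proof. exact: subIsetr. Qed.

Lemma near_comp X : atom X -> near_sub X (comp X).
Proof.
move=> [_ XR _ _]; have [i iP] := near_cent2 ls hG qzG lnc_Res.
by exists i => x [Xx Wx]; split=> //; apply: iP; split=> //; exact: XR.
Qed.

Lemma cent_comp X : atom X -> cent (comp X) = cent X.
Proof.
move=> aX; apply/seteqP; split.
  apply: (cent_near ls qzG (atom_lnc aX)); exact: near_comp.
by apply: cent_anti; exact: comp_sub.
Qed.

Lemma comp_conj X g : conj_set (comp X) g = comp (conj_set X g).
Proof.
rewrite /comp -{2}(conj_normal g normal_Res) !conj_setE.
by apply/seteqP; split.
Qed.

(* The intersection over the atoms X in D of the open subgroups kappa X * C(X)
   is normal in G, hence contains the residual. *)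
Lemma equivariant_open (D : set (set G)) (kappa : set G -> set G) :
  D `<=` atom -> (forall X g, D X -> D (conj_set X g)) ->
  (forall X, D X -> is_subgroup (kappa X)) ->
  (forall X, D X -> kappa X `<=` comp X) ->
  (forall X, D X -> near_sub X (kappa X)) ->
  (forall X g, D X -> conj_set (kappa X) g `<=` kappa (conj_set X g)) ->
  forall X, D X -> R `<=` mulc (kappa X) X /\ kappa X = comp X.
Proof.
move=> Da Dc sk kc nk ek X DX.
have kX Y : D Y -> kappa Y `<=` Y.
  by move=> DY; apply: subset_trans (kc Y DY) _; exact: comp_sub.
pose N := \bigcap_(Y in D) mulc (kappa Y) Y.
have RN : R `<=` N.
  apply: Res_sub; first exact: is_subgroupT; split=> //.
  - by apply: is_subgroup_bigcap => Y DY; apply: mulc_subgroup; [exact: sk|exact: kX].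
  - move=> g z _ Nz Y DY; have DY' := Dc _ g^-1 DY.
    have [a /(ek _ _ DY') ka] := mulc_conj g (Nz _ DY').
    by rewrite conj_setKV in ka *; exists a.
  - apply/open_inT; apply: open_finite_bigcap; first exact: sub_finite_set finite_atom.
    move=> Y DY; apply: mulc_open; [exact/atom_lnc/Da|exact: sk|exact: kX|exact: nk].
have RX : R `<=` mulc (kappa X) X by move=> z /RN; apply.
split=> //; apply/seteqP; split; first exact: kc.
move=> z cz; have Xz := comp_sub cz; have Rz : R z by case: cz.
have [a ka Ca] := RX z Rz; have lX := atom_lnc (Da _ DX).
have e : a^-1 * z = 1.
  apply: (lnc_center ls qzG lX); split=> //.
  have [sX _ _] := lX.
  by apply: (subgM sX) => //; apply: (subgV sX); exact: (kX X DX).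
by rewrite -(mulVKg a z) e mulg1.
Qed.

Lemma comp_dec X z : atom X -> R z -> mulc (comp X) X z.
Proof.
move=> aX Rz; suff [RX _] : R `<=` mulc (comp X) X /\ comp X = comp X by exact: RX.
apply: (@equivariant_open atom comp) => //.
- by move=> Y g; exact: atom_conj.
- exact: comp_subgroup.
- by move=> Y _ z'.
- exact: near_comp.
- by move=> Y g _; rewrite comp_conj.
Qed.

Lemma Oc_dec X z : atom X -> O z -> mulc (comp X) X z.
Proof.
move=> aX [a Ra Ca]; have [b cb Cb] := comp_dec aX Ra; exists b => //.
have -> : b^-1 * z = (b^-1 * a) * (a^-1 * z) by rewrite -mulgA mulVKg.
apply: (subgM (is_subgroup_cent _)) => //.
have [_ XR _ _] := aX; rewrite -(cent3 R) in Ca.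
exact: cent_anti XR _ Ca.
Qed.

(** Modulo C(X), every element of O acts on X as an element of the component does. This is the
    purpose of O. *)
Lemma normal_comp_Oc X K : atom X -> K `<=` X -> normalised (comp X) K ->
  normalised O K.
Proof.
move=> aX KX nK v x Ov Kx; have [a ca Ca] := Oc_dec aX Ov.
rewrite -(mulVKg a v) conjgM conj_fix; first exact: nK.
apply: commute_sym; apply: Ca; apply: KX; exact: nK.
Qed.

(** C(C(K)) is regular, normalised by O and contained in X, hence 1 or X by minimality; it has the
    same germ as K. *)
Lemma Oc_sub_atom X K : atom X -> is_subgroup K -> closed K -> K `<=` X ->
  normalised O K -> K = [set 1] \/ near_sub X K.
Proof.
move=> aX sK cK KX nK; have lK := lnc_Oc sK cK nK.
have [[rX _] _ _ mX] := aX.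
have [|||e|e] := mX (cent (cent K)).
- exact: (regular_cent2 ls hG lK).
- by do 2!apply: normalised_cent (Oc_subgroup) _.
- exact: (cent2_sub rX KX).
- by left; exact: (cent2_eq1 lK).
- by right; have := near_cent2 ls hG qzG lK; rewrite e.
Qed.

Lemma closed_comp X K : atom X -> closed_in (comp X) K -> closed K.
Proof. by move=> aX [C cC ->]; apply: closedI => //; case: (comp_lnc aX). Qed.

Lemma comp_normal_subgroup X K : atom X -> is_subgroup K -> closed K ->
  K `<=` comp X -> normalised (comp X) K -> K = [set 1] \/ near_sub X K.
Proof.
move=> aX sK cK KP nK.
have KX : K `<=` X by move=> x /KP /comp_sub.
by apply: Oc_sub_atom => //; exact: normal_comp_Oc aX KX nK.
Qed.

Lemma not_near1 X : atom X -> ~ near_sub X [set 1].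
Proof.
move=> aX [i iP]; have [[[lX _] _] _ X1 _] := aX; have [sX _ [j nX]] := lX.
apply: X1; apply/seteqP; split; last by move=> _ ->; exact: subg1.
exact: (discrete_eq1 ls qzG sX nX iP).
Qed.

Lemma comp_neq1 X : atom X -> comp X <> [set 1].
Proof. by move=> aX e; apply: (not_near1 aX); rewrite -e; exact: near_comp. Qed.

(** * Direct decompositions *)

Lemma level_sep x : (forall k, W k x) -> x = 1.
Proof.
move=> Wx; apply: contrapT => x1; case: (ls_base ls) => _ _ bW.
have [||n /(_ x (Wx n))] := bW (~` [set x]); last exact.
  by apply: closed_openC; exact: (accessible_closed_set1 (hausdorff_accessible hG)).
by move=> /= e; apply: x1.
Qed.

Lemma direct_product_lnc (I : finType) (P : I -> set G) (H : set G) :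
  (forall i, lnc (P i)) -> (forall i j, i <> j -> P i `<=` cent (P j)) ->
  (forall h, H h <-> exists2 x, boxed P x & h = \prod_i x i) ->
  direct_product P H.
Proof.
move=> lP cP HE; have sP i : is_subgroup (P i) by case: (lP i).
have PH i : P i `<=` H.
  move=> g Pg; apply/HE; exists (fun j => if j == i then g else 1).
    by move=> j; case: eqP => [->//|_]; exact: (subg1 (sP j)).
  by rewrite -big_mkcond big_pred1_eq.
apply: (direct_product_commuting sP cP (ls_base ls)) => //.
- move=> i; exists (P i); first by case: (lP i).
  by apply/seteqP; split=> x; [split=> //; exact: (PH i)|case].
- move=> k.
  (* A product near 1 is a c' with a small in [P i] and c' in its centraliser. Comparison with the
     factor [x i] gives a = [x i], since [P i] meets its centraliser trivially. *)
  have sep i : exists l, forall x : I -> G, boxed P x -> W l (\prod_j x j) -> W k (x i).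
    have [l lQ] := lnc_complement ls qzG k (lP i); exists l => x Px /lQ [a [Pa Wa Ca]].
    have [c Cc e] := prod_commuting_component cP i Px.
    rewrite e mulgA in Ca.
    have e1 : a^-1 * x i = 1.
      apply: (lnc_center ls qzG (lP i)); split.
        exact: (subgM (sP i) (subgV (sP i) Pa)).
      by apply: (subg_cancelr (is_subgroup_cent _) Cc).
    by rewrite -(mulVKg a (x i)) e1 mulg1.
  have [l lS] := @boolp.choice _ _ _ sep; exists (\max_i l i) => x Px Wx i.
  apply: (lS i) => //; case: (ls_base ls) => _ dW _.
  by apply: (dW _ _ _ _ Wx); exact: leq_bigmax.
- exact: level_sep.
Qed.

(* [big_bool] requires commutativity. *)
Lemma prodg_bool (x : bool -> G) : \prod_b x b = x true * x false.
Proof. by rewrite /index_enum !unlock /= mulg1. Qed.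

Lemma direct_product2_Res : direct_product2 R (cent R) O.
Proof.
apply: direct_product_lnc => [[]|[] []//|h].
- exact: lnc_Res.
- exact: (lnc_cent ls hG lnc_Res).
- by move=> _; exact: sub_cent2.
- by move=> _ z.
split=> [[a Ra Ca]|[x Px ->]].
  exists (fun b : bool => if b then a else a^-1 * h); first by case.
  by rewrite prodg_bool mulVKg.
by rewrite prodg_bool; exists (x true); [exact: (Px true)|rewrite mulKg; exact: (Px false)].
Qed.

Lemma direct_product2P A B H : direct_product2 A B H ->
  [/\ is_subgroup A /\ is_subgroup B, closed_in H A /\ closed_in H B,
      A `<=` cent B &
      forall h, H h <-> exists2 a, A a & exists2 b, B b & h = a * b].
Proof.
move=> [sc mM [fm im sm] _ _]; have [sA cA] := sc true; have [sB cB] := sc false.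
have DP a b : A a -> B b -> forall c : bool, (if c then A else B) (if c then a else b).
  by move=> Aa Bb [].
split=> // [a Aa b Bb|h].
  have := mM _ _ (DP 1 b (subg1 sA) Bb) (DP a 1 Aa (subg1 sB)).
  by rewrite !prodg_bool /= !mul1g !mulg1.
split=> [/sm [x Dx <-]|[a Aa [b Bb ->]]].
  by rewrite prodg_bool; exists (x true); [exact: (Dx true)|exists (x false); [exact: (Dx false)|]].
have := fm _ (DP a b Aa Bb); by rewrite /= prodg_bool.
Qed.

(** Each h in A has a factor in every chosen component. After division by their product it
    centralises all atoms, the chosen ones and by hypothesis the others, so [atoms_cover] applies.
    The family Y may be a part of the atoms, which covers the factors of R as well as R itself. *)
Lemma comp_product (I : finType) (Y : I -> set G) A :
  is_subgroup A -> A `<=` R -> injective Y -> (forall i, atom (Y i)) ->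
  (forall i, comp (Y i) `<=` A) ->
  (forall Z, atom Z -> (forall i, Y i <> Z) -> A `<=` cent Z) ->
  direct_product (fun i => comp (Y i)) A.
Proof.
move=> sA AR injY aY YA AZ.
have cY i j : i <> j -> comp (Y i) `<=` cent (comp (Y j)).
  move=> ij x /comp_sub Yx; rewrite cent_comp //.
  by apply: (atom_disjoint (aY i) (aY j) _ Yx) => /injY.
apply: direct_product_lnc => // [i|h]; first exact: comp_lnc.
split=> [Ah|[x Px ->]]; last first.
  by apply: big_ind => //; [exact: subg1|move=> a b; exact: subgM|move=> i _; exact: (YA i)].
have dec i : exists a, comp (Y i) a /\ cent (Y i) (a^-1 * h).
  by have [a ca Ca] := comp_dec (aY i) (AR h Ah); exists a.
have [x xP] := @boolp.choice _ _ _ dec.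
have Px : boxed (fun i => comp (Y i)) x by move=> i; case: (xP i).
have Ax : A (\prod_i x i).
  by apply: big_ind => //; [exact: subg1|move=> a b; exact: subgM|move=> i _; exact: (YA i)].
exists x => //; rewrite -[LHS](mulVKg (\prod_i x i)) -[RHS]mulg1; congr (_ * _).
apply: atoms_cover.
  by apply: AR; apply: (subgM sA) => //; exact: (subgV sA).
move=> Z aZ; have [[i <-]|nZ] := pselect (exists i, Y i = Z); last first.
  apply: (AZ Z aZ); first by move=> i e; apply: nZ; exists i.
  by apply: (subgM sA) => //; exact: (subgV sA).
have [c Cc ->] := prod_commuting_component cY i Px.
have sC := is_subgroup_cent (Y i); rewrite invgM -mulgA; apply: (subgM sC).
  by apply: (subgV sC); rewrite -cent_comp.
by case: (xP i).
Qed.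

(** A /\ X is trivial or open in X. In the first case A centralises X. In the second B does: for z =
    a b in the component, b = a^-1 z then centralises B, so that b = 1 and z is in A. *)
Lemma factor_dichotomy A B X : direct_product2 A B R -> atom X ->
  comp X `<=` A \/ A `<=` cent X.
Proof.
move=> /direct_product2P [[sA sB] [cA cB] AB RE] aX.
have clR C : closed_in R C -> closed C.
  by move=> [D cD ->]; apply: closedI => //; case: lnc_Res.
have AR : A `<=` R by case: cA => D _ -> x [].
have BR : B `<=` R by case: cB => D _ -> x [].
have nO C : normalised A C -> normalised B C -> C `<=` R -> normalised O C.
  move=> nA nB CR v x [w /RE [a Aa [b Bb ->]] Cw] Cx.
  have Cab : C (x ^ (a * b)) by rewrite conjgM; apply: nB => //; exact: nA.
  rewrite -(mulVKg (a * b) v) conjgM conj_fix //.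
  by apply: commute_sym; apply: Cw; exact: CR.
have nA : normalised O A.
  apply: nO => //; first exact: normalised_self.
  by move=> b x Bb Ax; rewrite conj_fix //; exact: AB.
have nB : normalised O B.
  apply: nO => //; last exact: normalised_self.
  by move=> b x Bb Bx; rewrite conj_fix //; apply: commute_sym; exact: AB.
have lA := lnc_Oc sA (clR _ cA) nA; have lB := lnc_Oc sB (clR _ cB) nB.
have [[[lX _] nX] _ _ _] := aX; have [sX cX _] := lX.
have [_ cAX _] := lncI ls lA lX.
have [e|XA] := Oc_sub_atom aX (is_subgroupI sA sX) cAX (@subIsetr _ _ _) (normalisedI nA nX).
  by right; apply: (disjoint_cent ls qzG lX lA); rewrite setIC e.
have BX : B `<=` cent X.
  apply: (@subset_trans _ (cent (A `&` X))); last exact: (cent_near ls qzG lX XA).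
  by apply: (@subset_trans _ (cent A)); [exact: sub_centC|apply: cent_anti => x []].
left=> z [Rz Xz]; have /RE [a Aa [b Bb e]] := Rz.
suff b1 : b = 1 by rewrite e b1 mulg1.
apply: (lnc_center ls qzG lB); split=> // y By.
apply/commute_sym; rewrite -(mulKg a b) -e; apply: commuteM.
  by apply/commute_sym/commuteV1; exact: AB.
exact: BX.
Qed.

Lemma factor_product (I : finType) (Y : I -> set G) A :
  injective Y -> (forall i, atom (Y i)) ->
  (forall Z, atom Z -> exists i, Y i = Z) -> direct_factor A R ->
  exists J : {set I},
    direct_product (fun j : {i : I | i \in J} => comp (Y (val j))) A.
Proof.
move=> injY aY surY [B AB].
pose J := [set i | `[< comp (Y i) `<=` A >]]%SET.
have [[sA _] [cA _] _ _] := direct_product2P AB.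
exists J; apply: comp_product => //.
- by case: cA => D _ -> x [].
- by move=> i j /injY /val_inj.
- by move=> [i /=]; rewrite finset.inE => /asboolP.
move=> Z /[dup] aZ /surY [i <-] nJ; have [YA|//] := factor_dichotomy AB (aY i).
have iJ : i \in J by rewrite finset.inE; apply/asboolP.
by case: (nJ (exist _ i iJ)).
Qed.

(** A nontrivial factor A is normal, hence open in X. The other factor centralises A and therefore
    X, in which it lies. *)
Lemma comp_indecomposable X : atom X -> directly_indecomposable (comp X).
Proof.
move=> aX; split=> [|A B /direct_product2P [[sA sB] [cA cB] AB PE]].
  exact: comp_neq1.
have AP : A `<=` comp X by case: cA => D _ -> x [].
have BP : B `<=` comp X by case: cB => D _ -> x [].
have nA : normalised (comp X) A.
  move=> v x /PE [a Aa [b Bb ->]] Ax; have Axa := subgJ sA Ax Aa.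
  by rewrite conjgM conj_fix //; exact: AB.
have [->|XA] := comp_normal_subgroup aX sA (closed_comp aX cA) AP nA; [by left|right].
apply/seteqP; split=> [b Bb|_ ->]; last exact: subg1.
apply: (lnc_center ls qzG (atom_lnc aX)); split; first by have [] := BP b Bb.
apply: (cent_near ls qzG (atom_lnc aX) XA); exact: (sub_centC AB).
Qed.

Lemma comp_loc_branch X : atom X -> loc_just_infinite_branch (comp X).
Proof.
move=> aX; have [sP cP [k nP]] := comp_lnc aX.
apply: (ls_branch ls sP cP nP) => l Pl; apply: (not_near1 aX).
by apply: (near_sub_trans ls (near_comp aX)); exists l.
Qed.

(** * Normal subgroups of a component *)

(** N C(X) extends N to a subgroup of G without changing its trace on the component. When N is open
    in the component this subgroup is open in G, which gives relative openness and closedness and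
    supplies open sets of G for compactness arguments. *)
Lemma mulcI X N : atom X -> is_subgroup N -> N `<=` comp X ->
  comp X `&` mulc N X = N.
Proof.
move=> aX sN NP; apply/seteqP; split=> [z [cz [a Na Ca]]|z Nz].
  have e : a^-1 * z = 1.
    apply: (lnc_center ls qzG (atom_lnc aX)); split=> //.
    have sP := comp_subgroup aX.
    by apply: comp_sub; apply: (subgM sP) => //; apply: (subgV sP); exact: NP.
  by rewrite -(mulVKg a z) e mulg1.
by split; [exact: NP|apply: mulset_sub => //; exact: is_subgroup_cent].
Qed.

Lemma near_mulc X N : atom X -> is_subgroup N -> N `<=` comp X ->
  near_sub X N -> open (mulc N X) /\ is_subgroup (mulc N X).
Proof.
move=> aX sN NP XN; have NX := subset_trans NP (@comp_sub X).
by split; [exact: mulc_open (atom_lnc aX) sN NX XN|exact: mulc_subgroup].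
Qed.

Lemma near_open X N : atom X -> is_subgroup N -> N `<=` comp X ->
  near_sub X N -> open_in (comp X) N.
Proof.
move=> aX sN NP XN; exists (mulc N X); last by rewrite mulcI.
by case: (near_mulc aX sN NP XN).
Qed.

Lemma near_closed X N : atom X -> is_subgroup N -> N `<=` comp X ->
  near_sub X N -> closed_in (comp X) N.
Proof.
move=> aX sN NP XN; exists (mulc N X); last by rewrite mulcI.
by have [oN sM] := near_mulc aX sN NP XN; exact: closed_open_subg.
Qed.

Lemma open_near X N : atom X -> N 1 -> open_in (comp X) N -> near_sub X N.
Proof.
move=> aX N1 [U oU NU]; apply: (near_sub_trans ls (near_comp aX)).
have [n nU] : exists n, W n `<=` U.
  by case: (ls_base ls) => _ _; apply => //; move: N1; rewrite NU => -[].
by exists n => x [cx /nU Ux]; rewrite NU.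
Qed.

Lemma comp_invariant X K : atom X -> is_subgroup K -> K `<=` comp X ->
  closed_in (comp X) K -> normalised [set: G] K -> K = [set 1] \/ K = comp X.
Proof.
move=> aX sK KP cK nK.
have nPK : normalised (comp X) K by exact: normalisedS nK.
have [->|XK] := comp_normal_subgroup aX sK (closed_comp aX cK) KP nPK; first by left.
have lK : lnc K by apply: lnc_normal => //; exact: closed_comp cK.
(* Since K is open in X, it determines X as its double centraliser; so X is normal in G along with
   K, and the G-stable family of atoms may be X alone. *)
have eX : cent (cent K) = X.
  have [[[lX eX] _] _ _ _] := aX; rewrite -[RHS]eX; congr cent; apply/seteqP; split.
    exact: (cent_near ls qzG lX XK).
  by apply: cent_anti; apply: subset_trans KP _; exact: comp_sub.
right; suff [] : R `<=` mulc K X /\ K = comp X by [].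
apply: (@equivariant_open [set X] (fun=> K)) => // [Y ->//|Y g ->|Y ->|Y ->//|Y g _] /=.
- by rewrite -[in conj_set _ _]eX -!cent_conj_set conj_normal.
- exact: KP.
- by rewrite conj_normal.
Qed.

(** The atoms with nontrivial intersection form a G-stable family because F is compatible with
    conjugation. For them the intersection is closed and normal in the component, hence open by
    minimality, so it is an admissible kappa. *)
Lemma comp_meet (F : set G -> set (set G)) X :
  (forall H, F H `<=` open_normal H) ->
  (forall H N g, F H N -> F (conj_set H g) (conj_set N g)) -> atom X ->
  meet (comp X) (F (comp X)) = [set 1] \/ meet (comp X) (F (comp X)) = comp X.
Proof.
pose M Y := meet (comp Y) (F (comp Y)); rewrite -/(M X).
pose D := [set Y | atom Y /\ M Y <> [set 1]].
move=> oF FJ aX; have [e|nX] := pselect (M X = [set 1]); [by left|right].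
have MJ Y g : conj_set (M Y) g `<=` M (conj_set Y g).
  by rewrite /M -comp_conj; exact: meet_conj.
have MP Y : atom Y -> [/\ is_subgroup (M Y), M Y `<=` comp Y,
    normalised (comp Y) (M Y) & closed_in (comp Y) (M Y)].
  by move=> aY; have [] := meet_closed (comp_subgroup aY) (oF _); split=> // x [].
suff [] : R `<=` mulc (M X) X /\ M X = comp X by [].
apply: (@equivariant_open D M) => // [Y []//||Y []/MP []//|Y []/MP []//|Y [aY nY]].
- move=> Y g [aY nY]; split; first exact: atom_conj.
  move=> e; apply: nY; apply/seteqP; split; last first.
    by move=> _ ->; apply: subg1; case: (MP Y aY).
  move=> x Mx; apply: (conjg_inj g); rewrite conj1g.
  by have := MJ Y g; rewrite e; apply; exists x.
- have [sM MY nM cM] := MP Y aY.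
  by have [] := comp_normal_subgroup aY sM (closed_comp aY cM) MY nM.
Qed.

Lemma comp_Res X : atom X -> Res (comp X) = [set 1] \/ Res (comp X) = comp X.
Proof.
move=> aX; rewrite ResE; last exact: comp_subgroup.
by apply: (comp_meet (F := open_normal)) => // [H N|H N g]; [|exact: open_normal_conj].
Qed.

(** Nontrivial closed normal subgroups of the component are the same as its open normal ones. So if
    the residual is everything, the component is simple; if it is simple, the only open normal
    subgroup is the whole component and the residual cannot be trivial. *)
Lemma comp_type X : atom X ->
  (residually_discrete (comp X) /\ ~ topologically_simple (comp X)) \/
  (topologically_simple (comp X) /\ ~ residually_discrete (comp X)).
Proof.
move=> aX; have sP := comp_subgroup aX; have P1 := comp_neq1 aX.
rewrite /residually_discrete; have [R1|RP] := comp_Res aX; [left|right]; split=> //.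
- move=> [_ simP]; apply: P1; rewrite -R1 ResE //; apply/seteqP; split=> [x Px|x []//].
  split=> // N oN; have [sN NP nN open_N] := oN.
  have XN := open_near aX (subg1 sN) open_N.
  have [||e|->//] := simP N.
  + by apply/normal_inP.
  + exact: near_closed.
  + by case: (not_near1 aX); rewrite -e.
- split=> // N /(normal_inP _ sP) [sN NP nN] cN.
  have [|XN] := comp_normal_subgroup aX sN (closed_comp aX cN) NP nN; first by left.
  right; apply/seteqP; split=> //; rewrite -{1}RP; apply: Res_sub => //.
  by split=> //; exact: near_open.
by rewrite RP.
Qed.

(** * Local equivalence and the fixed points of a component on its structure lattice *)

Lemma near_open_in A B : is_subgroup A -> is_subgroup B -> near_sub A B ->
  open_in A (A `&` B).
Proof.
move=> sA sB [i iP].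
exists (\bigcup_(a in A `&` B) [set z | W i (a^-1 * z)]).
  by apply: bigcup_open => a _; exact: open_coset.
apply/seteqP; split=> [x [Ax Bx]|x [Ax [a [Aa Ba] /= Wx]]]; split=> //.
  by exists x => //=; rewrite mulVg; exact: subg1.
rewrite -(mulVKg a x); apply: (subgM sB) => //; apply: iP; split=> //.
by apply: (subgM sA) => //; exact: (subgV sA).
Qed.

Lemma open_in_near A B : A 1 -> B 1 -> open_in A (A `&` B) -> near_sub A B.
Proof.
move=> A1 B1 [U oU AB].
have [n nU] : exists n, W n `<=` U.
  case: (ls_base ls) => _ _; apply => //.
  by have : (A `&` B) 1 by []; rewrite AB => -[].
exists n => x [Ax /nU Ux]; suff [] : (A `&` B) x by [].
by rewrite AB.
Qed.

Lemma locally_equivalentP A B : is_subgroup A -> is_subgroup B ->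
  locally_equivalent A B <-> near_sub A B /\ near_sub B A.
Proof.
move=> sA sB; have A1 := subg1 sA; have B1 := subg1 sB; split=> [[oA oB]|[AB BA]].
  by split; apply: open_in_near => //; rewrite setIC.
by split; [|rewrite setIC]; exact: near_open_in.
Qed.

Lemma local_class_eq H A B : is_subgroup A -> is_subgroup B ->
  near_sub A B -> near_sub B A -> local_class H A = local_class H B.
Proof.
move=> sA sB AB BA; apply/seteqP; split=> C [sC CH];
  move/(locally_equivalentP _ sC) => [] // XC CX; split=> //;
  by apply/locally_equivalentP => //; split;
    [apply: near_sub_trans XC|apply: (near_sub_trans ls CX)].
Qed.

Lemma local_class_conj H A g : conj_set H g = H ->
  conj_class (local_class H A) g `<=` local_class H (conj_set A g).
Proof.
move=> HJ _ [B [sB BH [oA oB]] <-].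
have JI : conj_set (A `&` B) g = conj_set A g `&` conj_set B g by rewrite !conj_setE.
split; first exact: is_subgroup_conj_set.
  by rewrite -HJ; exact: conj_set_mono.
by split; rewrite -JI; exact: open_in_conj.
Qed.

Lemma LN_fixed_normalised H A : is_subgroup H -> is_subgroup A -> A `<=` H ->
  closed_in H A -> normalised H A -> LN_fixed H (local_class H A).
Proof.
move=> sH sA AH cA nA.
have fixA g : H g -> conj_class (local_class H A) g `<=` local_class H A.
  move=> Hg; rewrite -[X in _ `<=` local_class _ X](conj_set_sub sH nA Hg).
  by apply: local_class_conj; apply: (conj_set_sub sH _ Hg); exact: normalised_self.
have [_ _ nHA] : normal_in H A by apply/normal_inP.
split=> [|g Hg].
  by exists A; split=> //; split=> //; rewrite nHA; exists setT; [exact: openT|rewrite setIT].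
apply/seteqP; split; first exact: fixA.
move=> B lB; exists (conj_set B g^-1); last exact: conj_setKV.
by apply: (fixA g^-1); [exact: subgV|exists B].
Qed.

(** A neighbourhood of 1 in G is contained in the product of a small part of the component, which
    normalises A, and C(X), which centralises it. *)
Lemma locally_normal_lnc X A : atom X -> locally_normal (comp X) A ->
  closed_in (comp X) A -> lnc A.
Proof.
move=> aX [sA AP [U oU nU]] cA; split=> //; first exact: closed_comp cA.
have sP := comp_subgroup aX.
have [k kU] : exists k, W k `<=` U.
  case: (ls_base ls) => _ _; apply => //.
  suff : normalizer (comp X) A 1 by rewrite nU => -[].
  by split; [exact: subg1|rewrite conj_set1].
have [i iP] := near_comp aX.
have [l lP] := lnc_complement ls qzG (maxn i k) (atom_lnc aX).
have [_ dW _] := ls_base ls.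
exists l => v x /lP [a [Xa Wa Ca]] Ax; rewrite -(mulVKg a v) conjgM.
have [_ nA] : normalizer (comp X) A a.
  rewrite nU; split; [apply: iP; split=> //|apply: kU].
    by apply: dW _ _ _ _ Wa; exact: leq_maxl.
  by apply: dW _ _ _ _ Wa; exact: leq_maxr.
have Axa : A (x ^ a) by rewrite -nA; exists x.
by rewrite conj_fix //; apply: commute_sym; apply: Ca; apply: comp_sub; exact: AP.
Qed.

(** A representative A of a fixed class need not be normal, but its centraliser depends only on the
    class. Hence C(C(A)) is normalised by the component, so by O, and minimality leaves 1 and X. *)
Lemma LN_fixed_comp X : atom X ->
  LN_fixed (comp X) = [set LN0 (comp X); LNoo (comp X)].
Proof.
move=> aX; have sP := comp_subgroup aX; have [[rX nX] _ _ mX] := aX.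
apply/seteqP; split; last first.
  move=> _ [->|->]; apply: LN_fixed_normalised => //.
  - exact: is_subgroup1.
  - by move=> _ ->; exact: subg1.
  - exists [set 1]; first exact: (accessible_closed_set1 (hausdorff_accessible hG)).
    by apply/seteqP; split=> [x ->|x []//]; split=> //; exact: subg1.
  - by move=> g x _ ->; rewrite conj1g.
  - by exists setT; [exact: closedT|rewrite setIT].
  - exact: normalised_self.
move=> a [[A [nA cA ->]] fixA]; have lA := locally_normal_lnc aX nA cA.
have [sA AP _] := nA; have AX := subset_trans AP (@comp_sub X).
have eqJ g : comp X g -> cent (conj_set A g) = cent A.
  move=> Pg; have lAg := lnc_conj ls g lA; have [sAg _ _] := lAg.
  have : local_class (comp X) A (conj_set A g).
    rewrite -(fixA g Pg); exists A => //; split=> //.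
    by apply/locally_equivalentP => //; split; exact: near_sub_sub.
  move=> [_ _ /(locally_equivalentP sA sAg) [AAg AgA]].
  by apply/seteqP; split; apply: (cent_near ls qzG).
have CX : cent (cent A) `<=` X by exact: cent2_sub rX AX.
have nC : normalised O (cent (cent A)).
  apply: (normal_comp_Oc aX CX) => g x Pg Cx.
  by rewrite -(eqJ g Pg) !cent_conj_set; exists x.
have [e|e] := mX _ (regular_cent2 ls hG lA) nC CX.
  by left; rewrite (cent2_eq1 lA e).
right; apply: local_class_eq => //; first by apply: near_sub_sub.
apply: (@near_sub_trans _ _ ls _ X); first by apply: near_sub_sub; exact: comp_sub.
by rewrite -[X in near_sub X _]e; exact: (near_cent2 ls hG qzG lA).
Qed.

(** * Noncompactness of the components *)

(** Modulo [W 0], which normalises every [W k], finitely many elements of H suffice. *)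
Lemma uniform_conj H k : compact H ->
  exists l, forall g y, H g -> W l y -> W k (y ^ g).
Proof.
move=> cH; have [s sP] := compact_coset_reps cH (sW 0) (oW 0).
have [_ dW _] := ls_base ls.
have [l lP] : exists l, forall c y, c \in s -> W l y -> W k (y ^ c).
  elim: s {sP} => [|c s [l IHs]]; first by exists 0%N.
  have [i iP] := near1 ls k (@continuous_conjl _ c) (conj1g _).
  exists (maxn l i) => c' y; rewrite inE => /orP [/eqP ->|c's] Wy.
    by apply: iP; apply: dW _ _ _ _ Wy; exact: leq_maxr.
  by apply: IHs => //; apply: dW _ _ _ _ Wy; exact: leq_maxl.
exists l => g y /sP [c cs Wcg] Wy.
by rewrite -(mulVKg c g) conjgM; apply: (ls_normal ls) => //; exact: lP.
Qed.

Lemma open_normal_near X N : atom X ->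
  open_normal (comp X) N <->
  [/\ is_subgroup N, N `<=` comp X, normalised (comp X) N & near_sub X N].
Proof.
move=> aX; split=> [[sN NP nN oN]|[sN NP nN XN]]; split=> //.
  exact: open_near (subg1 sN) oN.
exact: near_open.
Qed.

(** The witness is the set of elements whose conjugates all lie in some [W k] not containing the
    component; compactness makes it open. *)
Lemma proper_open_normal X : atom X -> compact (comp X) ->
  exists2 N, open_normal (comp X) N & N <> comp X.
Proof.
move=> aX cP; have sP := comp_subgroup aX.
have [k kP] : exists k, ~ comp X `<=` W k.
  apply/existsNP => PW; apply: (comp_neq1 aX); apply/seteqP; split=> [x Px|_ ->].
    by apply: level_sep => k; exact: PW.
  exact: subg1.
have [l lP] := uniform_conj k cP.
exists [set x | comp X x /\ forall g, comp X g -> W k (x ^ g)]; last first.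
  by move=> e; apply: kP => x; rewrite -e => -[_ /(_ 1 (subg1 sP))]; rewrite conjg1.
apply/open_normal_near => //; split.
- split=> [|x y [Px Wx] [Py Wy]|x [Px Wx]].
  + by split=> [|g _]; rewrite ?conj1g; exact: subg1.
  + split=> [|g Pg]; first exact: subgM.
    by rewrite conjMg; apply: (subgM (sW k)); [exact: Wx|exact: Wy].
  + split=> [|g Pg]; first exact: subgV.
    by rewrite conjVg; apply: (subgV (sW k)); exact: Wx.
- by move=> x [].
- move=> g x Pg [Px Wx]; split=> [|h Ph]; first exact: subgJ.
  by rewrite -conjgM; apply: Wx; exact: subgM.
apply: (near_sub_trans ls (near_comp aX)); exists l => x [Px Wx].
by split=> // g Pg; exact: lP.
Qed.

(* Otherwise there is a strictly increasing sequence of proper open normal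
   subgroups, which covers their union, an open and hence compact subgroup. *)
Lemma exists_max_open_normal X : atom X -> compact (comp X) ->
  exists M, max_open_normal (comp X) M.
Proof.
move=> aX cP; apply: contrapT => nM; have sP := comp_subgroup aX.
pose Q N := open_normal (comp X) N /\ N <> comp X.
have step N : exists N', Q N -> [/\ Q N', N `<=` N' & N <> N'].
  have [[oN NP]|] := pselect (Q N); last by exists N.
  apply: contrapT => nN; apply: nM; exists N; split=> // N' oN' NN'.
  have [|N'P] := pselect (N' = comp X); [by right|left].
  by apply: contrapT => ne; apply: nN; exists N' => _; split=> // e; apply: ne.
have [f fP] := @boolp.choice _ _ _ step.
have [N0 oN0 N0P] := proper_open_normal aX cP.
pose M k := iter k f N0.
have QM k : Q (M k) by elim: k => [//|k IHk] /=; have [] := fP _ IHk.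
have MS i j : (i <= j)%N -> M i `<=` M j.
  move=> /subnK <-; elim: (j - i)%N => // k IHk x /IHk Mx.
  by have [_ + _] := fP _ (QM (k + i)%N); exact.
have sM k : is_subgroup (M k) by have [[]] := QM k.
have MP k : M k `<=` comp X by have [[]] := QM k.
have XM k : near_sub X (M k) by have [/(open_normal_near _ aX) []] := QM k.
pose U := \bigcup_k M k.
have sU : is_subgroup U.
  split; first by exists 0%N => //; exact: subg1.
    move=> x y [i _ Mx] [j _ My]; exists (maxn i j) => //; apply: subgM => //.
      by apply: MS _ _ _ _ Mx; exact: leq_maxl.
    by apply: MS _ _ _ _ My; exact: leq_maxr.
  by move=> x [i _ Mx]; exists i => //; exact: subgV.
have UP : U `<=` comp X by move=> x [i _ /MP].
have XU : near_sub X U.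
  by apply: (near_sub_trans ls (XM 0%N)); apply: near_sub_sub => x; exists 0%N.
have [oU' sU'] := near_mulc aX sU UP XU.
(* The sets U minus [mulc (M k) X] are closed in G and decrease; by [mulcI] they equal U minus
   [M k]. A common point would lie in U but in no [M k]. *)
have [||i j ij x [Ux nMx]|k|x xP] := @compact_decreasing _ _
  (fun k => U `&` ~` mulc (M k) X) cP.
- by move=> x [/UP].
- move=> k; apply: closedI; last first.
    by apply: open_closedC; case: (near_mulc aX (sM k) (MP k) (XM k)).
  by apply: (closed_comp aX); exact: near_closed.
- split=> // -[a Ma Ca]; apply: nMx; exists a => //; exact: MS Ma.
- have [Q' MM' ne] := fP _ (QM k).
  have [|x [Mx nMx]] := @nonsubset _ (M k.+1) (M k).
    by move=> MM; apply: ne; apply/seteqP.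
  exists x; split; first by exists k.+1.
  move=> mx; apply: nMx; rewrite -(mulcI aX (sM k) (MP k)); split=> //.
  exact: MP Mx.
have [[k _ Mx] _] := xP 0%N; have [_] := xP k; apply.
by apply: mulset_sub => //; exact: is_subgroup_cent.
Qed.

(** For profinite H this is known as the Melnikov subgroup. *)
Definition radical H : set G := meet H (max_open_normal H).

(* If E is closed normal and not in M, and E meets M outside the maximal open
   normal subgroup N, then E /\ N is not in M either: as N (E /\ M) is the
   whole group, E <= (E /\ N) (E /\ M). *)
Lemma radical_step X M E : atom X -> max_open_normal (comp X) M ->
  radical (comp X) = [set 1] ->
  is_subgroup E -> closed E -> E `<=` comp X -> normalised (comp X) E ->
  ~ E `<=` M ->
  exists N, [/\ open_normal (comp X) N, ~ E `<=` N & ~ E `&` N `<=` M].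
Proof.
move=> aX mM rad1 sE cE EP nE EM; have sP := comp_subgroup aX.
have [oM MP _] := mM; have /(open_normal_near _ aX) [sM MsP nM [i iM]] := oM.
have [E1|[j jE]] := comp_normal_subgroup aX sE cE EP nE.
  by case: EM; rewrite E1 => _ ->; exact: subg1.
have [z [[Ez Mz] z1]] : exists z, (E `&` M) z /\ z <> 1.
  apply: contrapT => EM1; apply: (not_near1 aX); exists (maxn i j) => z [Xz Wz].
  have [_ dW _] := ls_base ls; apply: contrapT => z1; apply: EM1; exists z; split=> //.
  split; [apply: jE|apply: iM]; split=> //; apply: dW _ _ _ _ Wz.
    exact: leq_maxr.
  exact: leq_maxl.
have [N mN nNz] : exists2 N, max_open_normal (comp X) N & ~ N z.
  apply: contrapT => nN; apply: z1; suff : radical (comp X) z by rewrite rad1.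
  split=> [|N mN]; first exact: EP.
  by apply: contrapT => nNz; apply: nN; exists N.
have [oN _ maxN] := mN; have /(open_normal_near _ aX) [sN NP nN XN] := oN.
exists N; split=> // [/(_ z Ez)//|EN].
have sEM : is_subgroup (E `&` M) by exact: is_subgroupI.
have nEM : normalised (comp X) (E `&` M) by exact: normalisedI.
pose T := mulset N (E `&` M).
have NT : N `<=` T by exact: mulset_sub.
have oT : open_normal (comp X) T.
  apply/open_normal_near => //; split.
  - by apply: mulset_subgroup => // v x /NP; exact: nEM.
  - move=> x [a /NP Pa [/EP Pax _]]; rewrite -(mulVKg a x); exact: subgM.
  - move=> v x Pv /(mulset_conj v); rewrite (conj_set_sub sP nN Pv).
    by rewrite (conj_set_sub sP nEM Pv).
  by apply: (near_sub_trans ls XN); exact: near_sub_sub.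
have [TN|TP] := maxN T oT NT.
  apply: nNz; rewrite -TN; exists 1; first exact: subg1.
  by rewrite invg1 mul1g.
apply: EM => e Ee; have := EP e Ee; rewrite -TP => -[a Na [Ea Ma]].
rewrite -(mulVKg a e); apply: (subgM sM) => //; apply: EN; split=> //.
by apply: (subgVP sE); apply: (subg_cancelr sE Ee).
Qed.

(* Otherwise the previous lemma yields a strictly decreasing sequence of closed
   normal subgroups not contained in M. By compactness the intersection is not
   contained in M either, so that it is open and is reached. *)
Lemma radical_neq1 X : atom X -> compact (comp X) -> radical (comp X) <> [set 1].
Proof.
move=> aX cP rad1; have sP := comp_subgroup aX.
have [M mM] := exists_max_open_normal aX cP; have [oM MP _] := mM.
have /(open_normal_near _ aX) [sM MsP nM XM] := oM.
pose Q E := [/\ is_subgroup E, closed E, E `<=` comp X,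
  normalised (comp X) E & ~ E `<=` M].
have step E : exists E', Q E -> [/\ Q E', E' `<=` E & ~ E `<=` E'].
  have [[sE cE EP nE EM]|] := pselect (Q E); last by exists E.
  have [N [oN EN ENM]] := radical_step aX mM rad1 sE cE EP nE EM.
  have /(open_normal_near _ aX) [sN NP nN XN] := oN.
  exists (E `&` N) => _; split; [split=> //|by move=> x []|].
  - exact: is_subgroupI.
  - by apply: closedI => //; apply: (closed_comp aX); exact: near_closed.
  - by move=> x [/EP].
  - exact: normalisedI.
  - by move=> EE; apply: EN => x /EE [].
have [f fP] := @boolp.choice _ _ _ step.
pose E k := iter k f (comp X).
have QE k : Q (E k).
  elim: k => [|k IHk] /=; last by have [] := fP _ IHk.
  split=> //; [by case: (comp_lnc aX)|exact: normalised_self|].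
  by move=> PM; apply: MP; apply/seteqP.
have ES i j : (i <= j)%N -> E j `<=` E i.
  move=> /subnK <-; elim: (j - i)%N => // k IHk x Ex; apply: IHk.
  by have [_ + _] := fP _ (QE (k + i)%N); exact.
(* If no [E k] is inside the open subgroup A, compactness gives a point of all [E k] outside A. This
   is used for M, to see that the intersection is nontrivial, and then for the intersection
   itself. *)
have dec A : is_subgroup A -> A `<=` comp X -> near_sub X A ->
    (forall k, ~ E k `<=` A) -> exists x, ~ A x /\ forall k, E k x.
  move=> sA AP XA EA; have [oA sA'] := near_mulc aX sA AP XA.
  have [||i j ij x [/(ES _ _ ij) Ex nA]|k|x xP] := @compact_decreasing _ _
    (fun k => E k `&` ~` mulc A X) cP.
  - by move=> x [].
  - by move=> k; apply: closedI; [case: (QE k)|exact: open_closedC].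
  - by split.
  - have [x [Ex nAx]] := nonsubset (EA k).
    exists x; split=> // mx; apply: nAx; rewrite -(mulcI aX sA AP); split=> //.
    by case: (QE k) => _ _ EP _ _; exact: EP.
  exists x; split=> [Ax|k]; last by case: (xP k).
  have [_] := xP 0%N; apply; apply: mulset_sub => //; exact: is_subgroup_cent.
pose A := \bigcap_k E k.
have AP : A `<=` comp X by move=> x /(_ 0%N I).
have sA : is_subgroup A by apply: is_subgroup_bigcap => k _; case: (QE k).
have [A1|XA] : A = [set 1] \/ near_sub X A.
  apply: comp_normal_subgroup => //.
    by apply: closed_bigI => k _; case: (QE k).
  by move=> v x Pv Ax k _; case: (QE k) => _ _ _ nE _; apply: nE => //; exact: Ax.
  have [|x [nMx Ex]] := dec M sM MsP XM; first by move=> k; case: (QE k).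
  apply: nMx; have : A x by move=> k _.
  by rewrite A1 => ->; exact: subg1.
have [k|x [nAx Ex]] := dec A sA AP XA; last by apply: nAx => k _.
by have [_ _ EE] := fP _ (QE k) => EA; apply: EE => x /EA /(_ k.+1 I).
Qed.

Lemma comp_noncompact X : atom X -> ~ compact (comp X).
Proof.
move=> aX cX; have [|H N g|e|e] := @comp_meet max_open_normal X _ _ aX.
- by move=> H M [].
- exact: max_open_normal_conj.
- exact: radical_neq1 e.
have [M mM] := exists_max_open_normal aX cX; have [[_ MX _ _] MP _] := mM.
by apply: MP; apply/seteqP; split=> // x; rewrite -{1}e => -[_ /(_ M mM)].
Qed.

Lemma enum_atoms : exists n (X : 'I_n -> set G),
  [/\ injective X, forall i, atom (X i) & forall Y, atom Y -> exists i, X i = Y].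
Proof.
have [s us sP] := finite_uniq_seq finite_atom.
exists (size s), (tnth (in_tuple s)); split=> [|i|Y].
- exact/tuple_uniqP.
- by apply/sP; exact: mem_tnth.
- by move=> /sP Ys; have /tnthP [i ->] : Y \in in_tuple s by []; exists i.
Qed.

Lemma comp_product_Res n (X : 'I_n -> set G) : injective X ->
  (forall i, atom (X i)) -> (forall Y, atom Y -> exists i, X i = Y) ->
  direct_product (fun i => comp (X i)) R.
Proof.
move=> injX aX surX; apply: comp_product => //.
- by case: lnc_Res.
- by move=> i x [].
by move=> Z /surX [i <-] /(_ i).
Qed.

End Components.

Theorem theorem4p11 (G : topGroupType) :
  tdlc G -> type_JB G -> QZ [set: G] = [set 1] ->
  (exists O : set G, [/\ is_subgroup O, open O & direct_factor (Res [set: G]) O])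
  /\
  exists (n : nat) (P : 'I_n -> set G),
    [/\ direct_product P (Res [set: G]),
        (forall i, directly_indecomposable (P i)),
        (forall A : set G, direct_factor A (Res [set: G]) ->
           exists J : {set 'I_n},
             direct_product (fun j : {i : 'I_n | i \in J} => P (val j)) A),
        (forall i,
           [/\ ~ compact (P i),
               loc_just_infinite_branch (P i),
               LN_fixed (P i) = [set LN0 (P i); LNoo (P i)] &
               forall K : set G, is_subgroup K -> K `<=` P i ->
                 closed_in (P i) K -> normalizer [set: G] K = [set: G] ->
                 K = [set 1] \/ K = P i]) &
        (forall i,
           (residually_discrete (P i) /\ ~ topologically_simple (P i)) \/
           (topologically_simple (P i) /\ ~ residually_discrete (P i)))].
Proof.
move=> [hG _ _] [_ _ _ _ lb] qzG; have [W ls] := local_structure_exists lb.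
split.
  exists (Oc (G := G)); split; [exact: Oc_subgroup|exact: (Oc_open ls qzG)|].
  by exists (cent (Res [set: G])); exact: (direct_product2_Res ls hG qzG).
have [n [X [injX aX surX]]] := enum_atoms ls qzG.
exists n, (fun i => comp (X i)); split.
- exact: (comp_product_Res ls hG qzG injX aX surX).
- by move=> i; exact: (comp_indecomposable ls hG qzG (aX i)).
- by move=> A; exact: (factor_product ls hG qzG injX aX surX).
- move=> i; split.
  + exact: (comp_noncompact ls hG qzG (aX i)).
  + exact: (comp_loc_branch ls hG qzG (aX i)).
  + exact: (LN_fixed_comp ls hG qzG (aX i)).
  + move=> K sK KP cK nK; apply: (comp_invariant ls hG qzG (aX i)) => //.
    have [|_ _ //] := (normal_inP K (@is_subgroupT G)).1.
    by split.
- by move=> i; exact: (comp_type ls hG qzG (aX i)).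
Qed.
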